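(* Let $M$ be a smooth $n$-dimensional manifold with a polyhedral mesh $\mathcal{T}$, let $\alpha=(\alpha^1,\dots,\alpha^k)$ be a Pfaffian system on $M$ which is piecewise-$C^1$ with respect to $\mathcal{T}$, let $D=\ker\alpha$, and let $x_0\in M$. Suppose the following conditions hold: 1. There exists an open neighborhood $U$ of $x_0$ such that, for each top-dimensional polytope $T\ni x_0$, $\alpha_T$ can be extended to a $C^1$ Pfaffian system on $U$ (still denoted $\alpha_T$), and there exists a smooth $\mathfrak{gl}(k)$-valued one-form $A_T=({A_T}^i_j)_{i,j=1}^k$ on $U$ such that $d\alpha_T^i=-\sum_{j=1}^k {A_T}^i_j\wedge\alpha_T^j$ for all $i=1,\dots,k$ and $d{A_T}^i_j+\sum_{l=1}^k {A_T}^i_l\wedge {A_T}^l_j=0$ for all $i,j=1,\dots,k$. 2. If $\Delta$ is any polytope of the mesh containing $x_0$ and $T,T'$ are top-dimensional polytopes both containing $\Delta$ as a face, then $i_\Delta^*\alpha_T=i_\Delta^*\alpha_{T'}$ and $i_\Delta^*A_T=i_\Delta^*A_{T'}$ on $U\cap\Delta$. 3. There exists a $k$-dimensional subspace $V\subset T_{x_0}M$ such that for any set of non-negative weights $\{c^T\}_{T\ni x_0}$ (indexed by the top-dimensional polytopes containing $x_0$) satisfying $\sum_T c^T=1$, the linear map $\sum_T c^T\alpha_T|_{x_0}:T_{x_0}M\to\mathbb{R}^k$ has full rank when restricted to $V$. Then $D=\ker\alpha$ is completely integrable by continuous piecewise-$C^1$ diffeomorphisms at $x_0$.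
   Context: A polyhedral mesh $\mathcal{T}$ on the smooth $n$-manifold $M$ (which may have polyhedral boundary) is a set of subsets $\Delta\subset M$, called polytopes of the mesh, which cover $M$, such that each $\Delta$ is the image of a closed convex $(n-d)$-dimensional polytope $\hat\Delta\subset\mathbb{R}^{n-d}$ under a smooth embedding $f_\Delta:\mathbb{R}^{n-d}\to M$; such a $\Delta$ has codimension $d$. The image under $f_\Delta$ of each face of $\hat\Delta$ is also a polytope of the mesh, called a face of $\Delta$, and the intersection of any two polytopes of the mesh is either empty or a face of both. The mesh is locally finite. Polytopes of codimension $0$ are called top-dimensional and are denoted $T,T'$. $i_\Delta:\Delta\to M$ denotes the inclusion. A piecewise-$C^1$ Pfaffian system $\alpha=(\alpha^1,\dots,\alpha^k)$ (with respect to $\mathcal{T}$) is a $k$-tuple of differential one-forms, pointwise linearly independent, whose restriction $\alpha_T=(\alpha_T^1,\dots,\alpha_T^k)$ to each top-dimensional polytope $T$ is continuously differentiable; it need not be continuous across different polytopes, so on shared faces it may take several values, one $\alpha_T$ for each $T$ containing the point. The distribution $D=\ker\alpha$ is given on each $T$ by $D_x=\ker\alpha_T^1|_x\cap\dots\cap\ker\alpha_T^k|_x$, and $\alpha$ is called an annihilator of $D$. At a point $x\in T$, $\alpha_T|_x$ is regarded as a linear map $T_xM\to\mathbb{R}^k$. A map $\Phi:U\subset M\to\mathbb{R}^n$ on an open set $U$ is a continuous piecewise-$C^1$ diffeomorphism onto its image if $\Phi$ is a continuous one-to-one open map and $\Phi|_T$ (on $U\cap T$) is a $C^1$ embedding for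 each top-dimensional $T$. A piecewise-$C^1$ Pfaffian system $\alpha$ is trivializeable by continuous piecewise-$C^1$ diffeomorphisms at $x_0\in M$ if there exist an open set $U\ni x_0$ and a continuous piecewise-$C^1$ diffeomorphism onto its image $\Phi:U\to\mathbb{R}^n$ such that $\alpha_T^i=\Phi|_T^*dy^i$ for $i=1,\dots,k$ and each top-dimensional $T$ containing $x_0$, where $y^1,\dots,y^n$ are the standard coordinates on $\mathbb{R}^n$. The distribution $D$ is completely integrable by continuous piecewise-$C^1$ diffeomorphisms at $x_0$ if it has a piecewise-$C^1$ annihilator that is trivializeable by continuous piecewise-$C^1$ diffeomorphisms at $x_0$.
   Formalization: M is taken inside a boundaryless n-manifold containing the images of the f_Δ, and x_0 must be an interior point of M (automatic without boundary); at a boundary point no continuous one-to-one open map Φ:U→R^n exists, e.g. M=[0,1], x_0=0, α=dx. *)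

(* Defs.v *)
From HB Require Import structures.
From mathcomp Require Import all_boot all_order all_algebra.
From mathcomp Require Import all_classical all_reals all_analysis.
Import Order.TTheory GRing.Theory Num.Theory numFieldNormedType.Exports.

Set Implicit Arguments.
Unset Strict Implicit.
Unset Printing Implicit Defensive.

Local Open Scope classical_set_scope.
Local Open Scope ring_scope.

(* f is of class C^r on the open set O. In finite dimension, continuity of the
   differential amounts to continuity of every directional derivative. *)
Fixpoint Cr_on (R : realType) (V W : normedModType R) (r : nat) (O : set V)
    (f : V -> W) {struct r} : Prop :=
  match r with
  | 0%N => forall x, O x -> {for x, continuous f}
  | r'.+1 => (forall x, O x -> differentiable f x) /\
             (forall v, Cr_on r' O (fun x => 'd f x v))
  end.

Definition smooth_on (R : realType) (V W : normedModType R) (O : set V)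
    (f : V -> W) : Prop := forall r, Cr_on r O f.

Definition top_embedding (X Y : topologicalType) (S : set X) (f : X -> Y) :=
  [/\ {within S, continuous f}, {in S &, injective f} &
      forall O, open O -> exists2 O', open O' & f @` (S `&` O) = f @` S `&` O'].

(* cmap and cinv are total functions with junk values off cdom and
   cmap @` cdom respectively. *)
Record chart (R : realType) (n : nat) (X : topologicalType) := Chart {
  cdom : set X;
  cmap : X -> 'rV[R]_n;
  cinv : 'rV[R]_n -> X;
  cdom_open : open cdom;
  cimg_open : open (cmap @` cdom);
  cmapK : {in cdom, cancel cmap cinv};
  cmap_continuous : {within cdom, continuous cmap};
  cinv_continuous : {within cmap @` cdom, continuous cinv}
}.

(* Smooth n-manifolds without boundary. The atlas need not be maximal. The
   choice of a preferred chart around each point serves only to realise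
   the tangent space T_x N concretely: T_x N is 'rV[R]_n, a row vector standing
   for the tangent vector having these components in the chart chart_at x. *)
Record smoothManifold (R : realType) (n : nat) := SmoothManifold {
  carrier :> topologicalType;
  carrier_hausdorff : hausdorff_space carrier;
  carrier_second_countable : @second_countable carrier;
  atlas : set (chart R n carrier);
  chart_at : carrier -> chart R n carrier;
  chart_at_atlas : forall x, atlas (chart_at x);
  chart_at_dom : forall x, cdom (chart_at x) x;
  atlas_compatible : forall c c', atlas c -> atlas c' ->
    smooth_on (cmap c @` (cdom c `&` cdom c')) (cmap c' \o cinv c)
}.

Section Calculus.
Variables (R : realType) (n : nat) (N : smoothManifold R n).

(* Differential at p of a map into N, with values in T_{F p} N. *)
Definition diff_into (m : nat) (F : 'rV[R]_m -> N) (p v : 'rV[R]_m)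
    : 'rV[R]_n :=
  'd (cmap (chart_at (F p)) \o F) p v.

(* Differential at x of a map out of N, defined on T_x N. *)
Definition diff_from (m : nat) (G : N -> 'rV[R]_m) (x : N) (v : 'rV[R]_n)
    : 'rV[R]_m :=
  'd (G \o cinv (chart_at x)) (cmap (chart_at x) x) v.

Definition Cr_from (m r : nat) (W : set N) (G : N -> 'rV[R]_m) : Prop :=
  forall c, atlas c -> Cr_on r (cmap c @` (W `&` cdom c)) (G \o cinv c).

Definition smooth_into (m : nat) (F : 'rV[R]_m -> N) : Prop :=
  continuous F /\
  forall c, @atlas _ _ N c -> smooth_on (F @^-1` cdom c) (cmap c \o F).

Definition smooth_embedding (m : nat) (F : 'rV[R]_m -> N) : Prop :=
  [/\ smooth_into F, top_embedding setT F & forall p, injective (diff_into F p)].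

(* The value at x is an element of the dual of T_x N = 'rV_n; outside
   the set on which a form is considered its values are irrelevant. *)
Definition oneform := N -> 'cV[R]_n.

Definition pairing (w : 'cV[R]_n) (v : 'rV[R]_n) : R := (v *m w) 0 0.

Definition pullback (m : nat) (F : 'rV[R]_m -> N) (w : oneform)
    (p v : 'rV[R]_m) : R :=
  pairing (w (F p)) (diff_into F p v).

Definition form_Cr (r : nat) (U : set N) (w : oneform) : Prop :=
  forall c, atlas c -> forall v : 'rV[R]_n,
    Cr_on r (cmap c @` (U `&` cdom c))
      ((fun y => pullback (cinv c) w y v) : 'rV[R]_n -> R^o).

Definition form_smooth (U : set N) (w : oneform) : Prop :=
  forall r, form_Cr r U w.

(* Exterior derivative, d w (v1, v2) = D_v1 w(v2) - D_v2 w(v1), computed at x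
   in the chart chart_at x, i.e. the one in which v1, v2 are expressed. *)
Definition ext_d (w : oneform) (x : N) (v1 v2 : 'rV[R]_n) : R :=
  let c := chart_at x in
  let local v : 'rV[R]_n -> R^o := fun y => pullback (cinv c) w y v in
  'd (local v2) (cmap c x) v1 - 'd (local v1) (cmap c x) v2.

Definition wedge (a b : oneform) (x : N) (v1 v2 : 'rV[R]_n) : R :=
  pairing (a x) v1 * pairing (b x) v2 - pairing (a x) v2 * pairing (b x) v1.

(* L is the differential at x of the restriction of F to S, differentiability on
   an arbitrary subset S meaning existence of local extensions. When S is
   the intersection of an open set with a top-dimensional polytope, L does not
   depend on the extension. *)
Definition restr_diff (m : nat) (S : set N) (F : N -> 'rV[R]_m) (x : N)
    (L : 'rV[R]_n -> 'rV[R]_m) : Prop :=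
  exists (W : set N) (G : N -> 'rV[R]_m),
    [/\ open W, W x, Cr_from 1 W G,
        (forall z, (W `&` S) z -> G z = F z) & diff_from G x = L].

Definition C1_embedding_on (m : nat) (S : set N) (F : N -> 'rV[R]_m) : Prop :=
  top_embedding S F /\
  forall x, S x -> exists2 L, restr_diff S F x L & injective L.

Definition form_map (k : nat) (a : 'I_k -> oneform) (x : N) (v : 'rV[R]_n)
    : 'rV[R]_k :=
  \row_i pairing (a i x) v.

Definition indep_on (k : nat) (S : set N) (a : 'I_k -> oneform) : Prop :=
  forall x, S x -> free [tuple a i x | i < k].

Definition C1_pfaffian_on (k : nat) (U : set N) (a : 'I_k -> oneform) : Prop :=
  indep_on U a /\ forall i, form_Cr 1 U (a i).

(* Same, on a set S that need not be open (local C^1 extensions). *)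
Definition restr_C1_pfaffian (k : nat) (S : set N) (a : 'I_k -> oneform)
    : Prop :=
  indep_on S a /\
  forall i x, S x -> exists (W : set N) (w : oneform),
    [/\ open W, W x, form_Cr 1 W w & forall z, (W `&` S) z -> w z = a i z].

End Calculus.

Definition convex_polytope (R : realType) (m : nat) (P : set 'rV[R]_m) : Prop :=
  [/\ P° !=set0, bounded_set P &
      exists (q : nat) (a : 'I_q -> 'cV[R]_m) (b : 'I_q -> R),
        P = [set p | forall i, pairing (a i) p <= b i]].

(* Nonempty faces; P is a face of itself (a = 0, b = 0). *)
Definition polytope_face (R : realType) (m : nat) (P F : set 'rV[R]_m) : Prop :=
  F !=set0 /\
  exists (a : 'cV[R]_m) (b : R),
    (forall p, P p -> pairing a p <= b) /\
    F = P `&` [set p | pairing a p = b].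

(* A convex polytope of R^m together with a map from the whole of R^m to N. *)
Record cell (R : realType) (n : nat) (N : smoothManifold R n) := Cell {
  cdim : nat;
  cmodel : set 'rV[R]_cdim;
  cparam : 'rV[R]_cdim -> N;
  cmodel_polytope : convex_polytope cmodel;
  cparam_embedding : smooth_embedding cparam
}.

Arguments cmodel {R n N} c _.
Arguments cparam {R n N} c _.

Definition cell_face (R : realType) (n : nat) (N : smoothManifold R n)
    (C : cell N) (G : set N) : Prop :=
  exists2 F, polytope_face (cmodel C) F & G = cparam C @` F.

(* Polyhedral mesh on a subset M of N. The subset M plays the role of
   the manifold carrying the mesh: M = setT is the case without boundary, while
   a manifold with polyhedral boundary is seen inside a manifold N without
   boundary, in which the embeddings of the whole of R^(n-d) can take their
   values. For D in polys, mcell D is the chosen presentation of D as an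
   embedded polytope; its dimension is n - d, where d is the codimension of D. *)
Record mesh (R : realType) (n : nat) (N : smoothManifold R n) (M : set N) :=
  Mesh {
  polys : set (set N);
  mcell : set N -> cell N;
  mesh_dim : forall D, polys D -> (cdim (mcell D) <= n)%N;
  mesh_image : forall D, polys D ->
    D = cparam (mcell D) @` cmodel (mcell D);
  mesh_cover : \bigcup_(D in polys) D = M;
  mesh_faces : forall D G, polys D -> cell_face (mcell D) G -> polys G;
  mesh_inter : forall D D', polys D -> polys D' -> D `&` D' !=set0 ->
    cell_face (mcell D) (D `&` D') /\ cell_face (mcell D') (D `&` D');
  mesh_locally_finite : forall x, M x -> exists W : set N,
    [/\ open W, W x & finite_set [set D | polys D /\ D `&` W !=set0]]
}.

Section Integrability.
Variables (R : realType) (n : nat) (N : smoothManifold R n) (M : set N).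
Variable T : mesh M.

Definition mesh_face (D G : set N) : Prop := cell_face (mcell T D) G.

Definition top_polys : set (set N) := [set P | polys T P /\ cdim (mcell T P) = n].

(* Finite for x in M, by mesh_locally_finite. *)
Definition top_at (x : N) : set (set N) := [set P | top_polys P /\ P x].

(* i_D^* a = i_D^* b on U `&` D, D carrying the smooth structure given by
   its parametrization. *)
Definition pullback_eq (U D : set N) (a b : oneform N) : Prop :=
  let f := cparam (mcell T D) in
  forall p, cmodel (mcell T D) p -> U (f p) ->
    forall v, pullback f a p v = pullback f b p v.

(* a P i is the restriction of the i-th form to the top-dimensional polytope P;
   the values a P i x, for the various P containing x, are unrelated. *)
Definition pw_C1_pfaffian (k : nat) (a : set N -> 'I_k -> oneform N) : Prop :=
  forall P, top_polys P -> restr_C1_pfaffian P (a P).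

Definition distribution := set N -> N -> set 'rV[R]_n.

Definition ker_form (k : nat) (a : set N -> 'I_k -> oneform N) : distribution :=
  fun P x => [set v | forall i, pairing (a P i x) v = 0].

Definition annihilator (k : nat) (a : set N -> 'I_k -> oneform N)
    (D : distribution) : Prop :=
  forall P, top_polys P -> forall x, P x -> ker_form a P x = D P x.

Definition pw_C1_diffeo (U : set N) (Phi : N -> 'rV[R]_n) : Prop :=
  [/\ {within U, continuous Phi}, {in U &, injective Phi},
      (forall O, open O -> O `<=` U -> open (Phi @` O)) &
      forall P, top_polys P -> C1_embedding_on (U `&` P) Phi].

Definition trivializeable (k : nat) (a : set N -> 'I_k -> oneform N) (x0 : N)
    : Prop :=
  exists (U : set N) (Phi : N -> 'rV[R]_n),
    [/\ open U, U x0, U `<=` M, pw_C1_diffeo U Phi &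
        forall P, top_at x0 P -> forall x, (U `&` P) x ->
          exists2 L, restr_diff (U `&` P) Phi x L &
            forall i : 'I_k, exists2 j : 'I_n, i = j :> nat &
              forall v, pairing (a P i x) v = L v 0 j].

Definition completely_integrable (k : nat) (D : distribution) (x0 : N) : Prop :=
  exists b : set N -> 'I_k -> oneform N,
    [/\ pw_C1_pfaffian b, annihilator b D & trivializeable b x0].

End Integrability.

(* Main.v *)
(** In the chart around [x0], the two structure equations say that on each top-dimensional
    polytope the [gl(k+1)]-valued form [[A_T, alpha_T], [0, 0]] is a flat connection. Its parallel
    frame [g_T] with [g_T = 1] at [x0] (a limit of Euler products along rays, so that no theory of
    differential equations or integration is needed) has blocks [G_T] and [Y_T] with
    [d Y_T = G_T alpha_T]. By condition 2 the frames of [T] and [T'] satisfy the same linear equation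
    along every curve in the face [T `&` T'], hence agree there, and the potentials [Y_T] glue to a
    continuous map. Completed by linear coordinates transverse to [V], the [Y_T] become a continuous
    selection of finitely many C^1 maps whose Jacobians at [x0] have, by condition 3, an invertible
    convex hull; Clarke's form of the inverse function theorem then applies. The annihilator is
    [G_T alpha_T] near [x0], where [G_T] is cut off to the identity away from [x0]. *)
Require Import Defs.
From HB Require Import structures.
From mathcomp Require Import all_boot all_order all_algebra.
From mathcomp Require Import all_classical all_reals all_analysis.
From mathcomp Require Import ring lra.
Import Order.TTheory GRing.Theory Num.Theory numFieldNormedType.Exports.
Set Implicit Arguments.
Unset Strict Implicit.
Unset Printing Implicit Defensive.
Local Open Scope classical_set_scope.
Local Open Scope ring_scope.

(** Packing [A] and [alpha] into one connection replaces two successive integrations, of [A] to [G]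
    and of the closed form [G alpha] to [Y], by a single one, and its flatness makes sense for C^1
    coefficients. The Euler products are explicit functions of the endpoint, so they can be
    differentiated in every direction; vanishing curvature makes the derivative of each step correct
    up to [o(h)], and the errors add up to [o(1)]. Gluing has to cope with faces that are curved in
    the chart: two frames are compared along images of segments of the convex model polytope, and
    only near [x0]. That the pieces fill a neighbourhood of [x0] rests on lower-dimensional
    polytopes having empty interior. In the inverse function theorem no generalized Jacobian is
    formed: a vector separating the hull of the images [v *m J] from 0 turns a scalar mean value
    inequality along segments into a lower bound for the selection. Condition 3 concerns [x0] only
    and spreads by continuity of the Jacobians. The cutoff is there because an annihilator lives on
    every top-dimensional polytope, whereas the frames exist only near [x0]. *)

(** * Matrix norms, epsilon-delta forms of the calculus and one-variable estimates *)

Section MatrixNorm.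
Variable R : realType.

Lemma mx_norm_le p q (X : 'M[R]_(p, q)) (e : R) : 0 <= e ->
  (forall i j, `|X i j| <= e) -> `|X| <= e.
Proof.
move=> e0 H; rewrite /Num.Def.normr/= mx_normrE.
by apply: bigmax_le => // -[i j] _ /=; exact: H.
Qed.

Lemma mx_entry_le p q (X : 'M[R]_(p, q)) i j : `|X i j| <= `|X|.
Proof.
rewrite [leRHS]/Num.Def.normr/= mx_normrE.
exact: (le_bigmax _ (fun ij : 'I_p * 'I_q => `|X ij.1 ij.2|) (i, j)).
Qed.

Lemma mx_subE p q (X Y : 'M[R]_(p, q)) i j : (X - Y) i j = X i j - Y i j.
Proof. by rewrite !mxE. Qed.

(** The norm of a matrix is its largest entry, which is not submultiplicative; the inner dimension
    [q] is the price and recurs in the later constants. *)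
Lemma mx_norm_mul p q s (X : 'M[R]_(p, q)) (Y : 'M[R]_(q, s)) :
  `|X *m Y| <= q%:R * `|X| * `|Y|.
Proof.
apply: mx_norm_le => [|i j]; first by rewrite !mulr_ge0.
rewrite mxE (le_trans (ler_norm_sum _ _ _))//.
rewrite (@le_trans _ _ (\sum_(l < q) `|X| * `|Y|))//.
  by apply: ler_sum => l _; rewrite normrM ler_pM// mx_entry_le.
by rewrite sumr_const card_ord -[leLHS]mulr_natl mulrA.
Qed.

Lemma is_derive_mx p q (V : normedModType R) (F : V -> 'M[R]_(p, q)) x v
    (dF : 'M[R]_(p, q)) :
  (forall i j, is_derive x v ((fun y => F y i j) : V -> R^o) (dF i j)) ->
  is_derive x v F dF.
Proof.
move=> H; have dF' : derivable F x v.
  by apply/derivable_mxP => i j; have [] := H i j.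
apply: DeriveDef => //; rewrite derive_mx//; apply/matrixP => i j.
by rewrite mxE; have [_ <-] := H i j.
Qed.

Lemma is_derive_entry p q (V : normedModType R) (F : V -> 'M[R]_(p, q)) x v dF
    i j :
  is_derive x v F dF -> is_derive x v ((fun y => F y i j) : V -> R^o) (dF i j).
Proof.
move=> [H <-]; apply: DeriveDef; first by move/derivable_mxP: H.
by rewrite derive_mx// mxE.
Qed.

Lemma is_derive_mulmx p q s (V : normedModType R) (F : V -> 'M[R]_(p, q))
    (G : V -> 'M[R]_(q, s)) x v dF dG :
  is_derive x v F dF -> is_derive x v G dG ->
  is_derive x v (fun y => F y *m G y) (dF *m G x + F x *m dG).
Proof.
move=> HF HG; apply: is_derive_mx => i j.
have -> : (fun y => (F y *m G y) i j) =
    \sum_l ((fun y => F y i l) * (fun y => G y l j)).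
  by apply/funext => y; rewrite mxE fct_sumE.
apply: is_derive_eq.
  apply: is_derive_sum => l.
  exact: is_deriveM (is_derive_entry i l HF) (is_derive_entry l j HG).
rewrite !mxE -big_split/=; apply: eq_bigr => l _.
by rewrite /GRing.scale/= addrC mulrC [in LHS]addrC; ring.
Qed.

End MatrixNorm.

Section EpsDelta.
Variables (R : realType) (X Y : normedModType R).
Implicit Types (f : X -> Y) (x : X).

Lemma continuous_forP f x : {for x, continuous f} <->
  forall e : R, 0 < e ->
    exists2 d : R, 0 < d & forall y, `|x - y| < d -> `|f x - f y| < e.
Proof.
split=> [cf e e0|H].
  have /cvgrPdist_lt/(_ e e0)/nbhs_ballP[d /= d0 Hd] := cf.
  by exists d => // y xy; apply: Hd; rewrite -ball_normE.
apply/cvgrPdist_lt => e e0; have [d d0 Hd] := H e e0.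
by apply/nbhs_ballP; exists d => //= y; rewrite -ball_normE; exact: Hd.
Qed.

Lemma open_forP (O : set X) : open O <->
  forall x, O x -> exists2 d : R, 0 < d & forall y, `|x - y| < d -> O y.
Proof.
rewrite openE; split=> [oO x /oO|H x /H[d d0 Hd]].
  by move=> /nbhs_ballP[d /= d0 Hd]; exists d => // y xy; apply: Hd; rewrite -ball_normE.
by apply/nbhs_ballP; exists d => //= y; rewrite -ball_normE; exact: Hd.
Qed.

Lemma differentiable_forP f x : differentiable f x ->
  forall e : R, 0 < e -> exists2 d : R, 0 < d &
    forall h, `|h| < d -> `|f (x + h) - f x - 'd f x h| <= e * `|h|.
Proof.
move=> /diff_locallyP[_ H] e e0.
have /eqaddoP/(_ e e0) := H => /nbhs_ballP[d /= d0 Hd]; exists d => // h hd.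
have := Hd h; rewrite -ball_normE/= sub0r normrN => /(_ hd).
by rewrite !fctE/= [h + x]addrC opprD addrA.
Qed.

Lemma is_diff_forP f x (df : {linear X -> Y}) : continuous df ->
  (forall e : R, 0 < e -> exists2 d : R, 0 < d &
    forall h, `|h| < d -> `|f (x + h) - f x - df h| <= e * `|h|) ->
  is_diff x f df.
Proof.
move=> cdf H.
have E : f \o shift x = cst (f x) + df +o_ 0 id.
  apply/eqaddoP => e e0; have [d d0 Hd] := H e e0.
  apply/nbhs_ballP; exists d => //= h; rewrite -ball_normE/= sub0r normrN => hd.
  by have := Hd h hd; rewrite !fctE/= [h + x]addrC opprD addrA.
have Ed := diff_unique cdf E; apply: DiffDef => //.
by apply/diff_locallyP; rewrite Ed; split.
Qed.

(** Only [x] has to lie in [K]; [y] ranges over the whole space, because [f] is continuous at the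
    points of [K] and not merely within [K]. *)
Lemma compact_unif_continuous (K : set X) f (e : R) : compact K ->
    (forall x, K x -> {for x, continuous f}) -> 0 < e ->
  exists2 d : R, 0 < d & forall x y, K x -> `|x - y| < d -> `|f x - f y| < e.
Proof.
move=> cK cf e0; have e20 : 0 < e / 2 by rewrite divr_gt0.
move/compact_near_coveringP : cK => /(_ R (0 : R)^'+
  (fun d x => forall y, `|x - y| < d -> `|f x - f y| < e)).
move=> cK; have /cK : forall x, K x -> \forall x' \near x & d \near 0^'+,
    forall y, `|x' - y| < d -> `|f x' - f y| < e.
  move=> x /cf/continuous_forP/(_ _ e20)[d d0 Hd].
  have d20 : 0 < d / 2 by rewrite divr_gt0.
  exists (ball x (d / 2), [set z | z < d / 2]) => /=.
    by split; [exact: nbhsx_ballx|exact: nbhs_right_lt].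
  move=> [x' r] /= []; rewrite -ball_normE/= => xx' rd y x'y.
  rewrite -(subrKA (f x)) (le_lt_trans (ler_normD _ _))// (splitr e) ltrD//.
    by rewrite distrC Hd// (lt_trans xx')// ltr_pdivrMr// mulr_natr mulr2n ltrDl.
  apply: Hd; rewrite -(subrKA x') (le_lt_trans (ler_normD _ _))// (splitr d) ltrD//.
  exact: lt_trans x'y rd.
move=> H; near (0 : R)^'+ => d; exists d => //.
by move=> x y Kx; apply: (near H d).
Unshelve. all: by end_near. Qed.

End EpsDelta.

(* Gronwall's inequality on an interval so short that no exponential is needed. *)
Lemma gronwall_small (R : realType) p q (f df : R -> 'M[R]_(p, q)) (e : R) :
  f 0 = 0 -> (forall t : R, 0 <= t <= 1 -> is_derive t 1 f (df t)) ->
  (forall t : R, 0 <= t <= 1 -> `|df t| <= `|f t| / 2 + e) ->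
  forall t : R, 0 <= t <= 1 -> `|f t| <= 2 * e.
Proof.
move=> f0 fdf dfe.
have cf (t : R) : 0 <= t <= 1 -> {for t, continuous f}.
  move=> /fdf[H _]; apply: differentiable_continuous.
  exact/derivable1_diffP.
(* At a maximum [c] of [|f|] the mean value theorem on an interval of length at most 1 gives
   [|f c| <= |f c| / 2 + e], which can be solved for [|f c|]. *)
have [|c] := @EVT_max R (fun t => `|f t|) 0 1 ler01.
  apply: continuous_in_subspaceT => t; rewrite inE/= in_itv/= => t01.
  exact: continuous_comp (cf _ t01) (@norm_continuous _ _ _).
rewrite in_itv/= => /andP[c0 c1] cmax.
have fce : `|f c| <= `|f c| / 2 + e.
  have e0 : 0 <= `|f c| / 2 + e by apply: le_trans (dfe c _); rewrite ?c0.
  apply: mx_norm_le => // i j.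
  have [||z] := @MVT_segment R (fun t => f t i j) (fun t => df t i j) 0 c c0.
    move=> z; rewrite in_itv/= => /andP[z0 zc].
    apply: is_derive_entry; apply: fdf.
    by rewrite (ltW z0) (le_trans (ltW zc)).
    apply: continuous_in_subspaceT => t; rewrite inE/= in_itv/= => /andP[t0 tc].
    have := cf t; rewrite t0 (le_trans tc c1) => /(_ isT) H.
    exact: continuous_comp H (@coord_continuous _ _ _ i j _).
  rewrite in_itv/= => /andP[z0 zc]; rewrite f0 mxE !subr0 => ->.
  have z1 : 0 <= z <= 1 by rewrite z0 (le_trans zc).
  rewrite normrM -[leRHS]mulr1 ler_pM//; last by rewrite ger0_norm.
  rewrite (le_trans (mx_entry_le _ _ _))// (le_trans (dfe _ z1))// lerD2r.
  by rewrite ler_pM2r ?invr_gt0// cmax// in_itv.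
move=> t t01; apply: (@le_trans _ _ `|f c|); first by rewrite cmax// in_itv.
lra.
Qed.

Lemma is_derive_scale (R : realType) (V W : normedModType R) (f : V -> W) (s : R)
    (x v : V) : differentiable f (s *: x) ->
  is_derive x v (fun z => f (s *: z)) (s *: 'd f (s *: x) v).
Proof.
move=> df; have ds : differentiable ( *:%R s : V -> V) x.
  by have [] := is_diff_scaler s x.
have -> : (fun z => f (s *: z)) = f \o ( *:%R s) by [].
apply: DeriveDef; first by apply: diff_derivable; exact: differentiable_comp.
rewrite deriveE; last exact: differentiable_comp.
by rewrite diff_comp//= -linearZ (diff_val (is_diff_def := is_diff_scaler s x)).
Qed.

Lemma is_derive_line (R : realType) (V W : normedModType R) (f : V -> W) (y u : V)
    (t : R) df : is_derive (y + t *: u) u f df ->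
  is_derive t 1 (fun s => f (y + s *: u)) df.
Proof.
move=> [H <-].
have E : (fun h : R => h^-1 *: (f (y + (h *: 1 + t) *: u) - f (y + t *: u))) =
    (fun h : R => h^-1 *: (f (h *: u + (y + t *: u)) - f (y + t *: u))).
  apply/funext => h; congr (_ *: (f _ - _)).
  by rewrite scalerDl /GRing.scale/= mulr1 addrCA.
by apply: DeriveDef; rewrite /derivable /derive E.
Qed.

Lemma is_derive_coord (R : realType) n (x v : 'rV[R]_n) l :
  is_derive x v ((fun z : 'rV[R]_n => z 0 l) : 'rV[R]_n -> R^o) (v 0 l).
Proof. exact: is_derive_entry (is_derive_id x v). Qed.

Lemma linear_delta (R : realType) n (W : normedModType R)
    (L : {linear 'rV[R]_n -> W}) (u : 'rV[R]_n) :
  L u = \sum_m u 0 m *: L (delta_mx 0 m).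
Proof.
rewrite [u in LHS]row_sum_delta linear_sum.
by apply: eq_bigr => m _; rewrite linearZ.
Qed.

Lemma mvt01 (R : realType) (f df : R -> R) :
  (forall t : R, 0 <= t <= 1 -> is_derive t 1 f (df t)) ->
  exists2 t : R, 0 <= t <= 1 & f 1 - f 0 = df t.
Proof.
move=> H; have [||t] := @MVT_segment R f df 0 1 ler01.
- by move=> t; rewrite in_itv/= => /andP[t0 t1]; apply: H; rewrite !ltW.
- by apply: derivable_within_continuous => t; rewrite in_itv/= => /H[].
- by rewrite in_itv/= => t01; rewrite subr0 mulr1; exists t.
Qed.

Lemma seg_in (R : realType) (V : normedModType R) (x v : V) (r t : R) :
  `|x| < r -> `|x + v| < r -> 0 <= t <= 1 -> `|x + t *: v| < r.
Proof.
move=> xr xvr /andP[t0 t1].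
have -> : x + t *: v = (1 - t) *: x + t *: (x + v).
  by rewrite scalerDr addrA -scalerDl subrK scale1r.
apply: le_lt_trans (ler_normD _ _) _; rewrite !normrZ !ger0_norm ?subr_ge0//.
have [->|tneq0] := eqVneq t 0; first by rewrite subr0 mul1r mul0r addr0.
have t_gt0 : 0 < t by rewrite lt_def tneq0.
have -> : r = (1 - t) * r + t * r by ring.
by rewrite ler_ltD ?ltr_pM2l// ler_wpM2l ?subr_ge0// ltW.
Qed.

Lemma linear_rV_continuous (R : realType) n (W : normedModType R)
    (L : {linear 'rV[R]_n -> W}) : continuous L.
Proof.
apply/bounded_linear_continuous/linear_boundedP; near=> r => u.
rewrite linear_delta (le_trans (ler_norm_sum _ _ _))//.
apply: (@le_trans _ _ (\sum_m `|u| * `|L (delta_mx 0 m)|)).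
  by apply: ler_sum => m _; rewrite normrZ ler_wpM2r// mx_entry_le.
by rewrite -mulr_sumr mulrC ler_wpM2r//; near: r; exact: nbhs_pinfty_ge.
Unshelve. all: by end_near. Qed.

(** * Parallel frames of flat connections *)

Section FlatFrame.
Variables (R : realType) (n p : nat).
Local Notation V := 'rV[R]_n.
Variable B : 'I_n -> V -> 'M[R]_p.

(** The connection form with coefficients [B l], evaluated at [y] on the tangent vector [v]. *)
Definition conn (y v : V) : 'M[R]_p := \sum_l v 0 l *: B l y.

(** The derivative of [conn z v] in [z], at [y] along [u], spelled out in partial derivatives of
    entries so that finitely many scalar bounds control it. *)
Definition dconn (y u v : V) : 'M[R]_p :=
  \sum_l \sum_m (v 0 l * u 0 m) *:
    \matrix_(i, j) 'd ((fun z => B l z i j) : V -> R^o) y (delta_mx 0 m).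

(* The Euler approximations, with step h, of the parallel frame along the ray
   through x; they solve the connection equation up to an error governed by the curvature. *)
Fixpoint euler (h : R) (j : nat) (x : V) : 'M[R]_p :=
  if j is j'.+1 then euler h j' x *m (1%:M + h *: conn ((j'%:R * h) *: x) x)
  else 1%:M.

Variables (r C : R).
Hypothesis r_gt0 : 0 < r.
Hypothesis C_ge0 : 0 <= C.
Hypothesis B_diff : forall y : V, `|y| < r -> forall l i j,
  differentiable ((fun z => B l z i j) : V -> R^o) y.
Hypothesis conn_bound : forall y v : V, `|y| < r -> `|conn y v| <= C * `|v|.
(** This keeps [p * |conn y x|] below 1/2 on the ball, which bounds the Euler products by 2 and
    makes [gronwall_small] applicable along rays. *)
Hypothesis Cr_small : p%:R * C * r <= 1 / 2.
Hypothesis dconn_bound : forall y u v : V, `|y| < r ->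
  `|dconn y u v| <= C * `|u| * `|v|.
Hypothesis dconn_unif : forall e : R, 0 < e -> exists2 d : R, 0 < d &
  forall y z u v : V, `|y| < r -> `|z| < r -> `|y - z| < d ->
    `|dconn y u v - dconn z u v| <= e * `|u| * `|v|.
(** The integrability condition of [dg = g B]: differentiating [g *m conn y v] along [u] gives [g *m
    (conn y u *m conn y v + dconn y u v)], which must be symmetric in [u] and [v]. *)
Hypothesis flat : forall y u v : V, `|y| < r ->
  dconn y u v - dconn y v u + conn y u *m conn y v - conn y v *m conn y u = 0.

Lemma connD y u v : conn y (u + v) = conn y u + conn y v.
Proof. by rewrite -big_split; apply: eq_bigr => l _; rewrite mxE scalerDl. Qed.

Lemma connZ y (c : R) v : conn y (c *: v) = c *: conn y v.
Proof. by rewrite scaler_sumr; apply: eq_bigr => l _; rewrite mxE scalerA. Qed.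

Lemma conn0 y : conn y 0 = 0.
Proof. by rewrite -(scale0r (0 : V)) connZ scale0r. Qed.

Lemma dconnE y u v i j : dconn y u v i j = \sum_l \sum_m (v 0 l * u 0 m) *
  'd ((fun z => B l z i j) : V -> R^o) y (delta_mx 0 m).
Proof.
rewrite /dconn summxE; apply: eq_bigr => l _; rewrite summxE.
by apply: eq_bigr => m _; rewrite !mxE.
Qed.

Lemma dconn_subE y z u v i j : (dconn y u v - dconn z u v) i j =
  \sum_l \sum_m (v 0 l * u 0 m) *
    ('d ((fun z => B l z i j) : V -> R^o) y (delta_mx 0 m) -
     'd ((fun z => B l z i j) : V -> R^o) z (delta_mx 0 m)).
Proof.
rewrite mx_subE; apply: etrans
  (congr2 (fun a b => a - b) (dconnE y u v i j) (dconnE z u v i j)) _.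
rewrite -sumrB; apply: eq_bigr => l _; rewrite -sumrB; apply: eq_bigr => m _.
by rewrite mulrBr.
Qed.

Lemma is_derive_conn (y u v : V) : `|y| < r ->
  is_derive y u (fun z => conn z v) (dconn y u v).
Proof.
move=> yr; apply: is_derive_mx => i j.
have -> : (fun z => conn z v i j) = \sum_l (v 0 l *: (fun z => B l z i j : R^o)).
  by apply/funext => z; rewrite /conn summxE fct_sumE; apply: eq_bigr => l _; rewrite mxE.
apply: is_derive_eq.
  apply: is_derive_sum => l; apply: is_deriveZ; apply: derivableP.
  exact: diff_derivable (B_diff yr l i j).
rewrite /dconn summxE; apply: eq_bigr => l _.
rewrite deriveE; last exact: B_diff.
rewrite summxE.
transitivity (v 0 l *: \sum_m u 0 m *: 'd ((fun z => B l z i j) : V -> R^o) y (delta_mx 0 m)).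
  by congr (_ *: _); exact: linear_delta.
rewrite scaler_sumr.
by apply: eq_bigr => m _; rewrite !mxE scalerA.
Qed.

Lemma is_derive_conn_ray s (x v : V) : `|s *: x| < r ->
  is_derive x v (fun z => conn (s *: z) z)
    (s *: dconn (s *: x) v x + conn (s *: x) v).
Proof.
move=> sxr; apply: is_derive_mx => i j.
have -> : (fun z => conn (s *: z) z i j) =
    \sum_l ((fun z : V => z 0 l : R^o) * (fun z => B l (s *: z) i j : R^o)).
  by apply/funext => z; rewrite /conn summxE fct_sumE; apply: eq_bigr => l _; rewrite mxE.
apply: is_derive_eq.
  apply: is_derive_sum => l; apply: is_deriveM; first exact: is_derive_coord.
  exact: (@is_derive_scale _ _ _ (fun z : V => B l z i j : R^o) _ _ _ (B_diff sxr l i j)).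
rewrite mxE [X in X + _]mxE /conn /dconn !summxE mulr_sumr -big_split/=.
apply: eq_bigr => l _.
rewrite summxE mulr_sumr !mxE; congr (_ + _); last by rewrite /GRing.scale/= mulrC.
transitivity (x 0 l *: (s *: \sum_m v 0 m *: 'd ((fun z => B l z i j) : V -> R^o) (s *: x) (delta_mx 0 m))).
  by congr (_ *: (_ *: _)); exact: linear_delta.
rewrite !scaler_sumr.
have key (a b c D : R) : a * (b * (c * D)) = b * (a * c * D) by ring.
by apply: eq_bigr => m _; rewrite !mxE; exact: key.
Qed.

(** The coefficients are only C^1, so the remainder is [h] times the oscillation [e] of the
    derivative along the segment rather than of order [h ^+ 2]. *)
Lemma conn_taylor (e d : R) (y x v : V) (h : R) : 0 <= e -> 0 <= h ->
  (forall z : V, `|z| < r -> `|z - y| < d -> `|dconn z x v - dconn y x v| <= e) ->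
  (forall t : R, 0 <= t <= h -> `|y + t *: x| < r) -> h * `|x| < d ->
  `|conn (y + h *: x) v - conn y v - h *: dconn y x v| <= h * e.
Proof.
move=> e0 h0 He Hr hxd; apply: mx_norm_le => [|i j]; first by rewrite mulr_ge0.
have H (t : R) : 0 <= t <= h ->
    is_derive t 1 (fun s => conn (y + s *: x) v i j) (dconn (y + t *: x) x v i j).
  move=> th; apply: is_derive_entry.
  by apply: (@is_derive_line _ _ _ (fun z => conn z v)); apply: is_derive_conn; exact: Hr.
have [||t] := @MVT_segment R (fun t => conn (y + t *: x) v i j) (fun t => dconn (y + t *: x) x v i j) 0 h h0.
- move=> t; rewrite in_itv/= => /andP[t0 th]; apply: H.
  by rewrite (ltW t0) (ltW th).
- apply: derivable_within_continuous => t; rewrite in_itv/= => /H[].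
  by move=> ? _.
rewrite in_itv/= => th; rewrite scale0r addr0 subr0 => Ht.
rewrite !mxE [X in `|X|](_ : _ = (dconn (y + t *: x) x v - dconn y x v) i j * h).
  rewrite normrM mulrC (ger0_norm h0) ler_wpM2l// (le_trans (mx_entry_le _ _ _))//.
  apply: He; first exact: Hr.
  rewrite addrAC subrr add0r normrZ; have [/andP[t0 tle]] := th.
  by rewrite ger0_norm// (le_lt_trans _ hxd)// ler_wpM2r.
move: Ht; move: (conn _ _) (conn _ _) (dconn _ _ _) (dconn _ _ _) => M1 M2 M3 M4 Ht.
by rewrite !mxE mulrBl; lra.
Qed.

Let ray_in j m (x : V) : (j <= m.+1)%N -> `|x| < r -> `|(j%:R * m.+1%:R^-1) *: x| < r.
Proof.
move=> jm xr; rewrite normrZ ger0_norm ?mulr_ge0// (le_lt_trans _ xr)//.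
by rewrite ler_piMl// ler_pdivrMr// mul1r ler_nat.
Qed.

Let Apx (x y : V) : `|x| < r -> `|y| < r -> p%:R * `|conn y x| <= 1 / 2.
Proof.
move=> xr yr; apply: le_trans Cr_small; rewrite -mulrA ler_wpM2l//.
by apply: le_trans (conn_bound _ yr) _; rewrite ler_wpM2l// ltW.
Qed.

(** A linear bound takes the place of an exponential: each factor costs at most [1 + h / 2], and for
    [s <= 1] one has [(1 + s) * (1 + h / 2) <= 1 + s + h]. *)
Lemma euler_bound m j (x : V) : (j <= m.+1)%N -> `|x| < r ->
  `|euler m.+1%:R^-1 j x| <= 1 + j%:R * m.+1%:R^-1.
Proof.
elim: j => [|j IH] jm xr.
  rewrite mul0r addr0; apply: mx_norm_le => // i l.
  by rewrite mxE; case: eqP => _; rewrite ?normr1 ?normr0.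
rewrite /= mulmxDr mulmx1 -scalemxAr.
have {}IH := IH (ltnW jm) xr.
set h := _^-1 in IH *; set s := j%:R * h in IH *.
have h0 : 0 <= h by rewrite invr_ge0.
have s1 : s <= 1 by rewrite ler_pdivrMr// mul1r ler_nat ltnW.
have s0 : 0 <= s by rewrite mulr_ge0.
set G := euler _ _ _ in IH *.
have A1 : p%:R * `|conn (s *: x) x| <= 1 / 2 by apply: Apx => //; exact: ray_in (ltnW jm) xr.
apply: le_trans (ler_normD _ _) _; rewrite normrZ ger0_norm//.
have : `|G *m conn (s *: x) x| <= `|G| * (1 / 2).
  apply: le_trans (mx_norm_mul _ _) _.
  by rewrite mulrAC mulrC ler_wpM2l.
have -> : j.+1%:R * h = s + h by rewrite -natr1 mulrDl mul1r.
set g := `|G| in IH *; set u := `| _ |.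
nra.
Qed.

(** Here flatness is used. With [s = j h], the expected derivative along [v] of the [j]-th product
    [G] is [G *m (s *: conn (s *: x) v)]; the matrix multiplied by [G] is the defect of this
    prediction after one more step. Its terms of order [h] are [- s] times the curvature of [x] and
    [v], which vanishes, leaving terms of order [h ^+ 2] and the Taylor remainder. *)
Let euler_step (h s e : R) (x v : V) (G : 'M[R]_p) :
  0 <= h -> 0 <= s -> s + h <= 1 -> 0 <= e -> `|x| < r ->
  `|conn ((s + h) *: x) v - conn (s *: x) v - h *: dconn (s *: x) x v|
     <= h * (e * r * `|v|) ->
  `|G| <= 2 ->
  `|G *m (s *: conn (s *: x) v *m (1%:M + h *: conn (s *: x) x)
      + h *: (s *: dconn (s *: x) v x + conn (s *: x) v)
      - (1%:M + h *: conn (s *: x) x) *m ((s + h) *: conn ((s + h) *: x) v))|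
   <= h * (4 * p%:R * (h * C * r + h * C + e * r) * `|v|).
Proof.
move=> h0 s0 sh1 e0 xr; set y := s *: x; set rho := _ - _ - _ => rhoB GB.
have yr : `|y| < r.
  by rewrite normrZ ger0_norm// (le_lt_trans _ xr)// ler_piMl//; lra.
set Q := (X in G *m X).
have QE : Q = - (h ^+ 2 *: dconn y x v + (s + h) *: rho
   + h ^+ 2 *: (conn y x *m conn y v)
   + ((s + h) * h ^+ 2) *: (conn y x *m dconn y x v)
   + ((s + h) * h) *: (conn y x *m rho)).
  have Erho : conn ((s + h) *: x) v = conn y v + h *: dconn y x v + rho.
    rewrite /rho; move: (conn _ v) (conn y v) (h *: _) => a1 a2 a3.
    by apply/matrixP => i j; rewrite !mxE; ring.
  clearbody rho; rewrite /Q Erho !(mulmxDl, mulmxDr, mul1mx, mulmx1) -!(scalemxAl, scalemxAr).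
  move: (flat v x yr).
  rewrite !(mulmxDl, mulmxDr, mul1mx, mulmx1) -!(scalemxAl, scalemxAr).
  move: (dconn y x v) (dconn y v x) (conn y v) (conn y x *m conn y v)
   (conn y v *m conn y x) (conn y x *m dconn y x v) (conn y x *m rho)
   => a5 a6 a7 a1 a2 a3 a4 F.
  apply/matrixP => i j; have := congr1 (fun X : 'M[R]_p => X i j) F.
  rewrite !mxE => {}F; have -> : a6 i j = a5 i j - a2 i j + a1 i j by lra.
  ring.
have Ax : p%:R * `|conn y x| <= 1 / 2 by exact: Apx.
have Dv : `|dconn y x v| <= C * r * `|v|.
  apply: le_trans (dconn_bound _ _ yr) _.
  by rewrite ler_wpM2r// ler_wpM2l// ltW.
have Av : `|conn y v| <= C * `|v| by exact: conn_bound.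
have half (M : 'M[R]_p) z : `|M| <= z -> `|conn y x *m M| <= z / 2.
  move=> Mz; apply: le_trans (mx_norm_mul _ _) _.
  by rewrite [leRHS]mulrC; apply: ler_pM => //; lra.
have QB : `|Q| <= h * (2 * (h * C * r + h * C + e * r) * `|v|).
  rewrite QE normrN.
  apply: le_trans (ler_normD _ _) _; apply: le_trans (lerD (ler_normD _ _) (lexx _)) _.
  apply: le_trans (lerD (lerD (ler_normD _ _) (lexx _)) (lexx _)) _.
  apply: le_trans (lerD (lerD (lerD (ler_normD _ _) (lexx _)) (lexx _)) (lexx _)) _.
  rewrite !normrZ !ger0_norm ?(mulr_ge0, exprn_ge0, addr_ge0)//.
  move: (half _ _ Av) (half _ _ Dv) (half _ _ rhoB).
  move: (`|conn y x *m conn y v|) (`|conn y x *m dconn y x v|) (`|conn y x *m rho|) => a1 a2 a3 H1 H2 H3.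
  have v0 : 0 <= `|v| by [].
  have h2 : 0 <= h ^+ 2 by rewrite exprn_ge0.
  have Crv : 0 <= C * r * `|v| by rewrite !mulr_ge0// ltW.
  have erv : 0 <= e * r * `|v| by rewrite !mulr_ge0// ltW.
  have Cv : 0 <= C * `|v| by rewrite !mulr_ge0.
  have B1 : h ^+ 2 * `|dconn y x v| <= h ^+ 2 * (C * r * `|v|) by rewrite ler_wpM2l.
  have B2 : (s + h) * `|rho| <= h * (e * r * `|v|).
    by apply: le_trans rhoB; rewrite ler_piMl.
  have B3 : h ^+ 2 * a1 <= h ^+ 2 * (C * `|v| / 2) by rewrite ler_wpM2l.
  have B4 : (s + h) * h ^+ 2 * a2 <= h ^+ 2 * (C * r * `|v| / 2).
    have a20 : h ^+ 2 * a2 <= h ^+ 2 * (C * r * `|v| / 2) by rewrite ler_wpM2l.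
    rewrite -mulrA; apply: (@le_trans _ _ ((s + h) * (h ^+ 2 * (C * r * `|v| / 2)))).
      by rewrite ler_wpM2l// addr_ge0.
    by rewrite ler_piMl// mulr_ge0// divr_ge0.
  have B5 : (s + h) * h * a3 <= h * (e * r * `|v| / 2).
    rewrite -mulrA; apply: (@le_trans _ _ ((s + h) * (h * (h * (e * r * `|v|) / 2)))).
      by rewrite ler_wpM2l ?addr_ge0// ler_wpM2l.
    apply: (@le_trans _ _ (h * (h * (e * r * `|v|) / 2))).
      by rewrite ler_piMl// mulr_ge0// divr_ge0// mulr_ge0.
    rewrite ler_wpM2l// ler_wpM2r// ler_piMl//; lra.
  have T1 : 0 <= h * (e * r * `|v|) by rewrite mulr_ge0.
  have T2 : 0 <= h ^+ 2 * (C * r * `|v|) by rewrite mulr_ge0.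
  have T3 : 0 <= h ^+ 2 * (C * `|v|) by rewrite mulr_ge0.
  have -> : h * (2 * (h * C * r + h * C + e * r) * `|v|) =
    2 * (h ^+ 2 * (C * r * `|v|)) + 2 * (h ^+ 2 * (C * `|v|)) + 2 * (h * (e * r * `|v|)) by ring.
  lra.
apply: le_trans (mx_norm_mul _ _) _.
apply: (@le_trans _ _ (p%:R * 2 * (h * (2 * (h * C * r + h * C + e * r) * `|v|)))).
  by apply: ler_pM => //; rewrite ler_wpM2l.
by rewrite le_eqVlt; apply/orP; left; apply/eqP; ring.
Qed.

(** The defects of the steps accumulate linearly. The constant 8 is twice the 4 of [euler_step]: one
    half pays for the new defect, the other for the growth of the old one by the factor
    [1 + h / 2]. *)
Lemma euler_derive (d e : R) m j (x v : V) : 0 <= e -> r < d * m.+1%:R ->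
  (forall y z u w : V, `|y| < r -> `|z| < r -> `|y - z| < d ->
    `|dconn y u w - dconn z u w| <= e * `|u| * `|w|) ->
  (j <= m.+1)%N -> `|x| < r ->
  exists2 D, is_derive x v (euler m.+1%:R^-1 j) D &
    `|D - euler m.+1%:R^-1 j x *m
        ((j%:R * m.+1%:R^-1) *: conn ((j%:R * m.+1%:R^-1) *: x) v)| <=
    j%:R * m.+1%:R^-1 *
     (8 * p%:R * (m.+1%:R^-1 * C * r + m.+1%:R^-1 * C + e * r) * `|v|).
Proof.
move=> e0 rd Hd; set h := _^-1 => jm xr.
have h0 : 0 <= h by rewrite invr_ge0.
elim: j jm => [|j IH] jm.
  exists 0; first exact: is_derive_cst.
  by rewrite !mul0r scale0r mulmx0 subr0 normr0.
have {IH} [D HD HDE] := IH (ltnW jm).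
have s1 : j%:R * h <= 1 by rewrite ler_pdivrMr// mul1r ler_nat ltnW.
have sr : `|(j%:R * h) *: x| < r by exact: ray_in (ltnW jm) xr.
have GB : `|euler h j x| <= 2.
  apply: le_trans (euler_bound (ltnW jm) xr) _; rewrite -/h; lra.
have sh1 : j%:R * h + h <= 1.
  by rewrite -[X in _ + X]mul1r -mulrDl natr1 ler_pdivrMr// mul1r ler_nat.
have E1 : j.+1%:R * h = j%:R * h + h by rewrite -natr1 mulrDl mul1r.
rewrite E1.
have s0 : 0 <= j%:R * h by rewrite mulr_ge0.
have hxd : h * `|x| < d.
  rewrite mulrC ltr_pdivrMr//; exact: lt_trans xr rd.
have T : `|conn ((j%:R * h + h) *: x) v - conn ((j%:R * h) *: x) v
    - h *: dconn ((j%:R * h) *: x) x v| <= h * (e * r * `|v|).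
  rewrite scalerDl; apply: (conn_taylor (d := d)) => //.
  - by rewrite !mulr_ge0// ltW.
  - move=> z zr zd; apply: le_trans (Hd _ _ _ _ zr sr zd) _.
    by rewrite ler_wpM2r// ler_wpM2l// ltW.
  - move=> t /andP[t0 th]; rewrite -scalerDl normrZ ger0_norm ?addr_ge0//.
    apply: le_lt_trans xr; rewrite ler_piMl//; lra.
have HG := is_derive_mulmx HD (@is_deriveD _ _ _ (cst 1%:M)
   (h \*: (fun z => conn ((j%:R * h) *: z) z)) x v 0 _ (is_derive_cst _ _ _)
   (is_deriveZ h (is_derive_conn_ray v sr))).
exists (D *m (1%:M + h *: conn ((j%:R * h) *: x) x) + euler h j x *m (0 + h *:
   ((j%:R * h) *: dconn ((j%:R * h) *: x) v x + conn ((j%:R * h) *: x) v))).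
  exact: HG.
have := euler_step h0 s0 sh1 e0 xr T GB.
rewrite [euler h j.+1 x]/=.
move: T HDE GB {HD HG}; move: (euler h j x) => G.
move: s0 s1 sr sh1 {hxd E1}; set s := j%:R * h => s0 s1 sr sh1.
set y := s *: x; set Av := conn y v; set Ax := conn y x.
move=> T HDE GB; set Q := s *: Av *m _ + _ - _ => QB.
have -> : D *m (1%:M + h *: Ax) + G *m (0 + h *: (s *: dconn y v x + Av)) -
    G *m (1%:M + h *: Ax) *m ((s + h) *: conn ((s + h) *: x) v) =
    (D - G *m (s *: Av)) + h *: ((D - G *m (s *: Av)) *m Ax) + G *m Q.
  rewrite /Q add0r !(mulmxDl, mulmxDr, mul1mx, mulmx1, mulmxBl, mulmxBr, mulmxN, mulNmx) -!(scalemxAl, scalemxAr).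
  rewrite -!mulmxA.
  move: (D *m Ax) (G *m Av) (G *m (Av *m Ax)) (G *m (s *: _ + Av)) (G *m conn _ v)
    (G *m (Ax *m conn _ v)) => a1 a2 a3 a4 a5 a6.
  by apply/matrixP => i l; rewrite !mxE; ring.
move: (D - G *m (s *: Av)) HDE QB => E HDE QB.
set W := 8 * p%:R * _ * `|v| in HDE *.
have {}QB : `|G *m Q| <= h * (W / 2).
  by apply: le_trans QB _; rewrite le_eqVlt; apply/orP; left; apply/eqP; rewrite /W; field.
have W0 : 0 <= W by rewrite /W !mulr_ge0// !addr_ge0// !mulr_ge0// ltW.
apply: le_trans (ler_normD _ _) _; apply: le_trans (lerD (ler_normD _ _) (lexx _)) _.
rewrite normrZ ger0_norm//.
have EA : `|E *m Ax| <= `|E| / 2.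
  apply: le_trans (mx_norm_mul _ _) _.
  by rewrite mulrAC mulrC ler_wpM2l//; have := Apx xr sr; rewrite mul1r.
have EA' : h * `|E *m Ax| <= h * (s * W / 2).
  by rewrite ler_wpM2l// (le_trans EA)// ler_wpM2r.
have : h * (s * W / 2) <= h * (W / 2).
  by rewrite ler_wpM2l// ler_wpM2r// ler_piMl.
have -> : (s + h) * W = s * W + 2 * (h * (W / 2)) by field.
lra.
Qed.

Let F m x := euler m.+1%:R^-1 m.+1 x.

Let ray_frac m : m.+1%:R * m.+1%:R^-1 = 1 :> R.
Proof. by rewrite divff// pnatr_eq0. Qed.

Let F_bound m (x : V) : `|x| < r -> `|F m x| <= 2.
Proof. by move=> xr; apply: le_trans (euler_bound _ xr) _; rewrite ?ray_frac. Qed.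

Lemma euler_error (e : R) : 0 < e -> exists M : nat,
  forall m (x v : V), (M <= m)%N -> `|x| < r ->
    exists2 D, is_derive x v (F m) D & `|D - F m x *m conn x v| <= e * `|v|.
Proof.
move=> e0; pose K := 8 * p%:R * (C * r + C + r) + 1.
have K0 : 0 < K by rewrite ltr_wpDl// !mulr_ge0// !addr_ge0// ?mulr_ge0// ltW.
have eK : 0 < e / K by rewrite divr_gt0.
have [d d0 Hd] := dconn_unif eK.
(* [M1] makes a step along the ray shorter than [d], and [M2] makes the step size at most
   [e / K]. *)
pose M1 := Num.truncn (r / d); pose M2 := Num.truncn (K / e).
exists (maxn M1 M2) => m x v; rewrite geq_max => /andP[M1m M2m] xr.
have rd : r < d * m.+1%:R.
  rewrite mulrC -ltr_pdivrMr// (lt_le_trans (truncnS_gt _))// ler_nat//.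
have mK : m.+1%:R^-1 <= e / K.
  rewrite -[leRHS]invrK lef_pV2 ?posrE ?invr_gt0// invf_div.
  by rewrite (le_trans (ltW (truncnS_gt _)))// ler_nat.
have [D HD HE] := euler_derive v (ltW eK) rd Hd (leqnn m.+1) xr.
exists D => //; move: HE; rewrite ray_frac !scale1r mul1r => /le_trans; apply.
rewrite ler_wpM2r//.
have KE : 8 * p%:R * (C * r + C + r) <= K by rewrite lerDl.
apply: (@le_trans _ _ (K * (e / K))); last by rewrite mulrCA divff ?gt_eqF// mulr1.
apply: (@le_trans _ _ ((8 * p%:R * (C * r + C + r)) * (e / K))); last first.
  by rewrite ler_wpM2r// ltW.
rewrite -[leRHS]mulrA ler_wpM2l ?mulr_ge0// !mulrDl.
rewrite !lerD//.
- by rewrite -mulrA [leRHS]mulrC ler_wpM2r// mulr_ge0// ltW.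
- by rewrite [leRHS]mulrC ler_wpM2r.
- by rewrite mulrC.
Qed.

Let F0 m : F m 0 = 1%:M.
Proof.
rewrite /F; elim: {2}m.+1 => //= j ->.
by rewrite conn0 scaler0 addr0 mulmx1.
Qed.

(** Along the ray [t *: x] both approximations solve the same linear equation up to an error of at
    most [e / 4] each, and they agree at [t = 0]; Gronwall's inequality compares them at [t = 1]. *)
Lemma euler_cauchy (e : R) : 0 < e -> exists M : nat,
  forall m m' (x : V), (M <= m)%N -> (M <= m')%N -> `|x| < r ->
    `|F m x - F m' x| <= e.
Proof.
move=> e0; have e4 : 0 < e / (4 * r) by rewrite divr_gt0// mulr_gt0.
have [M HM] := euler_error e4; exists M => m m' x Mm Mm' xr.
have tx (t : R) : 0 <= t <= 1 -> `|t *: x| < r.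
  by move=> /andP[t0 t1]; rewrite normrZ ger0_norm// (le_lt_trans _ xr)// ler_piMl.
have D l (t : R) : (M <= l)%N -> 0 <= t <= 1 ->
    is_derive t 1 (fun s => F l (s *: x)) ('D_x (F l) (t *: x)).
  move=> Ml /tx tr; have [D [HD <-] _] := HM l _ x Ml tr.
  have -> : (fun s => F l (s *: x)) = (fun s => F l (0 + s *: x)).
    by apply/funext => s; rewrite add0r.
  by apply: is_derive_line; rewrite add0r; apply: derivableP.
have E l (t : R) : (M <= l)%N -> 0 <= t <= 1 ->
    `|'D_x (F l) (t *: x) - F l (t *: x) *m conn (t *: x) x| <= e / (4 * r) * `|x|.
  by move=> Ml /tx tr; have [D' [_ ->]] := HM l _ x Ml tr.
have := @gronwall_small R p p (fun t => F m (t *: x) - F m' (t *: x))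
  (fun t => 'D_x (F m) (t *: x) - 'D_x (F m') (t *: x)) (e / 2).
have -> : 2 * (e / 2) = e by field.
rewrite scale0r !F0 subrr => /(_ erefl) G.
have := G _ _ 1; rewrite scale1r; apply => //; last by rewrite ler01 lexx.
  by move=> t t01; apply: is_deriveB; exact: D.
move=> t t01; have := E m t Mm t01; have := E m' t Mm' t01.
have e4x : e / (4 * r) * `|x| <= e / 4.
  rewrite invfM mulrA -mulrA ler_piMr ?divr_ge0 ?ltW//.
  by rewrite mulrC ltr_pdivrMr// mul1r.
have AH := Apx xr (tx t t01).
move: ('D_x _ _) ('D_x _ _) => D1 D2 E1 E2.
have -> : D1 - D2 = (F m (t *: x) - F m' (t *: x)) *m conn (t *: x) x +
   ((D1 - F m (t *: x) *m conn (t *: x) x) - (D2 - F m' (t *: x) *m conn (t *: x) x)).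
  rewrite mulmxBl; move: (_ *m _) (_ *m _) => a1 a2.
  by apply/matrixP => i j; rewrite !mxE; ring.
apply: le_trans (ler_normD _ _) _; apply: lerD.
  apply: le_trans (mx_norm_mul _ _) _.
  by rewrite mulrAC mulrC ler_wpM2l//; rewrite mul1r in AH.
apply: le_trans (ler_normB _ _) _; move: E1 E2.
by move: (`|_ - _|) (`|D2 - _|) => a1 a2; lra.
Qed.

Lemma euler_cvg : exists g : V -> 'M[R]_p, forall e : R, 0 < e -> exists M : nat,
  forall m (x : V), (M <= m)%N -> `|x| < r -> `|F m x - g x| <= e.
Proof.
(* The entrywise [lim] is total; it is the actual limit on the ball, where the sequences are
   Cauchy. *)
exists (fun x => \matrix_(i, j) lim ((fun m => F m x i j) @ \oo)) => e e0.
have e20 : 0 < e / 2 by rewrite divr_gt0.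
have [M HM] := euler_cauchy e20; exists M => m x Mm xr.
apply: mx_norm_le => [|i j]; first exact: ltW.
have cv : cvg ((fun m => F m x i j) @ \oo).
  apply/cauchy_cvgP/cauchy_exP => eps eps0.
  have eps2 : 0 < eps / 2 by rewrite divr_gt0.
  have [M' HM'] := euler_cauchy eps2; exists (F M' x i j); exists M' => // m' /= Mm'.
  rewrite -ball_normE/= (@le_lt_trans _ _ (eps / 2))//; last by lra.
  have := HM' M' m' x (leqnn _) Mm' xr; apply: le_trans.
  by have := mx_entry_le (F M' x - F m' x) i j; rewrite mxE [X in _ + X]mxE.
rewrite mxE [X in _ + X]mxE [X in _ - X]mxE.
have /cvgrPdist_le/(_ _ e20)[M2 _ HM2] := cv.
have := HM2 (maxn M M2) (leq_maxr _ _); set l := lim _.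
have := HM m (maxn M M2) x Mm (leq_maxl _ _) xr.
move=> /(le_trans (mx_entry_le _ i j)); rewrite mxE [X in _ + X]mxE /= => H1 H2.
rewrite -(subrKA (F (maxn M M2) x i j)) (splitr e) (le_trans (ler_normD _ _))// lerD//.
by rewrite distrC.
Qed.

Let conn_lip (y v w : V) : `|y| < r -> `|y + v| < r ->
  `|conn (y + v) w - conn y w| <= C * `|v| * `|w|.
Proof.
move=> yr yvr.
apply: mx_norm_le => [|i j]; first by rewrite !mulr_ge0.
have seg (t : R) : 0 <= t <= 1 -> `|y + t *: v| < r by exact: seg_in.
have H (t : R) : 0 <= t <= 1 ->
    is_derive t 1 (fun s => conn (y + s *: v) w i j) (dconn (y + t *: v) v w i j).
  move=> th; apply: is_derive_entry.
  by apply: (@is_derive_line _ _ _ (fun z => conn z w)); apply: is_derive_conn; exact: seg.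
have [t t01] := mvt01 H.
rewrite scale1r scale0r addr0 => E.
rewrite mxE [X in _ + X]mxE E (le_trans (mx_entry_le _ _ _))//.
exact: dconn_bound (seg t t01).
Qed.

(** The mean value theorem is scalar, so the intermediate [t] depends on the entry and the estimate
    stays entrywise. *)
Let F_mvt (e : R) : 0 < e -> exists M : nat, forall m (x v : V) i j, (M <= m)%N ->
  `|x| < r -> `|x + v| < r -> exists2 t : R, 0 <= t <= 1 &
   `|F m (x + v) i j - F m x i j - (F m (x + t *: v) *m conn (x + t *: v) v) i j| <= e * `|v|.
Proof.
move=> e0; have [M HM] := euler_error e0; exists M => m x v i j Mm xr xvr.
have H (t : R) : 0 <= t <= 1 ->
    is_derive t 1 (fun s => F m (x + s *: v) i j) ('D_v (F m) (x + t *: v) i j).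
  move=> t01; apply: is_derive_entry; apply: (is_derive_line (f := F m)).
  have [D [HD _] _] := HM m _ v Mm (seg_in xr xvr t01).
  exact: derivableP.
have [t t01] := mvt01 H; rewrite scale1r scale0r addr0 => ->; exists t => //.
have [D [HD <-]] := HM m _ v Mm (seg_in xr xvr t01); apply: le_trans.
by have := mx_entry_le ('D_v (F m) (x + t *: v) - F m (x + t *: v) *m conn (x + t *: v) v) i j; rewrite mxE [X in _ + X]mxE.
Qed.

Let prod_bound (X : 'M[R]_p) (y v : V) b : `|X| <= b -> `|y| < r ->
  `|X *m conn y v| <= p%:R * b * (C * `|v|).
Proof.
move=> Xb yr; apply: le_trans (mx_norm_mul _ _) _; apply: ler_pM => //.
- by rewrite ler_wpM2l.
- exact: conn_bound.
Qed.

Lemma euler_lipschitz : exists2 L : R, 0 <= L & exists M : nat, forall m (x v : V),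
  (M <= m)%N -> `|x| < r -> `|x + v| < r -> `|F m (x + v) - F m x| <= L * `|v|.
Proof.
exists (p%:R * 2 * C + 1); first by rewrite addr_ge0// !mulr_ge0.
have [M HM] := F_mvt ltr01; exists M => m x v Mm xr xvr.
apply: mx_norm_le => [|i j]; first by rewrite mulr_ge0// addr_ge0// !mulr_ge0.
have [t t01] := HM m x v i j Mm xr xvr.
have yr := seg_in xr xvr t01 => Ht; rewrite mxE [X in _ + X]mxE; move: Ht.
have := le_trans (mx_entry_le _ i j) (prod_bound v (F_bound m yr) yr).
move: (F m (x + v) i j - F m x i j) ((_ *m _) i j) => a b Hb Hab.
rewrite -(subrK b a) (le_trans (ler_normD _ _))//.
have -> : (p%:R * 2 * C + 1) * `|v| = 1 * `|v| + p%:R * 2 * (C * `|v|) by ring.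
exact: lerD.
Qed.

(** The limit is differentiated by hand: the mean value estimate for the approximations passes to
    the limit as a remainder quadratic in [v], because [g] and [conn] are both Lipschitz. *)
Theorem euler_frame : exists2 g : V -> 'M[R]_p, g 0 = 1%:M &
  forall x : V, `|x| < r -> is_diff x g (fun v => g x *m conn x v).
Proof.
have [g Hg] := euler_cvg; have [L L0 [ML HL]] := euler_lipschitz.
have gap (m m' : nat) : (m <= maxn m m')%N * (m' <= maxn m m')%N.
  by rewrite leq_maxl leq_maxr.
have g0 : g 0 = 1%:M.
  apply/eqP; rewrite -subr_eq0 -normr_le0; apply/ler_addgt0Pl => e e0.
  by have [M HM] := Hg e e0; rewrite addr0 -(F0 M) distrC HM// normr0.
have gB (x : V) : `|x| < r -> `|g x| <= 2.
  move=> xr; apply/ler_addgt0Pl => e e0; have [M HM] := Hg e e0.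
  rewrite -(subrK (F M x) (g x)) (le_trans (ler_normD _ _))// lerD ?F_bound//.
  by rewrite distrC HM.
have gL (x v : V) : `|x| < r -> `|x + v| < r -> `|g (x + v) - g x| <= L * `|v|.
  move=> xr xvr; apply/ler_addgt0Pl => e e0.
  have e20 : 0 < e / 2 by rewrite divr_gt0.
  have [M HM] := Hg _ e20; have [M1 M2] := gap M ML.
  have H1 := HM _ _ M1 xr; have H2 := HM _ _ M1 xvr; have H3 := HL _ _ _ M2 xr xvr.
  rewrite (_ : g _ - g _ = - (F (maxn M ML) (x + v) - g (x + v)) +
     ((F (maxn M ML) (x + v) - F (maxn M ML) x) + (F (maxn M ML) x - g x))).
    apply: le_trans (ler_normD _ _) _.
    apply: le_trans (lerD (lexx _) (ler_normD _ _)) _; rewrite normrN; lra.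
  move: (F _ _) (F _ _) => a b; apply/matrixP => i j; rewrite !mxE; ring.
exists g => // x xr.
(* The first term pairs the Lipschitz constant of [g] with the bound of [conn], the second the bound
   2 of [g] with the Lipschitz constant of [conn]. *)
pose K := p%:R * L * C + p%:R * 2 * C.
have K0 : 0 <= K by rewrite addr_ge0// !mulr_ge0.
have main (v : V) : `|x + v| < r -> `|g (x + v) - g x - g x *m conn x v| <= K * `|v| * `|v|.
  move=> xvr; apply/ler_addgt0Pl => e e0.
  (* The denominator counts the errors proportional to [e']: two from approximating [g] at the ends,
     [p C |v|] from approximating it at the intermediate point, and [|v|] from [F_mvt]. *)
  pose e' := e / (2 + p%:R * C * `|v| + `|v|).
  have den : 0 < 2 + p%:R * C * `|v| + `|v| by rewrite ltr_pwDl// ltr_pwDl// !mulr_ge0.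
  have e'0 : 0 < e' by rewrite divr_gt0.
  have [M HM] := Hg _ e'0; have [M' HM'] := F_mvt e'0; have [M1 M2] := gap M M'.
  apply: mx_norm_le => [|i j]; first by rewrite addr_ge0 ?(ltW e0)// !mulr_ge0.
  have [t t01] := HM' _ _ _ i j M2 xr xvr.
  have yr := seg_in xr xvr t01.
  have := HM _ _ M1 yr; have := HM _ _ M1 xr; have := HM _ _ M1 xvr.
  have := gL x (t *: v) xr yr; have := conn_lip v xr yr; have := gB x xr.
  set y := x + t *: v in yr *.
  have tv : `|t *: v| <= `|v|.
    by case/andP: t01 => t0 t1; rewrite normrZ ger0_norm// ler_piMl.
  move: (F _ (x + v)) (F _ x) (F _ y) => F1 F2 F3 B1 B2 B3 B4 B5 B6 B7.
  rewrite (_ : (g (x + v) - g x - g x *m conn x v) i j =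
     - (F1 - g (x + v)) i j + (F2 - g x) i j +
     (F1 i j - F2 i j - (F3 *m conn y v) i j) +
     (((F3 - g y) *m conn y v) i j + ((g y - g x) *m conn y v) i j +
      (g x *m (conn y v - conn x v)) i j)); last first.
    rewrite !mulmxBl mulmxBr.
    move: (F3 *m _) (g y *m _) (g x *m _) (g x *m _) => a1 a2 a3 a4.
    by rewrite !mxE; ring.
  have B5' : `|(F1 - g (x + v)) i j| <= e' := le_trans (mx_entry_le _ _ _) B4.
  have B6' : `|(F2 - g x) i j| <= e' := le_trans (mx_entry_le _ _ _) B5.
  have C1 := le_trans (mx_entry_le _ i j) (prod_bound v B6 yr).
  have C2 := le_trans (mx_entry_le _ i j) (prod_bound v B3 yr).
  have C3 : `|(g x *m (conn y v - conn x v)) i j| <= p%:R * 2 * (C * `|v| * `|v|).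
    apply: le_trans (mx_entry_le _ _ _) _; apply: le_trans (mx_norm_mul _ _) _.
    apply: ler_pM => //; first by rewrite ler_wpM2l.
    by apply: le_trans B2 _; rewrite ler_wpM2r// ler_wpM2l.
  have C2' : p%:R * (L * `|t *: v|) * (C * `|v|) <= p%:R * L * C * `|v| * `|v|.
    rewrite -!mulrA ler_wpM2l// ler_wpM2l// mulrCA ler_wpM2l// mulrC.
    by rewrite [leRHS]mulrC ler_wpM2l.
  have -> : e + K * `|v| * `|v| = e' + e' + e' * `|v| + (p%:R * e' * (C * `|v|)
     + p%:R * L * C * `|v| * `|v| + p%:R * 2 * (C * `|v| * `|v|)).
    have -> : e = e' * (2 + p%:R * C * `|v| + `|v|) by rewrite /e' divfK// gt_eqF.
    by rewrite /K; ring.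
  do 2 (apply: le_trans (ler_normD _ _) _; rewrite lerD//).
  - by apply: le_trans (ler_normD _ _) _; rewrite lerD// normrN.
  - apply: le_trans (ler_normD _ _) _; rewrite lerD//.
    apply: le_trans C2 C2'.
have lin : linear (fun v => g x *m conn x v).
  by move=> a u v; rewrite connD connZ mulmxDr scalemxAr.
pose l := HB.pack_for {linear V -> 'M[R]_p} (fun v => g x *m conn x v)
   (GRing.isLinear.Build _ _ _ _ _ lin).
change (is_diff x g l); apply: is_diff_forP; first exact: linear_rV_continuous.
move=> e e0.
pose d := Order.min (r - `|x|) (e / (K + 1)).
exists d; first by rewrite lt_min subr_gt0 xr divr_gt0// ltr_wpDl.
move=> h; rewrite lt_min => /andP[h1 h2].
have xh : `|x + h| < r by rewrite (le_lt_trans (ler_normD _ _))// addrC -ltrBrDr.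
apply: le_trans (main h xh) _; rewrite ler_wpM2r//.
move: h2; rewrite ltr_pdivlMr ?ltr_wpDl// => /ltW; apply: le_trans.
by rewrite mulrC ler_wpM2l// lerDl.
Qed.

End FlatFrame.

(** A common radius for finitely many conditions that persist under shrinking; the neutral value 1
    serves an empty index type. *)
Lemma fin_min (R : realType) (T : finType) (P : T -> R -> Prop) :
  (forall t (d d' : R), d' <= d -> P t d -> P t d') ->
  (forall t, exists2 d : R, 0 < d & P t d) ->
  exists2 d : R, 0 < d & forall t, P t d.
Proof.
move=> mon H; have /choice[f Hf] : forall t, exists d, 0 < d /\ P t d.
  by move=> t; have [d d0 Pd] := H t; exists d.
exists (\big[Order.min/1]_t f t).
  by apply: lt_bigmin => // t _; have [] := Hf t.
by move=> t; apply: mon (Hf t).2; apply: bigmin_le.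
Qed.

Lemma fin_max (R : realType) (T : finType) (P : T -> R -> Prop) :
  (forall t (d d' : R), d <= d' -> P t d -> P t d') ->
  (forall t, exists d : R, P t d) ->
  exists2 d : R, 0 <= d & forall t, P t d.
Proof.
move=> mon /choice[f Hf]; exists (\big[Order.max/0]_t f t); first exact: bigmax_ge_id.
by move=> t; apply: mon (Hf t); exact: le_bigmax.
Qed.

Lemma closed_ball_rV_compact (R : realType) n (x : 'rV[R]_n) (r : R) :
  compact [set y : 'rV[R]_n | `|x - y| <= r].
Proof.
apply: bounded_closed_compact.
  exists (`|x| + r); split; first exact: num_real.
  move=> M rM y /= yr; rewrite ltW// (le_lt_trans _ rM)//.
  rewrite -(subKr x y) (le_trans (ler_normB _ _))// lerD2l//.
have -> : [set y : 'rV[R]_n | `|x - y| <= r] =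
    (fun y => `|x - y|) @^-1` [set z : R | z <= r] by [].
apply: closed_comp => // y _; apply: continuous_comp; last exact: norm_continuous.
by apply: continuousB; [exact: cst_continuous|move=> ?; exact: cvg_id].
Qed.

Lemma compact_bounded_fun (R : realType) (X Y : normedModType R) (K : set X)
    (f : X -> Y) : compact K -> (forall x, K x -> {for x, continuous f}) ->
  exists M : R, forall x, K x -> `|f x| <= M.
Proof.
move=> cK cf; have : compact (f @` K).
  by apply: continuous_compact => //; apply: continuous_in_subspaceT => x /set_mem /cf.
move=> /compact_bounded/ex_strict_bound_gt0[M M0 HM]; exists M => x Kx.
by rewrite ltW//; apply: HM; exists x.
Qed.

Theorem flat_frame (R : realType) n p (B : 'I_n -> 'rV[R]_n -> 'M[R]_p)
    (O : set 'rV[R]_n) : open O -> O 0 ->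
  (forall l i j, Cr_on 1 O ((fun z => B l z i j) : 'rV[R]_n -> R^o)) ->
  (forall y u v, O y -> dconn B y u v - dconn B y v u
     + conn B y u *m conn B y v - conn B y v *m conn B y u = 0) ->
  exists r (g : 'rV[R]_n -> 'M[R]_p), [/\ 0 < r, forall x, `|x| < r -> O x,
    g 0 = 1%:M &
    forall x : 'rV[R]_n, `|x| < r -> is_diff x g (fun v => g x *m conn B x v)].
Proof.
move=> oO O0 CB flat.
have [r1 r10 Hr1] := (open_forP O).1 oO 0 O0.
pose r0 := r1 / 2; have r00 : 0 < r0 by rewrite divr_gt0.
pose K := [set y : 'rV[R]_n | `|0 - y| <= r0].
have cK : compact K := @closed_ball_rV_compact R n 0 r0.
have KO y : K y -> O y.
  by move=> Ky; apply: Hr1; apply: le_lt_trans Ky _; rewrite /r0; lra.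
have Bcont l i j y : K y -> {for y, continuous ((fun z => B l z i j) : 'rV[R]_n -> R^o)}.
  by move=> /KO Oy; apply: differentiable_continuous; have [H _] := CB l i j; exact: H.
have DBcont l i j m y : K y ->
  {for y, continuous (fun z => 'd ((fun z => B l z i j) : 'rV[R]_n -> R^o) z (delta_mx 0 m) : R^o)}.
  by move=> /KO Oy; have [_ H] := CB l i j; exact: H.
pose T := ('I_n * 'I_p * 'I_p * 'I_n)%type.
have [M1 M10 HM1] : exists2 M : R, 0 <= M & forall t : T, forall y, K y ->
    `|B t.1.1.1 y t.1.1.2 t.1.2| <= M.
  apply: (fin_max (P := fun (t : T) M => forall y, K y -> `|B t.1.1.1 y t.1.1.2 t.1.2| <= M)).
    by move=> t d d' dd' H y Ky; apply: le_trans dd'; exact: H.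
  by move=> [[[l i] j] m]; exact: compact_bounded_fun cK (Bcont l i j).
have [M2 M20 HM2] : exists2 M : R, 0 <= M & forall t : T, forall y, K y ->
    `|'d ((fun z => B t.1.1.1 z t.1.1.2 t.1.2) : 'rV[R]_n -> R^o) y (delta_mx 0 t.2)| <= M.
  apply: (fin_max (P := fun (t : T) M => forall y, K y ->
    `|'d ((fun z => B t.1.1.1 z t.1.1.2 t.1.2) : 'rV[R]_n -> R^o) y (delta_mx 0 t.2)| <= M)).
    by move=> t d d' dd' H y Ky; apply: le_trans dd'; exact: H.
  by move=> [[[l i] j] m]; exact: compact_bounded_fun cK (DBcont l i j m).
have unif (e : R) : 0 < e -> exists2 d : R, 0 < d & forall t : T, forall y z, K y -> `|y - z| < d ->
    `|'d ((fun z => B t.1.1.1 z t.1.1.2 t.1.2) : 'rV[R]_n -> R^o) y (delta_mx 0 t.2)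
     - 'd ((fun z => B t.1.1.1 z t.1.1.2 t.1.2) : 'rV[R]_n -> R^o) z (delta_mx 0 t.2)| <= e.
  move=> e0; apply: (fin_min (P := fun (t : T) d => forall y z, K y -> `|y - z| < d ->
    `|'d ((fun z => B t.1.1.1 z t.1.1.2 t.1.2) : 'rV[R]_n -> R^o) y (delta_mx 0 t.2)
     - 'd ((fun z => B t.1.1.1 z t.1.1.2 t.1.2) : 'rV[R]_n -> R^o) z (delta_mx 0 t.2)| <= e)).
    by move=> t d d' d'd H y z Ky yz; apply: H => //; exact: lt_le_trans d'd.
  move=> [[[l i] j] m]; have [d d0 Hd] := compact_unif_continuous cK (DBcont l i j m) e0.
  by exists d => // y z Ky yz; rewrite ltW//; exact: Hd.
(* One constant serves both bounds: the first term bounds [conn], a sum over [n] coefficients, the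
   second [dconn], a sum over [n * n] partial derivatives. *)
pose C := n%:R * M1 + n%:R * n%:R * M2.
have C0 : 0 <= C by rewrite addr_ge0// !mulr_ge0.
(* The second term yields [p C r <= 1/2]; the added 1 covers [p C = 0]. *)
pose r := Order.min r0 (2 * (p%:R * C + 1))^-1.
have den : 0 < 2 * (p%:R * C + 1) by rewrite mulr_gt0// ltr_wpDl// mulr_ge0.
have r_gt0 : 0 < r by rewrite lt_min r00 invr_gt0.
have rK y : `|y| < r -> K y.
  by rewrite lt_min => /andP[yr _]; rewrite /K/= sub0r normrN ltW.
have sum2 (F : 'I_n -> 'I_n -> R) (b : R) (u v : 'rV[R]_n) : 0 <= b ->
    (forall l m, `|F l m| <= b) ->
    `|\sum_l \sum_m (v 0 l * u 0 m) * F l m| <= n%:R * n%:R * b * `|u| * `|v|.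
  move=> b0 Fb; apply: le_trans (ler_norm_sum _ _ _) _.
  apply: (@le_trans _ _ (\sum_(l < n) \sum_(m < n) `|v| * `|u| * b)).
    apply: ler_sum => l _; apply: le_trans (ler_norm_sum _ _ _) _.
    by apply: ler_sum => m _; rewrite !normrM !ler_pM ?mx_entry_le// mulr_ge0.
  by rewrite !sumr_const !card_ord -!mulrnA -[leLHS]mulr_natl natrM le_eqVlt; apply/orP; left; apply/eqP; ring.
have [] := @euler_frame R n p B r C r_gt0 C0.
- by move=> y /rK/KO Oy l i j; have [H _] := CB l i j; exact: H.
- move=> y v /rK Ky; apply: mx_norm_le => [|i j]; first by rewrite mulr_ge0.
  rewrite summxE; apply: le_trans (ler_norm_sum _ _ _) _.
  apply: (@le_trans _ _ (\sum_(l < n) `|v| * M1)).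
    apply: ler_sum => l _; rewrite mxE normrM ler_pM ?mx_entry_le//.
    exact: (HM1 (l, i, j, l)).
  rewrite sumr_const card_ord -[leLHS]mulr_natl mulrCA mulrC ler_wpM2r//.
  by rewrite lerDl !mulr_ge0.
- have rden : r <= (2 * (p%:R * C + 1))^-1 by rewrite ge_min lexx orbT.
  apply: (@le_trans _ _ (p%:R * C * (2 * (p%:R * C + 1))^-1)); first by rewrite ler_wpM2l// mulr_ge0.
  rewrite ler_pdivrMr//; lra.
- move=> y u v /rK Ky; apply: mx_norm_le => [|i j]; first by rewrite !mulr_ge0.
  rewrite dconnE.
  apply: le_trans (sum2 _ _ u v M20 _) _; first by move=> l m; exact: (HM2 (l, i, j, m)).
  by rewrite ler_wpM2r// ler_wpM2r// lerDr mulr_ge0.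
- move=> e e0.
  pose e' := e / (n%:R * n%:R + 1).
  have nn : 0 < n%:R * n%:R + 1 :> R by rewrite ltr_wpDl// mulr_ge0.
  have e'0 : 0 < e' by rewrite divr_gt0.
  have [d d0 Hd] := unif e' e'0; exists d => // y z u v /rK Ky zr yz.
  apply: mx_norm_le => [|i j]; first by rewrite !mulr_ge0// ltW.
  rewrite dconn_subE.
  apply: le_trans (sum2 _ _ u v (ltW e'0) _) _.
    by move=> l m; exact: (Hd (l, i, j, m)).
  rewrite ler_wpM2r// ler_wpM2r// /e' mulrCA ler_piMr//; first exact: ltW.
  by rewrite ler_pdivrMr// mul1r lerDl.
- by move=> y u v /rK/KO Oy; exact: flat.
by move=> g g0 Hg; exists r, g; split=> // x /rK/KO.
Qed.

(** * The inverse function theorem for continuous selections *)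

Section Dot.
Variables (R : realType) (n : nat).
Local Notation V := 'rV[R]_n.

(** Row vectors carry the sup norm, whereas separation needs an inner product; [dot_le] and
    [sqr_norm_le_dot] compare the two. *)
Definition dot (a b : V) : R := \sum_i a 0 i * b 0 i.

Lemma dotC a b : dot a b = dot b a.
Proof. by apply: eq_bigr => i _; rewrite mulrC. Qed.

Lemma dotDr a b c : dot a (b + c) = dot a b + dot a c.
Proof. by rewrite -big_split; apply: eq_bigr => i _; rewrite mxE mulrDr. Qed.

Lemma dotZr a (k : R) b : dot a (k *: b) = k * dot a b.
Proof. by rewrite mulr_sumr; apply: eq_bigr => i _; rewrite mxE mulrCA. Qed.

Lemma dot0r a : dot a 0 = 0.
Proof. by rewrite -(scale0r 0) dotZr mul0r. Qed.

Lemma dotNr a b : dot a (- b) = - dot a b.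
Proof. by rewrite -scaleN1r dotZr mulN1r. Qed.

Lemma dotBr a b c : dot a (b - c) = dot a b - dot a c.
Proof. by rewrite dotDr dotNr. Qed.

Lemma dotDl a b c : dot (a + b) c = dot a c + dot b c.
Proof. by rewrite dotC dotDr !(dotC c). Qed.

Lemma dotZl (k : R) a b : dot (k *: a) b = k * dot a b.
Proof. by rewrite dotC dotZr dotC. Qed.

Lemma dot_ge0 a : 0 <= dot a a.
Proof. by apply: sumr_ge0 => i _; rewrite -expr2 sqr_ge0. Qed.

Lemma dot_le a b : `|dot a b| <= n%:R * `|a| * `|b|.
Proof.
apply: le_trans (ler_norm_sum _ _ _) _.
apply: (@le_trans _ _ (\sum_(i < n) `|a| * `|b|)).
  by apply: ler_sum => i _; rewrite normrM ler_pM ?mx_entry_le.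
by rewrite sumr_const card_ord -[leLHS]mulr_natl mulrA.
Qed.

Lemma sqr_norm_le_dot a : `|a| ^+ 2 <= dot a a.
Proof.
have [->|a0] := eqVneq a 0.
  by rewrite normr0 expr0n/= dot_ge0.
have [i Hi] : exists i, `|a| = `|a 0 i|.
  have [|[i j] /= E] := @mx_norm_neq0 _ _ _ a.
    by apply: contra_neq a0 => /mx_norm_eq0.
  by exists j; rewrite (ord1 i) in E.
rewrite Hi real_normK ?num_real// /dot (bigD1 i)//= expr2 lerDl.
by apply: sumr_ge0 => j _; rewrite -expr2 sqr_ge0.
Qed.

Lemma dot_eq0 a : dot a a = 0 -> a = 0.
Proof.
move=> H; have := sqr_norm_le_dot a; rewrite H => Ha.
by apply/eqP; rewrite -normr_eq0 -sqrf_eq0 eq_le Ha sqr_ge0.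
Qed.

Lemma dot_mulmxr (a b : V) (A : 'M[R]_n) : dot a (b *m A) = dot (a *m A^T) b.
Proof.
rewrite /dot; under eq_bigr do rewrite mxE mulr_sumr.
rewrite exchange_big/=; apply: eq_bigr => i _; rewrite mxE mulr_suml.
by apply: eq_bigr => j _; rewrite mxE; ring.
Qed.

End Dot.

Section ContinuousSums.
Variables (R : realType) (T : topologicalType).

Lemma continuous_bigsum (I : finType) (f : I -> T -> R) :
  (forall i, continuous (f i)) -> continuous (fun x => \sum_i f i x).
Proof.
move=> H; have -> : (fun x => \sum_i f i x) = \sum_i f i.
  by apply/funext => x; rewrite fct_sumE.
apply: (big_ind (fun g : T -> R => continuous g)) => //.
- by move=> x; exact: cst_continuous.
- by move=> g h cg ch x; apply: continuousD; [exact: cg|exact: ch].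
Qed.

Lemma continuous_dot n (f g : T -> 'rV[R]_n) : continuous f -> continuous g ->
  continuous (fun x => dot (f x) (g x)).
Proof.
move=> cf cg; apply: continuous_bigsum => i x.
apply: continuousM; first exact: continuous_comp (cf x) (@coord_continuous _ _ _ _ _ _).
exact: continuous_comp (cg x) (@coord_continuous _ _ _ _ _ _).
Qed.

Lemma continuous_mx_for p q (f : T -> 'M[R]_(p, q)) x :
  (forall i j, {for x, continuous (fun y => f y i j)}) -> {for x, continuous f}.
Proof.
move=> H; apply/cvgrPdist_lt => e e0; have e20 : 0 < e / 2 by rewrite divr_gt0.
have K2 : \forall y \near x, forall ij : 'I_p * 'I_q, `|f x ij.1 ij.2 - f y ij.1 ij.2| < e / 2.
  by apply: filter_forall => -[i j]; apply: (cvgrPdist_lt _ _).1 (H i j) _ e20.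
apply: filterS K2 => y Hy; apply: (@le_lt_trans _ _ (e / 2)); last by lra.
by apply: mx_norm_le => [|i j]; [exact: ltW|rewrite mx_subE ltW//; exact: (Hy (i, j))].
Qed.

Lemma continuous_rV_for n (f : T -> 'rV[R]_n) x :
  (forall i, {for x, continuous (fun y => f y 0 i)}) -> {for x, continuous f}.
Proof. by move=> H; apply: continuous_mx_for => i j; rewrite (ord1 i); exact: H. Qed.

Lemma continuous_rV n (f : T -> 'rV[R]_n) :
  (forall i, continuous (fun x => f x 0 i)) -> continuous f.
Proof. by move=> H x; apply: continuous_rV_for => i; exact: H. Qed.

End ContinuousSums.

Section Hull.
Variables (R : realType) (m : nat).

Definition simplex : set 'rV[R]_m :=
  [set c | (forall i, 0 <= c 0 i) /\ \sum_i c 0 i = 1].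

Lemma simplex_compact : compact simplex.
Proof.
apply: (subclosed_compact _ (@closed_ball_rV_compact R m 0 1)).
  have -> : simplex = \bigcap_(i in setT) [set c : 'rV[R]_m | 0 <= c 0 i] `&`
      [set c | \sum_i c 0 i = 1].
    by apply/seteqP; split => c [] H1 H2; split=> // i; move: (H1 i) => // /(_ I).
  apply: closedI.
    apply: closed_bigI => i _.
    apply: (@closed_comp _ _ (fun c : 'rV[R]_m => c 0 i) [set x : R | 0 <= x]).
      by move=> c _; exact: coord_continuous.
    exact: closed_ge.
  apply: (@closed_comp _ _ (fun c : 'rV[R]_m => \sum_i c 0 i) [set x : R | x = 1]).
    by move=> c _; apply: continuous_bigsum => i; exact: coord_continuous.
  exact: closed_eq.
move=> c [c0 c1] /=; rewrite sub0r normrN; apply: mx_norm_le => // i j.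
rewrite ord1 ger0_norm// -c1 (bigD1 j)//= lerDl.
by apply: sumr_ge0 => ? _.
Qed.

Lemma simplex_delta i : simplex (delta_mx 0 i).
Proof.
split=> [j|]; first by rewrite mxE ler0n.
rewrite (bigD1 i)//= mxE !eqxx big1 ?addr0// => j ji.
by rewrite mxE (negbTE ji) andbF.
Qed.

Lemma simplex_convex (c d : 'rV[R]_m) (t : R) : simplex c -> simplex d ->
  0 <= t <= 1 -> simplex (c + t *: (d - c)).
Proof.
move=> [c0 c1] [d0 d1] /andP[t0 t1]; split=> [i|].
  rewrite !mxE; have := c0 i; have := d0 i; nra.
under eq_bigr do rewrite !mxE.
by rewrite big_split/= -mulr_sumr sumrB c1 d1 subrr mulr0 addr0.
Qed.

(* The point of least norm of the hull separates it from the origin. *)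
Lemma hull_separation n (u : 'I_m -> 'rV[R]_n) (mu : R) (i0 : 'I_m) :
  (forall c, simplex c -> mu <= dot (\sum_i c 0 i *: u i) (\sum_i c 0 i *: u i)) ->
  exists2 c, simplex c & forall i, mu <= dot (\sum_i c 0 i *: u i) (u i).
Proof.
move=> Hmu; pose z (c : 'rV[R]_m) := \sum_i c 0 i *: u i.
have cz : continuous z.
  apply: continuous_rV => j.
  have -> : (fun c => z c 0 j) = (fun c : 'rV[R]_m => \sum_i c 0 i * u i 0 j).
    by apply/funext => c; rewrite summxE; apply: eq_bigr => i _; rewrite mxE.
  apply: continuous_bigsum => i c; apply: continuousM; first exact: coord_continuous.
  exact: cst_continuous.
have [||c] := @compact_EVT_min _ R (fun c => dot (z c) (z c)) simplex _ simplex_compact.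
- by exists (delta_mx 0 i0); exact: simplex_delta.
- by apply: continuous_subspaceT; exact: continuous_dot.
move=> /set_mem Sc minc; exists c => // i.
apply: le_trans (Hmu _ Sc) _; rewrite -/(z c) -subr_ge0 -dotBr.
have [w Ew] : exists w, w = u i - z c by exists (u i - z c).
rewrite -Ew leNgt; apply/negP => neg.
have zt (t : R) : z (c + t *: (delta_mx 0 i - c)) = z c + t *: w.
  rewrite Ew /z; under eq_bigr do rewrite !mxE scalerDl.
  rewrite big_split/=; congr (_ + _).
  under eq_bigr do rewrite -scalerA scalerBl.
  rewrite -scaler_sumr sumrB; congr (_ *: (_ - _)).
  rewrite (bigD1 i)//= !eqxx scale1r big1 ?addr0// => j ji.
  by rewrite (negbTE ji) scale0r.
have q (t : R) : 0 <= t <= 1 -> 0 <= t * (2 * dot (z c) w + t * dot w w).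
  move=> t01; have := minc (c + t *: (delta_mx 0 i - c)).
  rewrite inE => /(_ (simplex_convex Sc (simplex_delta i) t01)).
  rewrite zt dotDl !dotDr !dotZr !dotZl (dotC w) => H.
  have -> : t * (2 * dot (z c) w + t * dot w w) =
    dot (z c) (z c) + t * dot (z c) w + (t * dot (z c) w + t * (t * dot w w)) - dot (z c) (z c) by ring.
  by rewrite subr_ge0; move: H; rewrite !mulrA.
(* The step [t = - dot (z c) w / D] is at most 1 and satisfies [t * dot w w <= - dot (z c) w], so
   the linear term wins and the norm would decrease towards [u i]. *)
pose D := dot w w + 1 - dot (z c) w.
have D0 : 0 < D by have := dot_ge0 w; rewrite /D; lra.
pose t := - dot (z c) w / D.
have t0 : 0 < t by rewrite divr_gt0// oppr_gt0.
have t1 : t <= 1 by rewrite ler_pdivrMr// mul1r /D; have := dot_ge0 w; lra.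
have := q t; rewrite (ltW t0) t1 => /(_ isT); rewrite pmulr_rge0// leNgt => /negP; apply.
have : t * dot w w <= - dot (z c) w.
  rewrite /t mulrAC ler_pdivrMr// ler_wpM2l ?oppr_ge0 ?ltW// /D; lra.
lra.
Qed.

(** A continuous function that is positive on the compact product of the simplex and the unit sphere
    has a positive minimum. *)
Lemma hull_lower_bound n (A : 'I_m -> 'M[R]_n) :
  (forall c (v : 'rV[R]_n), simplex c -> v != 0 -> \sum_i c 0 i *: (v *m A i) != 0) ->
  exists2 mu : R, 0 < mu & forall c (v : 'rV[R]_n), simplex c -> `|v| = 1 ->
    mu <= dot (\sum_i c 0 i *: (v *m A i)) (\sum_i c 0 i *: (v *m A i)).
Proof.
move=> H; pose S1 := [set v : 'rV[R]_n | `|v| = 1].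
have cS1 : compact S1.
  apply: (subclosed_compact _ (@closed_ball_rV_compact R n 0 1)).
    apply: (@closed_comp _ _ (fun v : 'rV[R]_n => `|v|) [set x : R | x = 1]).
      by move=> v _; exact: norm_continuous.
    exact: closed_eq.
  by move=> v /= v1; rewrite sub0r normrN v1.
pose K := simplex `*` S1.
have cK : compact K by apply: compact_setX => //; exact: simplex_compact.
(* The product is empty when [m = 0] or [n = 0]; any positive [mu] will do there. *)
have [K0|/set0P/negP/negPn/eqP K0] := pselect (K !=set0); last first.
  exists 1 => // c v Sc v1; exfalso; suff : (set0 : set ('rV[R]_m * 'rV[R]_n)) (c, v) by [].
  by rewrite -K0; split.
pose z (x : 'rV[R]_m * 'rV[R]_n) := \sum_i x.1 0 i *: (x.2 *m A i).
have cz : continuous z.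
  apply: continuous_rV => j.
  have -> : (fun x => z x 0 j) = (fun x : 'rV[R]_m * 'rV[R]_n =>
       \sum_i x.1 0 i * \sum_l x.2 0 l * A i l j).
    apply/funext => x; rewrite summxE; apply: eq_bigr => i _; rewrite mxE; congr (_ * _).
    by rewrite mxE.
  apply: continuous_bigsum => i x; apply: continuousM.
    exact: continuous_comp (@cvg_fst _ _ _ _ _) (@coord_continuous _ _ _ _ _ _).
  apply: (@continuous_bigsum _ _ _ (fun l (x : 'rV[R]_m * 'rV[R]_n) => x.2 0 l * A i l j)) => l y.
  apply: continuousM; last exact: cst_continuous.
  exact: continuous_comp (@cvg_snd _ _ _ _ _) (@coord_continuous _ _ _ _ _ _).
have [|[c v]] := @compact_EVT_min _ R (fun c => dot (z c) (z c)) K K0 cK.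
  by apply: continuous_subspaceT; exact: continuous_dot.
move=> /set_mem[/= Sc v1] minc.
exists (dot (z (c, v)) (z (c, v))).
  rewrite lt_def dot_ge0 andbT; apply/eqP => /dot_eq0 /eqP; apply/negP.
  by apply: H => //; rewrite -normr_eq0 v1 oner_eq0.
by move=> c' v' Sc' v1'; apply: (minc (c', v')); rewrite inE; split.
Qed.

End Hull.

(** The selection [s] need not be differentiable. With [t1] the supremum of the times where
    [h = s - c t] is at least [h 0], any index active slightly after [t1] is already active at [t1],
    so the mean value theorem for that single [f i] pushes the supremum further unless [t1 = 1]. *)
Lemma selection_mono (R : realType) (m : nat) (s : R -> R) (f df : 'I_m -> R -> R)
    (c : R) :
  (forall t : R, 0 <= t <= 1 -> {for t, continuous s}) ->
  (forall t : R, 0 <= t <= 1 -> exists i, s t = f i t) ->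
  (forall i (t : R), 0 <= t <= 1 -> is_derive t 1 (f i) (df i t)) ->
  (forall i (t : R), 0 <= t <= 1 -> c <= df i t) ->
  c <= s 1 - s 0.
Proof.
move=> cs sel fdf cdf; pose h t := s t - c * t.
have ch (t : R) : 0 <= t <= 1 -> {for t, continuous h}.
  move=> t01; apply: continuousB; first exact: cs.
  by apply: continuousM; [exact: cst_continuous|exact: cvg_id].
have cf i (t : R) : 0 <= t <= 1 -> {for t, continuous (f i)}.
  by move=> /(fdf i)[/derivable1_diffP/differentiable_continuous].
pose E := [set t : R | 0 <= t <= 1 /\ h 0 <= h t].
have E0 : E 0 by split=> //; rewrite lexx ler01.
have hsE : has_sup E by split; [exists 0|exists 1 => t [/andP[]]].
pose t1 := sup E.
have t1_01 : 0 <= t1 <= 1.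
  apply/andP; split; first by apply: ub_le_sup => //; exact: hsE.2.
  by apply: ge_sup; [exists 0|move=> t [/andP[]]].
have Et1 : h 0 <= h t1.
  rewrite leNgt; apply/negP => lt1.
  have d0 : 0 < h 0 - h t1 by rewrite subr_gt0.
  have [d d_gt0 Hd] := (continuous_forP _ _).1 (ch _ t1_01) _ d0.
  have [t [t01 ht] tt1] := sup_adherent d_gt0 hsE.
  have tle : t <= t1 by apply: ub_le_sup => //; exact: hsE.2.
  have := Hd t; rewrite ger0_norm ?subr_ge0// ltrBlDl -ltrBlDr => /(_ tt1).
  by rewrite distrC => /ltr_normlW; lra.
have [t1E|t1_lt1] := eqVneq t1 1.
  by move: Et1; rewrite t1E /h mulr1 mulr0; lra.
exfalso; have {t1_lt1} t1_lt1 : t1 < 1 by rewrite lt_neqAle t1_lt1; case/andP: t1_01.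
(* Indices inactive at [t1] remain inactive nearby, by continuity and finiteness. *)
have [d d0 Hd] : exists2 d : R, 0 < d & forall i t, 0 <= t <= 1 -> `|t1 - t| < d ->
    f i t1 != s t1 -> f i t != s t.
  apply: (fin_min (P := fun i d => forall t, 0 <= t <= 1 -> `|t1 - t| < d ->
    f i t1 != s t1 -> f i t != s t)).
    by move=> i d d' d'd H t t01 td; apply: H => //; exact: lt_le_trans d'd.
  move=> i; case: (eqVneq (f i t1) (s t1)) => [E1|ne].
    by exists 1 => // t _ _; rewrite E1 eqxx.
  have e0 : 0 < `|f i t1 - s t1| by rewrite normr_gt0 subr_eq0.
  have cg : {for t1, continuous (fun t => f i t - s t)} by apply: continuousB; [exact: cf|exact: cs].
  have [d d0 Hd] := (continuous_forP _ _).1 cg _ e0.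
  exists d => // t t01 td _; apply: contraTneq (Hd t td) => ->.
  by rewrite subrr subr0 -leNgt.
pose t2 := Order.min ((t1 + 1) / 2) (t1 + d / 2).
have t12 : t1 < t2 by rewrite lt_min; apply/andP; split; lra.
have t2_1 : t2 <= 1 by rewrite ge_min; apply/orP; left; lra.
have t2d : t2 - t1 <= d / 2 by rewrite lerBlDl ge_min lexx orbT.
have t1_0 : 0 <= t1 by case/andP: t1_01.
have t2_01 : 0 <= t2 <= 1 by rewrite t2_1 andbT; lra.
have [i si] := sel t2 t2_01.
have fi : f i t1 = s t1.
  apply/eqP; apply: contraT => ne; have := Hd i t2 t2_01.
  rewrite distrC ger0_norm ?subr_ge0 ?(ltW t12)// => /(_ _ ne)/negP H; exfalso; apply: H.
    by lra.
  by rewrite si.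
have in01 (z : R) : t1 <= z -> z <= t2 -> 0 <= z <= 1.
  by move=> z1 z2; apply/andP; split; lra.
have [||z] := @MVT_segment R (f i) (df i) t1 t2 (ltW t12).
- by move=> z; rewrite in_itv/= => /andP[/ltW z1 /ltW z2]; apply: fdf; exact: in01.
- apply: continuous_in_subspaceT => z; rewrite inE/= in_itv/= => /andP[z1 z2].
  by apply: cf; exact: in01.
rewrite in_itv/= => /andP[z1 z2] Ez.
have cz := cdf i z (in01 z z1 z2).
have : E t2.
  split=> //; apply: le_trans Et1 _; rewrite /h si -fi.
  have : c * (t2 - t1) <= df i z * (t2 - t1) by rewrite ler_wpM2r// subr_ge0 ltW.
  lra.
move=> /(ub_le_sup hsE.2); rewrite -/t1; lra.
Qed.

Section InverseFunction.
Variables (R : realType) (n m : nat).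
Local Notation V := 'rV[R]_n.
Variables (O : set V) (Phi : V -> V) (f : 'I_m -> V -> V) (J : 'I_m -> V -> 'M[R]_n).
Variable y0 : V.
Hypothesis O_open : open O.
Hypothesis O_y0 : O y0.
Hypothesis Phi_cont : forall y, O y -> {for y, continuous Phi}.
Hypothesis Phi_sel : forall y, O y -> exists i, Phi y = f i y.
Hypothesis f_diff : forall i y, O y -> is_diff y (f i) (fun v => v *m J i y).
Hypothesis J_cont : forall i, {for y0, continuous (J i)}.
Hypothesis J_hull : forall c (v : V), simplex c -> v != 0 ->
  \sum_i c 0 i *: (v *m J i y0) != 0.

Lemma selection_dot (w x v : V) (b : R) :
  (forall t : R, 0 <= t <= 1 -> O (x + t *: v)) ->
  (forall i (t : R), 0 <= t <= 1 -> b <= dot w (v *m J i (x + t *: v))) ->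
  b <= dot w (Phi (x + v) - Phi x).
Proof.
move=> xO Hb.
have := @selection_mono R m (fun t => dot w (Phi (x + t *: v)))
  (fun i t => dot w (f i (x + t *: v))) (fun i t => dot w (v *m J i (x + t *: v))) b.
rewrite scale1r scale0r addr0 -dotBr; apply=> //.
- move=> t t01.
  have cP : {for t, continuous (fun t : R => Phi (x + t *: v))}.
    apply: continuous_comp; last exact: Phi_cont (xO t t01).
    apply: continuousD; first exact: cst_continuous.
    exact: scalel_continuous.
  have cd : continuous (dot w).
    by apply: continuous_dot; [exact: cst_continuous|move=> ?; exact: cvg_id].
  exact: continuous_comp cP (cd _).
- by move=> t t01; have [i ->] := Phi_sel (xO t t01); exists i.
- move=> i t t01; have D := f_diff i (xO t t01).
  have D' : is_derive t 1 (fun t : R => f i (x + t *: v)) (v *m J i (x + t *: v)).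
    apply: (is_derive_line (f := f i)).
    have [Hd HE] := D; apply: DeriveDef; first exact: diff_derivable.
    by rewrite deriveE// HE.
  rewrite /dot.
  have -> : (fun t : R => \sum_j w 0 j * f i (x + t *: v) 0 j) =
     \sum_j (w 0 j *: (fun t : R => f i (x + t *: v) 0 j : R^o)).
    by apply/funext => s; rewrite fct_sumE.
  apply: is_derive_sum => j; apply: is_deriveZ.
  exact: is_derive_entry D'.
Qed.

Lemma sup_norm_scale (v : V) : v != 0 -> exists2 v1 : V, `|v1| = 1 & v = `|v| *: v1.
Proof.
move=> v0; have nv0 : `|v| != 0 by rewrite normr_eq0.
exists (`|v|^-1 *: v); last by rewrite scalerA divff// scale1r.
by rewrite normrZ normfV normr_id mulVf.
Qed.

(** The point is the order of quantifiers: [w] depends on [v] alone and [v] on [e] alone, and each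
    works for all indices and all nearby points, as [selection_dot] demands. The first family gives
    injectivity of [Phi], the second openness. *)
Lemma uniform_separation : exists mu L r : R, [/\ 0 < mu, 0 < L, 0 < r,
   forall y, `|y0 - y| < r -> O y &
  [/\ forall v : V, exists2 w : V, `|w| <= L &
        forall i y, `|y0 - y| < r -> mu * `|v| <= dot w (v *m J i y),
      forall e : V, exists2 v : V, `|v| <= L &
        forall i y, `|y0 - y| < r -> mu * `|e| <= dot e (v *m J i y) &
      forall i y (v : V), `|y0 - y| < r -> `|v *m J i y| <= L * `|v|]].
Proof.
have [i0 _] := Phi_sel O_y0.
have [mu mu0 Hmu] := hull_lower_bound J_hull.
have [L L0 HL] : exists2 L : R, 0 <= L & forall i, `|J i y0| <= L.
  apply: (fin_max (P := fun i L => `|J i y0| <= L)).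
    by move=> t d d' dd'; move=> /le_trans; apply.
  by move=> i; exists `|J i y0|.
(* Every matrix in the hull is invertible, hence so is its transpose, and the bound applies to the
   transposed Jacobians as well. *)
have [muT muT0 HmuT] : exists2 mu : R, 0 < mu & forall c (v : V), simplex c -> `|v| = 1 ->
    mu <= dot (\sum_i c 0 i *: (v *m (J i y0)^T)) (\sum_i c 0 i *: (v *m (J i y0)^T)).
  apply: (hull_lower_bound (A := fun i => (J i y0)^T)) => c v Sc v0.
  pose M := \sum_i c 0 i *: J i y0.
  have ME (u : V) : u *m M = \sum_i c 0 i *: (u *m J i y0).
    by rewrite mulmx_sumr; apply: eq_bigr => i _; rewrite scalemxAr.
  have MT (u : V) : u *m M^T = \sum_i c 0 i *: (u *m (J i y0)^T).
    rewrite linear_sum mulmx_sumr; apply: eq_bigr => i _.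
    by rewrite linearZ/= scalemxAr.
  rewrite -MT; have Mu : M \in unitmx.
    rewrite -row_free_unit -kermx_eq0; apply: contraT => /rowV0Pn[u /sub_kermxP uM u0].
    by have := J_hull Sc u0; rewrite -ME uM eqxx.
  have MTu : M^T \in unitmx by rewrite unitmx_tr.
  by apply: contraNneq v0 => E; rewrite -(mulmxK MTu v) E mul0mx.
pose b := Order.min mu muT.
have b0 : 0 < b by rewrite lt_min mu0 muT0.
(* [L1] dominates the images of unit vectors under matrices of norm at most [L + 1]. Below,
   [eta <= 1] puts the nearby Jacobians under that bound, and [n * n * L1 * eta <= b / 2] preserves
   half of the separation. *)
pose L1 := n%:R * (L + 1) + 1.
have L10 : 0 < L1 by rewrite ltr_wpDl// mulr_ge0// addr_ge0.
pose eta := Order.min 1 (b / 2 / (n%:R * n%:R * L1 + 1)).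
have den : 0 < n%:R * n%:R * L1 + 1 by rewrite ltr_wpDl// !mulr_ge0// ltW.
have eta0 : 0 < eta by rewrite lt_min ltr01 !divr_gt0.
have [r1 r10 Hr1] := (open_forP O).1 O_open y0 O_y0.
have [r2 r20 Hr2] : exists2 d : R, 0 < d & forall i y, `|y0 - y| < d -> `|J i y0 - J i y| < eta.
  apply: (fin_min (P := fun i d => forall y, `|y0 - y| < d -> `|J i y0 - J i y| < eta)).
    by move=> i d d' d'd H y yd; apply: H; exact: lt_le_trans d'd.
  by move=> i; exact: (continuous_forP _ _).1 (J_cont (i:=i)) _ eta0.
exists (b / 2), L1, (Order.min r1 r2); split=> //.
- by rewrite divr_gt0.
- by rewrite lt_min r10 r20.
- by move=> y; rewrite lt_min => /andP[yr _]; exact: Hr1.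
have pert (w v : V) i y : `|y0 - y| < Order.min r1 r2 -> `|w| * `|v| <= L1 ->
    dot w (v *m J i y0) - b / 2 <= dot w (v *m J i y).
  rewrite lt_min => /andP[_ /(Hr2 i)/ltW Jr] wv.
  rewrite lerBlDr -lerBlDl -dotBr -mulmxBr.
  apply: le_trans (ler_norm _) _; apply: le_trans (dot_le _ _) _.
  apply: (@le_trans _ _ (n%:R * n%:R * L1 * eta)).
    rewrite -!mulrA ler_wpM2l//.
    apply: (@le_trans _ _ (`|w| * (n%:R * (`|v| * eta)))).
      rewrite ler_wpM2l// (le_trans (mx_norm_mul _ _))// -mulrA ler_wpM2l// ler_wpM2l//.
    by rewrite mulrCA ler_wpM2l// mulrA ler_wpM2r// ltW.
  apply: (@le_trans _ _ ((n%:R * n%:R * L1 + 1) * eta)).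
    by rewrite ler_wpM2r ?(ltW eta0)// lerDl.
  by rewrite mulrC -ler_pdivlMr// ge_min lexx orbT.
have nrm (u : V) (A : 'M[R]_n) : `|u| = 1 -> `|A| <= L -> `|u *m A| <= L1.
  move=> u1 AL; apply: le_trans (mx_norm_mul _ _) _; rewrite u1 mulr1 /L1.
  apply: (@le_trans _ _ (n%:R * (L + 1))); last by rewrite lerDl.
  by rewrite ler_wpM2l// (le_trans AL)// lerDl.
have hullB c (u : 'I_m -> V) : simplex c -> (forall i, `|u i| <= L1) ->
    `|\sum_i c 0 i *: u i| <= L1.
  move=> [c0 c1] uL; apply: le_trans (ler_norm_sum _ _ _) _.
  rewrite -[leRHS]mul1r -c1 mulr_suml; apply: ler_sum => i _.
  by rewrite normrZ ger0_norm// ler_wpM2l.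
split.
- move=> v; have [->|v0] := eqVneq v 0.
    exists 0; first by rewrite normr0 ltW.
    by move=> i y _; rewrite normr0 mulr0 mul0mx dot0r.
  have [v1 v11 vE] := sup_norm_scale v0.
  have [c Sc Hc] := hull_separation i0 (fun c Sc => Hmu c v1 Sc v11).
  have wL : `|\sum_i c 0 i *: (v1 *m J i y0)| <= L1.
    by apply: hullB => // i; exact: nrm.
  exists (\sum_i c 0 i *: (v1 *m J i y0)) => // i y yr.
  rewrite [in leRHS]vE -scalemxAl dotZr mulrC ler_wpM2l//.
  apply: le_trans (pert _ v1 i y yr _); last by rewrite v11 mulr1.
  have bmu : b <= mu by rewrite ge_min lexx.
  by have := Hc i; lra.
- move=> e; have [->|e0] := eqVneq e 0.
    exists 0; first by rewrite normr0 ltW.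
    by move=> i y _; rewrite normr0 mulr0 mul0mx dot0r.
  have [e1 e11 eE] := sup_norm_scale e0.
  have [c Sc Hc] := hull_separation i0 (fun c Sc => HmuT c e1 Sc e11).
  have wL : `|\sum_i c 0 i *: (e1 *m (J i y0)^T)| <= L1.
    apply: hullB => // i; apply: nrm => //.
    by apply: mx_norm_le => // k l; rewrite mxE (le_trans (mx_entry_le _ _ _)).
  exists (\sum_i c 0 i *: (e1 *m (J i y0)^T)) => // i y yr.
  rewrite [X in dot X _]eE dotZl mulrC ler_wpM2l//.
  apply: le_trans (pert e1 _ i y yr _); last by rewrite e11 mul1r.
  rewrite dot_mulmxr dotC.
  have bmu : b <= muT by rewrite ge_min lexx orbT.
  by have := Hc i; lra.
- move=> i y v; rewrite lt_min => /andP[_ /(Hr2 i)/ltW Jr].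
  apply: le_trans (mx_norm_mul _ _) _; rewrite mulrAC ler_wpM2r//.
  apply: (@le_trans _ _ (n%:R * (L + 1))); last by rewrite lerDl.
  rewrite ler_wpM2l// -(subKr (J i y0) (J i y)) (le_trans (ler_normB _ _))// lerD//.
  by apply: le_trans Jr _; rewrite ge_min lexx.
Qed.

(** Injectivity follows from a lower Lipschitz bound. For openness, the squared distance from
    [Phi y] to the target is minimized over a closed ball: the minimizer is interior, and a nonzero
    residue [e] could be reduced by moving along the vector that [uniform_separation] attaches to
    [e]. *)
Theorem pw_inverse_function : exists2 r : R, 0 < r &
  [/\ forall y, `|y0 - y| < r -> O y,
    forall x y, `|y0 - x| < r -> `|y0 - y| < r -> Phi x = Phi y -> x = y,
    forall O' : set V, open O' -> (forall y, O' y -> `|y0 - y| < r) -> open (Phi @` O') &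
    forall i y (v : V), `|y0 - y| < r -> v *m J i y = 0 -> v = 0].
Proof.
have [mu [L [r [mu0 L0 r0 rO [HR HT HB]]]]] := uniform_separation.
exists r => //.
have seg (x v : V) (t : R) : `|y0 - x| < r -> `|y0 - (x + v)| < r -> 0 <= t <= 1 ->
    `|y0 - (x + t *: v)| < r.
  rewrite !opprD !addrA -!scalerN => xr xvr t01; exact: seg_in.
pose k := mu / (n%:R * L + 1).
have den : 0 < n%:R * L + 1 by rewrite ltr_wpDl// mulr_ge0// ltW.
have k0 : 0 < k by rewrite divr_gt0.
have low (x y : V) : `|y0 - x| < r -> `|y0 - y| < r -> k * `|x - y| <= `|Phi x - Phi y|.
  move=> xr yr; have [w wL Hw] := HR (x - y).
  have xE : x = y + (x - y) by rewrite addrC subrK.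
  have xr' : `|y0 - (y + (x - y))| < r by rewrite -xE.
  have := @selection_dot w y (x - y) (mu * `|x - y|); rewrite -xE => H.
  have {}H : mu * `|x - y| <= dot w (Phi x - Phi y).
    by apply: H => [t t01|i t t01]; [apply: rO|apply: Hw]; exact: seg.
  rewrite /k mulrAC ler_pdivrMr//; apply: le_trans H _; apply: le_trans (ler_norm _) _.
  apply: le_trans (dot_le _ _) _; rewrite [leRHS]mulrC ler_wpM2r//.
  by apply: (@le_trans _ _ (n%:R * L)); [rewrite ler_wpM2l|rewrite lerDl].
have up (x v : V) : `|y0 - x| < r -> `|y0 - (x + v)| < r -> `|Phi (x + v) - Phi x| <= L * `|v|.
  move=> xr xvr; apply: mx_norm_le => [|i j]; first by rewrite mulr_ge0// ltW.
  (* A sup norm bound requires one scalar estimate per coordinate and sign, so [selection_dot] is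
     applied with [w] a signed basis vector. *)
  have dotd (a : R) (u : V) : dot (a *: delta_mx 0 j) u = a * u 0 j.
    rewrite dotZl /dot (bigD1 j)//= mxE !eqxx mul1r big1 ?addr0// => l lj.
    by rewrite mxE (negbTE lj) andbF mul0r.
  have B (a : R) : `|a| = 1 -> - (L * `|v|) <= a * (Phi (x + v) - Phi x) 0 j.
    move=> a1; rewrite -dotd; apply: selection_dot => [t t01|l t t01].
      by apply: rO; exact: seg.
    rewrite dotd lerNl -mulNr; apply: le_trans (ler_norm _) _.
    rewrite normrM normrN a1 mul1r (le_trans (mx_entry_le _ _ _))//.
    by apply: HB; exact: seg.
  rewrite (ord1 i) ler_norml; have := B 1; have := B (-1).
  rewrite normrN normr1 !mul1r mulN1r => /(_ erefl) H1 /(_ erefl) ->.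
  by rewrite -lerN2.
split=> //.
- move=> x y xr yr E; have := low x y xr yr; rewrite E subrr normr0 => H.
  apply/eqP; rewrite -subr_eq0 -normr_le0 -(pmulr_rle0 _ k0)//.
- move=> O' oO' O'r; apply/open_forP => _ [x O'x <-].
  have [rho1 rho10 Hrho] := (open_forP O').1 oO' x O'x.
  pose rho := rho1 / 2; have rho0 : 0 < rho by rewrite divr_gt0.
  have KO' y : `|x - y| <= rho -> O' y.
    by move=> xy; apply: Hrho; apply: le_lt_trans xy _; rewrite /rho; lra.
  have n2 : 0 < n%:R + 2 :> R by rewrite ltr_wpDl.
  (* Passing between [dot] and the sup norm, a minimizer [y] has
     [|Phi y - z| <= (n + 1) |Phi x - z|], hence [|Phi x - Phi y| <= (n + 2) |Phi x - z| < k rho];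
     the lower bound then keeps [y] off the boundary of the ball. *)
  exists (k * rho / (n%:R + 2)); first by rewrite divr_gt0// mulr_gt0.
  move=> z xz; pose q y := dot (Phi y - z) (Phi y - z).
  have cq y : `|x - y| <= rho -> {for y, continuous q}.
    move=> xy; have Oy : O y by apply: rO; apply: O'r; exact: KO'.
    have c1 : {for y, continuous (fun y => Phi y - z)}.
      by apply: continuousB; [exact: Phi_cont|exact: cst_continuous].
    have c2 : continuous (fun u : V => dot u u).
      by apply: continuous_dot => u; exact: cvg_id.
    exact: continuous_comp c1 (c2 _).
  have [||y yK miny] := @compact_EVT_min _ R q _ _ (@closed_ball_rV_compact R n x rho).
  - by exists x; rewrite /= subrr normr0 ltW.
  - by apply: continuous_in_subspaceT => y /set_mem; exact: cq.
  have {}yK : `|x - y| <= rho by move: yK; rewrite inE.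
  have xr : `|y0 - x| < r by exact: O'r.
  have yr : `|y0 - y| < r by apply: O'r; exact: KO'.
  have qyx : q y <= q x by apply: miny; rewrite inE /= subrr normr0 ltW.
  have Pyz : `|Phi y - z| <= (n%:R + 1) * `|Phi x - z|.
    rewrite -ler_sqr ?nnegrE ?mulr_ge0 ?addr_ge0//.
    apply: le_trans (sqr_norm_le_dot _) _; apply: le_trans qyx _.
    apply: le_trans (ler_norm _) _; apply: le_trans (dot_le _ _) _.
    rewrite exprMn -mulrA -expr2 ler_wpM2r ?sqr_ge0//.
    have : 0 <= n%:R :> R by []. nra.
  have yin : `|x - y| < rho.
    have H := low x y xr yr; rewrite -(ltr_pM2l k0); apply: le_lt_trans H _.
    rewrite -(subrKA z) (le_lt_trans (ler_normD _ _))// [X in _ + X]distrC.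
    move: xz; rewrite ltr_pdivlMr ?ltr_wpDl//; lra.
  have [->|ne] := eqVneq z (Phi y); first by exists y => //; exact: KO'.
  exfalso; pose e := z - Phi y.
  have e0 : 0 < `|e| by rewrite normr_gt0 subr_eq0.
  have [v vL Hv] := HT e.
  pose a := rho - `|x - y|; have a0 : 0 < a by rewrite subr_gt0.
  (* The first bound keeps [y + tau v] in the ball; the second makes the quadratic term
     [n (tau L L) ^+ 2] of the squared distance smaller than the gain [tau mu |e|]. *)
  pose tau := Order.min (a / (L + 1)) (mu * `|e| / (n%:R * (L * L) * (L * L) + 1)).
  have den2 : 0 < n%:R * (L * L) * (L * L) + 1 by rewrite ltr_wpDl// !mulr_ge0// ltW.
  have L10 : 0 < L + 1 by rewrite addr_gt0.
  have tau0 : 0 < tau by rewrite lt_min !divr_gt0// mulr_gt0.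
  have tv : `|tau *: v| <= a.
    rewrite normrZ gtr0_norm//; apply: (@le_trans _ _ (tau * (L + 1))).
      by rewrite ler_wpM2l ?(ltW tau0)// (le_trans vL)// lerDl.
    by rewrite -ler_pdivlMr// ge_min lexx.
  have xyv : `|x - (y + tau *: v)| <= rho.
    rewrite opprD addrA (le_trans (ler_normB _ _))//; move: tv; rewrite /a; lra.
  have yvr : `|y0 - (y + tau *: v)| < r by apply: O'r; exact: KO'.
  have Q := miny (y + tau *: v); rewrite inE in Q; have {}Q := Q xyv.
  have U := up y (tau *: v) yr yvr.
  have S : tau * (mu * `|e|) <= dot e (Phi (y + tau *: v) - Phi y).
    apply: selection_dot => [t t01|i t t01]; first by apply: rO; exact: seg.
    by rewrite -scalemxAl dotZr ler_wpM2l ?(ltW tau0)//; apply: Hv; exact: seg.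
  move: Q S U; rewrite /q; set D := Phi (y + tau *: v) - Phi y => Q S U.
  have E1 : Phi (y + tau *: v) - z = D - e by rewrite /D /e opprB addrA subrK.
  have E2 : Phi y - z = - e by rewrite /e opprB.
  have expand (d u : V) : dot (- u) (- u) <= dot (d - u) (d - u) -> 2 * dot u d <= dot d d.
    have nl w1 w2 : dot (- w1) w2 = - dot w1 w2 by rewrite dotC dotNr dotC.
    by rewrite dotNr nl opprK dotDl !dotDr !(nl, dotNr) opprK (dotC d u); lra.
  move: Q; rewrite E1 E2 => /expand Q.
  have DD : dot D D <= n%:R * (L * (tau * L)) * (L * (tau * L)).
    apply: le_trans (ler_norm _) _; apply: le_trans (dot_le _ _) _.
    have DL : `|D| <= L * (tau * L).
      apply: le_trans U _; rewrite normrZ gtr0_norm// ler_wpM2l ?(ltW L0)//.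
      by rewrite ler_wpM2l ?(ltW tau0).
    by rewrite -mulrA -[leRHS]mulrA ler_wpM2l// ler_pM.
  have T2 : tau * (n%:R * (L * L) * (L * L) + 1) <= mu * `|e|.
    by rewrite -ler_pdivlMr// ge_min lexx orbT.
  have T3 : tau * (tau * (n%:R * (L * L) * (L * L) + 1)) <= tau * (mu * `|e|).
    by rewrite ler_wpM2l ?(ltW tau0).
  have T4 : 0 < tau * tau by rewrite mulr_gt0.
  have T5 : 0 < tau * (mu * `|e|) by rewrite !mulr_gt0.
  have T6 : n%:R * (L * (tau * L)) * (L * (tau * L)) = tau * (tau * (n%:R * (L * L) * (L * L))) by ring.
  nra.
- move=> i y v yr vJ; have [w wL Hw] := HR v.
  have := Hw i y yr; rewrite vJ dot0r => H.
  by apply/eqP; rewrite -normr_le0 -(pmulr_rle0 _ mu0).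
Qed.

End InverseFunction.

(** * Calculus of C^1 maps *)

Section CrCalculus.
Variable R : realType.

Lemma near_eq_is_diff (V W : normedModType R) (f g : V -> W) (x : V) :
  (\forall y \near x, f y = g y) -> differentiable f x -> is_diff x g ('d f x).
Proof.
move=> fg df; apply: is_diff_forP; first exact: diff_continuous.
have gx : f x = g x by exact: nbhs_singleton fg.
move=> e e0; have [d d0 Hd] := differentiable_forP df e0.
have /nbhs_ballP[d' /= d'0 Hd'] := fg.
exists (Order.min d d'); first by rewrite lt_min d0.
move=> h; rewrite lt_min => /andP[hd hd']; rewrite -gx -Hd'; first exact: Hd.
by rewrite -ball_normE/= opprD addrA subrr sub0r normrN.
Qed.

Lemma open_eq_near (T : topologicalType) (W : Type) (O : set T) (f g : T -> W) x :
  open O -> (forall y, O y -> f y = g y) -> O x -> \forall y \near x, f y = g y.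
Proof. by move=> oO fg Ox; apply: filterS fg _; exact: open_nbhs_nbhs. Qed.

Lemma eq_diff (V W : normedModType R) (O : set V) (f g : V -> W) x : open O ->
  (forall y, O y -> f y = g y) -> O x -> differentiable f x ->
  is_diff x g ('d f x).
Proof. by move=> oO fg Ox; apply: near_eq_is_diff; exact: open_eq_near Ox. Qed.

Lemma Cr_on_sub (V W : normedModType R) r (O O' : set V) (f : V -> W) :
  O' `<=` O -> Cr_on r O f -> Cr_on r O' f.
Proof.
move=> sub; elim: r f => [|r IH] f /=; first by move=> H x /sub; exact: H.
by move=> [H1 H2]; split=> [x /sub|v]; [exact: H1|apply: IH].
Qed.

Lemma Cr_on_ext (V W : normedModType R) r (O : set V) (f g : V -> W) : open O ->
  (forall y, O y -> f y = g y) -> Cr_on r O f -> Cr_on r O g.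
Proof.
move=> oO; elim: r f g => [|r IH] f g fg /=.
  move=> H x Ox; have := H x Ox; rewrite /prop_for /continuous_at -(fg x Ox).
  by apply: cvg_trans; apply: near_eq_cvg; apply: open_eq_near Ox => // y /fg ->.
move=> [H1 H2]; split=> [x Ox|v].
  by have [] := eq_diff oO fg Ox (H1 x Ox).
apply: IH (H2 v) => x Ox.
by have [_ ->] := eq_diff oO fg Ox (H1 x Ox).
Qed.

Lemma Cr_on_linear (V W W' : normedModType R) r (O : set V) (f : V -> W)
    (L : {linear W -> W'}) : continuous L -> open O ->
  Cr_on r O f -> Cr_on r O (L \o f).
Proof.
move=> cL oO; elim: r f => [|r IH] f /=.
  by move=> H x Ox; apply: continuous_comp; [exact: H|exact: cL].
move=> [H1 H2].
have dL y : differentiable L y by exact: linear_differentiable.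
have D x : O x -> differentiable (L \o f) x.
  by move=> Ox; apply: differentiable_comp; [exact: H1|exact: dL].
split=> // v; apply: Cr_on_ext oO _ (IH _ (H2 v)) => x Ox /=.
have E y : ('d L y : W -> W') = L by exact: diff_lin.
by rewrite (diff_comp (H1 x Ox) (dL (f x)))/= E.
Qed.

(** Values in [R^o] make the coordinate a linear map between normed modules, to which the
    differential calculus applies. *)
Definition coordl n (j : 'I_n) (u : 'rV[R]_n) : R^o := u 0 j.

Lemma coordl_linear n (j : 'I_n) : linear (@coordl n j).
Proof. by move=> a u v; rewrite /coordl !mxE. Qed.

HB.instance Definition _ n (j : 'I_n) :=
  GRing.isLinear.Build R 'rV[R]_n R^o _ (@coordl n j) (@coordl_linear n j).

Lemma coordl_continuous n (j : 'I_n) : continuous (@coordl n j).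
Proof. exact: coord_continuous. Qed.

Lemma diff_coord n (V : normedModType R) (f : V -> 'rV[R]_n) x j :
  differentiable f x -> is_diff x (@coordl n j \o f) (@coordl n j \o 'd f x).
Proof.
move=> df; have dL y : differentiable (@coordl n j) y.
  exact/linear_differentiable/coordl_continuous.
have E : ('d (@coordl n j) (f x) : 'rV[R]_n -> R^o) = @coordl n j.
  by apply: diff_lin; exact: coordl_continuous.
by apply: DiffDef; [exact: differentiable_comp|rewrite diff_comp// E].
Qed.

Lemma is_diff_rV n (V : normedModType R) (f : V -> 'rV[R]_n) x (df : {linear V -> 'rV[R]_n}) :
  (forall j, is_diff x (@coordl n j \o f) (@coordl n j \o df)) -> is_diff x f df.
Proof.
move=> H; apply: is_diff_forP.
  have : continuous (df : V -> 'rV[R]_n).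
    apply: continuous_rV => j.
    have [D E] := H j; have := @diff_continuous _ _ _ _ _ D; rewrite E.
    by [].
  by [].
move=> e e0.
have [d d0 Hd] : exists2 d : R, 0 < d & forall j h, `|h| < d ->
    `|(f (x + h) - f x - df h) 0 j| <= e * `|h|.
  apply: (fin_min (P := fun j d => forall h, `|h| < d ->
    `|(f (x + h) - f x - df h) 0 j| <= e * `|h|)).
    by move=> j d d' d'd K h hd; apply: K; exact: lt_le_trans d'd.
  move=> j; have [D E] := H j; have [d d0 Hd] := differentiable_forP D e0.
  by exists d => // h hd; have := Hd h hd; rewrite E /= /coordl !mx_subE.
exists d => // h hd; apply: mx_norm_le => [|i j]; first by rewrite mulr_ge0// ltW.
by rewrite (ord1 i); exact: Hd.
Qed.

Lemma Cr_on_cst (V W : normedModType R) (O : set V) (a : W) r : Cr_on r O (cst a).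
Proof.
elim: r a => [|r IH] a /=; first by move=> x _; exact: cst_continuous.
split=> [x _|v]; first exact: differentiable_cst.
have -> : (fun x => 'd (cst a) x v) = (cst 0 : V -> W).
  by apply/funext => x; rewrite diff_cst.
exact: IH.
Qed.

Lemma Cr1D (V W : normedModType R) (O : set V) (f g : V -> W) : open O ->
  Cr_on 1 O f -> Cr_on 1 O g -> Cr_on 1 O (f + g).
Proof.
move=> oO [f1 f2] [g1 g2]; split=> [x Ox|v].
  by apply: differentiableD; [exact: f1|exact: g1].
apply: (@Cr_on_ext _ _ 0 _ (fun x => 'd f x v + 'd g x v)) => // x Ox.
  by rewrite diffD//; [exact: f1|exact: g1].
by apply: continuousD; [exact: f2|exact: g2].
Qed.

Lemma Cr1_sum (V W : normedModType R) (O : set V) (I : finType) (f : I -> V -> W) :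
  open O -> (forall i, Cr_on 1 O (f i)) -> Cr_on 1 O (\sum_i f i).
Proof.
move=> oO H; apply: (big_ind (fun g : V -> W => Cr_on 1 O g)).
- exact: (@Cr_on_cst V W O 0 1).
- by move=> g h Cg Ch; exact: Cr1D.
- by move=> i _; exact: H.
Qed.

Lemma Cr1M (V : normedModType R) (O : set V) (f g : V -> R^o) : open O ->
  Cr_on 1 O f -> Cr_on 1 O g -> Cr_on 1 O ((fun x => f x * g x) : V -> R^o).
Proof.
move=> oO [f1 f2] [g1 g2]; split=> [x Ox|v].
  by apply: (@differentiableM _ _ f g); [exact: f1|exact: g1].
apply: (@Cr_on_ext _ _ 0 _ (fun x => f x * 'd g x v + g x * 'd f x v : R^o)) => //.
  move=> x Ox; exact: (esym (congr1 (fun h : V -> R => h v)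
    (@diffM _ _ f g x (f1 x Ox) (g1 x Ox)))).
move=> x Ox; have cf : {for x, continuous f} by apply: differentiable_continuous; exact: f1.
have cg : {for x, continuous g} by apply: differentiable_continuous; exact: g1.
by apply: continuousD; apply: continuousM => //; [exact: g2|exact: f2].
Qed.

(** [Cr_on] gives continuity of ['d f] in fixed directions only, so the moving direction ['d h x v]
    is expanded in the standard basis. *)
Lemma Cr1_comp n (V W : normedModType R) (O : set V) (Q : set 'rV[R]_n)
    (h : V -> 'rV[R]_n) (f : 'rV[R]_n -> W) : open O ->
  (forall x, O x -> Q (h x)) -> Cr_on 1 O h -> Cr_on 1 Q f -> Cr_on 1 O (f \o h).
Proof.
move=> oO OQ [h1 h2] [f1 f2]; split=> [x Ox|v].
  by apply: differentiable_comp; [exact: h1|exact/f1/OQ].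
apply: (@Cr_on_ext _ _ 0 _ (\sum_m (fun x => @coordl n m ('d h x v) *: 'd f (h x) (delta_mx 0 m)))) => //.
  move=> x Ox; rewrite (diff_comp (h1 x Ox) (f1 _ (OQ x Ox))) fct_sumE.
  exact: esym (linear_delta ('d f (h x)) ('d h x v)).
move=> x Ox; have ch : {for x, continuous h} by apply: differentiable_continuous; exact: h1.
apply: (big_ind (fun g : V -> W => {for x, continuous g})).
- exact: cst_continuous.
- by move=> g k cg ck; exact: continuousD.
move=> m _; apply: continuousZ.
  by apply: continuous_comp; [exact: h2|exact: coordl_continuous].
exact: (continuous_comp ch (f2 (delta_mx 0 m) (h x) (OQ x Ox))).
Qed.

Lemma second_difference n (O : set 'rV[R]_n) (f : 'rV[R]_n -> R^o) y u v :
  Cr_on 2 O f ->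
  (forall s t : R, 0 <= s <= 1 -> 0 <= t <= 1 -> O (y + s *: u + t *: v)) ->
  exists s t : R, [/\ 0 <= s <= 1, 0 <= t <= 1 &
    f (y + u + v) - f (y + u) - (f (y + v) - f y) =
    'd ((fun z => 'd f z u) : _ -> R^o) (y + s *: u + t *: v) v].
Proof.
move=> [f1 f2] HO.
have line (w z : 'rV[R]_n) (g : 'rV[R]_n -> R^o) (t : R) : differentiable g (z + t *: w) ->
    is_derive t 1 (fun t : R => g (z + t *: w)) ('d g (z + t *: w) w).
  move=> dg; apply: (is_derive_line (f := g)).
  by apply: DeriveDef; [exact: diff_derivable|rewrite deriveE].
have in0 : 0 <= (0 : R) <= 1 by rewrite lexx ler01.
have in1 : 0 <= (1 : R) <= 1 by rewrite lexx ler01.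
have [|s s01] := @mvt01 R (fun s : R => f (y + v + s *: u) - f (y + s *: u))
   (fun s : R => 'd f (y + v + s *: u) u - 'd f (y + s *: u) u).
- move=> s s01; apply: is_deriveB; apply: line; apply: f1.
    by have := HO s 1 s01 in1; rewrite scale1r addrAC.
  by have := HO s 0 s01 in0; rewrite scale0r addr0.
rewrite scale1r scale0r !addr0 => E1.
have [|t t01] := @mvt01 R (fun t : R => 'd f (y + s *: u + t *: v) u)
   (fun t : R => 'd ((fun z => 'd f z u) : _ -> R^o) (y + s *: u + t *: v) v).
- move=> t t01; apply: (line v (y + s *: u) (fun z => 'd f z u : R^o)).
  by have [H _] := f2 u; apply: H; exact: HO.
rewrite scale1r scale0r addr0 => E2; exists s, t; split=> //.
apply: etrans E2; rewrite (addrAC y u v); apply: (etrans E1).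
exact: (congr1 (fun z => 'd f z u - 'd f (y + s *: u) u) (addrAC y v (s *: u))).
Qed.

(** Both mixed derivatives, taken at suitable points close to [y], equal one and the same second
    difference, which is symmetric in [u] and [v]. *)
Lemma schwarz n (O : set 'rV[R]_n) (f : 'rV[R]_n -> R^o) y u v : open O -> O y ->
  Cr_on 2 O f ->
  'd ((fun z => 'd f z u) : _ -> R^o) y v = 'd ((fun z => 'd f z v) : _ -> R^o) y u.
Proof.
move=> oO Oy C2; have [D HD] : exists D : _ -> _ -> _ -> R, forall a b,
    D a b = fun z => 'd ((fun z => 'd f z a) : 'rV[R]_n -> R^o) z b.
  by exists (fun a b z => 'd ((fun z => 'd f z a) : 'rV[R]_n -> R^o) z b).
have cD a b : {for y, continuous (D a b)}.
  by rewrite HD; have [_ /(_ a)[_ /(_ b)]] := C2; apply.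
have {}HD a b z : D a b z = 'd ((fun z => 'd f z a) : 'rV[R]_n -> R^o) z b.
  exact: (congr1 (fun h => h z) (HD a b)).
apply: etrans (esym (HD u v y)) (etrans _ (HD v u y)).
apply/eqP; rewrite -subr_eq0 -normr_le0; apply/ler_addgt0Pl => e e0; rewrite addr0.
have e20 : 0 < e / 2 by rewrite divr_gt0.
have [d0 d00 Hd0] := (open_forP O).1 oO y Oy.
have [d1 d10 Hd1] := (continuous_forP _ _).1 (cD u v) _ e20.
have [d2 d20 Hd2] := (continuous_forP _ _).1 (cD v u) _ e20.
pose d := Order.min d0 (Order.min d1 d2).
have dgt0 : 0 < d by rewrite !lt_min d00 d10.
have den : 0 < `|u| + `|v| + 1 by rewrite ltr_wpDl// addr_ge0.
(* Scaling [u] and [v] by [h] keeps the whole parallelogram within [d] of [y]; the common factor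
   [h * h] cancels afterwards. *)
have [h h0 hE] : exists2 h : R, 0 < h & h * (`|u| + `|v| + 1) = d.
  by exists (d / (`|u| + `|v| + 1)); [rewrite divr_gt0|rewrite divfK// gt_eqF].
have close (s t : R) a b : 0 <= s <= 1 -> 0 <= t <= 1 ->
    `|a| + `|b| <= `|u| + `|v| -> `|y - (y + s *: (h *: a) + t *: (h *: b))| < d.
  move=> /andP[s0 s1] /andP[t0 t1] ab.
  rewrite -addrA opprD addrA subrr sub0r normrN (le_lt_trans (ler_normD _ _))//.
  rewrite !normrZ !(ger0_norm s0, ger0_norm t0, gtr0_norm h0).
  apply: (@le_lt_trans _ _ (h * (`|a| + `|b|))).
    by rewrite mulrDr lerD// ler_piMl// mulr_ge0// ltW.
  rewrite -hE ltr_pM2l//; lra.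
have Dle0 : d <= d0 by rewrite ge_min lexx.
have Dle1 : d <= d1 by rewrite !ge_min lexx orbT.
have Dle2 : d <= d2 by rewrite !ge_min lexx !orbT.
have inO a b : `|a| + `|b| <= `|u| + `|v| -> forall s t : R, 0 <= s <= 1 -> 0 <= t <= 1 ->
    O (y + s *: (h *: a) + t *: (h *: b)).
  move=> ab s t s01 t01; apply: Hd0; apply: lt_le_trans Dle0; exact: close.
have hom a b z : O z ->
    'd ((fun z => 'd f z (h *: a)) : 'rV[R]_n -> R^o) z (h *: b) = h * h * D a b z.
  move=> Oz; have E : (fun z => 'd f z (h *: a)) = (fun z => h *: 'd f z a).
    by apply/funext => w; exact: linearZ.
  rewrite E; have [_ /(_ a)[/(_ z Oz) dz _]] := C2.
  have -> : (fun z => h *: 'd f z a) = h \*: (fun z => 'd f z a : R^o) by [].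
  apply: etrans (congr1 (fun g : _ -> R => g (h *: b)) (diffZ h dz)) _.
  by rewrite /= linearZ /GRing.scale/= mulrA HD.
have [s [t [s01 t01]]] := second_difference C2 (inO u v (lexx _)).
have vu : `|v| + `|u| <= `|u| + `|v| by rewrite addrC.
have [s' [t' [s'01 t'01]]] := second_difference C2 (inO v u vu).
set z1 := _ + t *: _; set z2 := _ + t' *: _.
have Oz1 : O z1 by exact: inO.
have Oz2 : O z2 by exact: inO.
move=> E2 E1; have {}E2 := etrans E2 (hom _ _ _ Oz2); have {}E1 := etrans E1 (hom _ _ _ Oz1).
have hh : h * h != 0 by rewrite mulf_neq0// gt_eqF.
have E : D u v z1 = D v u z2.
  apply: (mulfI hh); apply: etrans (esym E1) (etrans _ E2).
  rewrite (addrAC y (h *: u)).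
  by move: (f _) (f _) (f _) (f _) => a1 a2 a3 a4; rewrite !opprB addrACA [RHS]addrACA (addrC (- a2)).
rewrite (_ : D u v y - D v u y = (D u v y - D u v z1) + (D v u z2 - D v u y)); last first.
  by rewrite E; ring.
rewrite (splitr e) (le_trans (ler_normD _ _))// lerD ?ltW//.
  by apply: Hd1; apply: lt_le_trans Dle1; exact: close.
by rewrite distrC; apply: Hd2; apply: lt_le_trans Dle2; exact: close.
Qed.

Lemma is_diff_bigsum (V W : normedModType R) (I : finType) (f df : I -> V -> W) x :
  (forall i, is_diff x (f i) (df i)) -> is_diff x (\sum_i f i) (\sum_i df i).
Proof.
move=> H; apply: (big_ind2 (fun g dg : V -> W => is_diff x g dg)).
- exact: (@is_diff_cst _ _ _ 0 x).
- by move=> g1 d1 g2 d2 H1 H2; exact: is_diffD.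
- by move=> i _; exact: H.
Qed.

Lemma schwarz_rV n p (O : set 'rV[R]_n) (f : 'rV[R]_n -> 'rV[R]_p) y u v :
  open O -> O y -> Cr_on 2 O f ->
  'd (fun z => 'd f z u) y v = 'd (fun z => 'd f z v) y u.
Proof.
move=> oO Oy C2; apply/rowP => j.
have Cj : Cr_on 2 O (coordl j \o f).
  by apply: Cr_on_linear => //; exact: coordl_continuous.
have [f1 f2] := C2.
have E a b : 'd ((fun z => 'd (coordl j \o f) z a) : _ -> R^o) y b = ('d (fun z => 'd f z a) y b) 0 j.
  have [D _] := f2 a.
  have [Dj Ej] := diff_coord j (D y Oy).
  have Eq z : O z -> (coordl j \o (fun z => 'd f z a)) z = 'd (coordl j \o f) z a.
    by move=> Oz; have [_ ->] := diff_coord j (f1 z Oz).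
  have [_ K] := eq_diff oO Eq Oy Dj.
  exact: (congr1 (fun h : _ -> R => h b) (etrans K Ej)).
exact: etrans (esym (E u v)) (etrans (schwarz u v oO Oy Cj) (E v u)).
Qed.

End CrCalculus.

(** * Differential forms in charts *)

Section ChartCalculus.
Variables (R : realType) (n : nat) (N : smoothManifold R n).
Local Notation V := 'rV[R]_n.
Implicit Types (c : chart R n N) (w : oneform N) (W : set N).

Lemma chartK c x : cdom c x -> cinv c (cmap c x) = x.
Proof. by move=> cx; apply: (@cmapK _ _ _ c); rewrite inE. Qed.

Lemma cmap_cont c x : cdom c x -> {for x, continuous (cmap c)}.
Proof.
move=> cx; have := @cmap_continuous _ _ _ c.
by rewrite (continuous_open_subspace _ (cdom_open c)) => /(_ x); apply; rewrite inE.
Qed.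

Lemma cinv_cont c x : cdom c x -> {for cmap c x, continuous (cinv c)}.
Proof.
move=> cx; have := @cinv_continuous _ _ _ c.
rewrite (continuous_open_subspace _ (@cimg_open _ _ _ c)) => /(_ (cmap c x)); apply.
by rewrite inE; exists x.
Qed.

Lemma chart_img_open c W : open W -> open (cmap c @` (W `&` cdom c)).
Proof.
move=> oW; rewrite openE => _ [x [Wx cx] <-].
have oI : nbhs (cmap c x) (cmap c @` cdom c).
  by apply: open_nbhs_nbhs; split; [exact: (@cimg_open _ _ _ c)|exists x].
have : nbhs (cmap c x) (cinv c @^-1` W).
  by apply: cinv_cont => //; rewrite chartK//; exact: open_nbhs_nbhs.
apply: filter_app; apply: filterS oI => y [z cz <-]; rewrite /preimage/= chartK// => Wz.
by exists z.
Qed.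

Lemma chart_preimg_open c (Q : set V) : open Q -> open (cdom c `&` cmap c @^-1` Q).
Proof.
move=> oQ; rewrite openE => x [cx Qx].
have oI : nbhs x (cdom c) by apply: open_nbhs_nbhs; split=> //; exact: cdom_open.
have : nbhs x (cmap c @^-1` Q) by apply: cmap_cont => //; exact: open_nbhs_nbhs.
by move=> K; apply: filterI.
Qed.

Lemma transition_smooth c c' : atlas c -> atlas c' ->
  smooth_on (cmap c @` (cdom c' `&` cdom c)) (cmap c' \o cinv c).
Proof. by rewrite setIC; exact: atlas_compatible. Qed.

Lemma transition_diff c c' x : atlas c -> atlas c' -> cdom c x -> cdom c' x ->
  differentiable (cmap c' \o cinv c) (cmap c x).
Proof.
move=> ac ac' cx c'x; have [+ _] := transition_smooth ac ac' 1.
by apply; exists x.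
Qed.

Lemma transition_cancel c c' x v : atlas c -> atlas c' -> cdom c x -> cdom c' x ->
  'd (cmap c \o cinv c') (cmap c' x) ('d (cmap c' \o cinv c) (cmap c x) v) = v.
Proof.
move=> ac ac' cx c'x.
have D1 := transition_diff ac ac' cx c'x.
have E0 : (cmap c' \o cinv c) (cmap c x) = cmap c' x by rewrite /= chartK.
have D2 : differentiable (cmap c \o cinv c') ((cmap c' \o cinv c) (cmap c x)).
  by rewrite E0; exact: transition_diff.
have Eid y : (cmap c @` (cdom c' `&` cdom c)) y ->
    ((cmap c \o cinv c') \o (cmap c' \o cinv c)) y = id y.
  by move=> [z [c'z cz] <-]; rewrite /= !chartK.
have [_ E1] := eq_diff (@chart_img_open c _ (cdom_open c')) Eid
  (ex_intro2 _ _ x (conj c'x cx) erefl) (differentiable_comp D1 D2).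
have [_ E2] := is_diff_id (cmap c x).
have E3 := congr1 (fun h : V -> V => h v) (etrans (esym (diff_comp D1 D2)) (etrans (esym E1) E2)).
apply: etrans E3.
exact: (congr1 (fun q => 'd (cmap c \o cinv c') q ('d (cmap c' \o cinv c) (cmap c x) v)) (esym E0)).
Qed.

(** [pullback] reads tangent vectors in the preferred chart at each point, which varies with the
    point; the chain rule replaces it by a single chart, so that the result can be differentiated in
    [p]. *)
Lemma pullback_chart c m (F : 'rV[R]_m -> N) (O : set 'rV[R]_m) w p v :
  atlas c -> open O -> O p -> (forall q, O q -> cdom c (F q)) ->
  differentiable (cmap c \o F) p ->
  pullback F w p v = pullback (cinv c) w (cmap c (F p)) ('d (cmap c \o F) p v).
Proof.
move=> ac oO Op Oc dF; rewrite /pullback /diff_into chartK; last exact: Oc.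
congr pairing; set c' := chart_at (F p).
have c'p : cdom c' (F p) by exact: chart_at_dom.
have dT : differentiable (cmap c' \o cinv c) ((cmap c \o F) p).
  by apply: transition_diff => //; [exact: chart_at_atlas|exact: Oc].
have Ein q : O q -> ((cmap c' \o cinv c) \o (cmap c \o F)) q = (cmap c' \o F) q.
  by move=> Oq; rewrite /= chartK//; exact: Oc.
have [_ E] := eq_diff oO Ein Op (differentiable_comp dF dT).
exact: (congr1 (fun h : 'rV[R]_m -> V => h v) (etrans E (diff_comp dF dT))).
Qed.

(** The tangent space at [x] is realised in [chart_at x]; this is the passage to components in
    [c]. *)
Definition tangent_to c x : V -> V := 'd (cmap c \o cinv (chart_at x)) (cmap (chart_at x) x).

Lemma pairing_chart c w x v : atlas c -> cdom c x ->
  pullback (cinv c) w (cmap c x) (tangent_to c x v) = pairing (w x) v.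
Proof.
move=> ac cx; rewrite /pullback /diff_into chartK// transition_cancel//.
- exact: chart_at_atlas.
- exact: chart_at_dom.
Qed.

Lemma tangent_to_inj c x : atlas c -> cdom c x -> injective (tangent_to c x).
Proof.
move=> ac cx u v /(congr1 ('d (cmap (chart_at x) \o cinv c) (cmap c x))).
have K z := transition_cancel z (chart_at_atlas x) ac (chart_at_dom x) cx.
by move=> E; exact: etrans (esym (K u)) (etrans E (K v)).
Qed.

Lemma pullback_linear m (F : 'rV[R]_m -> N) w p : linear (pullback F w p : 'rV[R]_m -> R^o).
Proof.
move=> a u v; rewrite /pullback /diff_into /pairing linearP mulmxDl -scalemxAl !mxE.
by [].
Qed.

Lemma pullback_delta m (F : 'rV[R]_m -> N) w p v :
  pullback F w p v = \sum_l v 0 l * pullback F w p (delta_mx 0 l).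
Proof.
pose L := HB.pack_for {linear 'rV[R]_m -> R^o} (pullback F w p : 'rV[R]_m -> R^o)
  (GRing.isLinear.Build _ _ _ _ _ (@pullback_linear m F w p)).
exact: (linear_delta L v).
Qed.

(** Invariance of the exterior derivative. With [t] the transition map, the form evaluated on [z] is
    the sum of [coordl m ('d t y z) * a m (t y)]; differentiating produces second derivatives of
    [t], which cancel in the antisymmetrization by Schwarz. *)
Lemma ext_d_chart c w W x u v : atlas c -> open W -> W x -> cdom c x -> form_Cr 1 W w ->
  'd ((fun y => pullback (cinv c) w y v) : V -> R^o) (cmap c x) u -
  'd ((fun y => pullback (cinv c) w y u) : V -> R^o) (cmap c x) v =
  ext_d w x ('d (cmap (chart_at x) \o cinv c) (cmap c x) u)
            ('d (cmap (chart_at x) \o cinv c) (cmap c x) v).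
Proof.
move=> ac oW Wx cx Cw; set c' := chart_at x; have ac' : atlas c' := chart_at_atlas x.
have c'x : cdom c' x := chart_at_dom x.
pose t := cmap c' \o cinv c; set y0 := cmap c x.
have oO := @chart_img_open c _ (openI oW (cdom_open c')).
set O := cmap c @` _ in oO.
have Oy0 : O y0 by exists x.
have Ct r : Cr_on r O t.
  apply: Cr_on_sub (transition_smooth ac ac' r).
  by move=> _ [z [[Wz c'z] cz] <-]; exists z.
have ty0 : t y0 = cmap c' x by rewrite /t /= chartK.
pose a m (q : V) : R^o := pullback (cinv c') w q (delta_mx 0 m).
have Ca m : differentiable (a m) (t y0).
  by rewrite ty0; have [H _] := Cw c' ac' (delta_mx 0 m); apply: H; exists x.
have dt y : O y -> differentiable t y by have [H _] := Ct 1; exact: H.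
have D2 z : differentiable (fun y => 'd t y z) y0.
  by have [_ /(_ z)[H _]] := Ct 2; exact: H.
have Da m b : is_diff (t y0) (a m) ('d (a m) (t y0)) by exact: differentiableP.
pose T := 'd t y0.
pose D z b := \sum_m (coordl m (T z) * 'd (a m) (t y0) (T b) +
       a m (t y0) * coordl m ('d (fun y => 'd t y z) y0 b)).
have loc z b : 'd ((fun y => pullback (cinv c) w y z) : V -> R^o) y0 b = D z b.
  pose g := \sum_m ((coordl m \o (fun y => 'd t y z)) * (a m \o t) : V -> R^o).
  have Dg : is_diff y0 g (\sum_m (coordl m ('d t y0 z) *: ('d (a m) (t y0) \o 'd t y0) +
       a m (t y0) *: (coordl m \o 'd (fun y => 'd t y z) y0)) : V -> R^o).
    apply: is_diff_bigsum => m.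
    apply: (@is_diffM _ _ (coordl m \o (fun y => 'd t y z)) (a m \o t)).
      exact: diff_coord.
    exact: (@is_diff_comp _ _ _ _ t _ (a m) _ y0 (differentiableP (dt y0 Oy0))
      (differentiableP (Ca m))).
  have [Dg1 Dg2] := Dg.
  have Oc' p : O p -> cdom c' (cinv c p) by case=> s [[_ ?] ?] <-; rewrite chartK.
  have Eg y : O y -> g y = pullback (cinv c) w y z.
    move=> Oy; rewrite /g fct_sumE.
    exact: esym (etrans (pullback_chart w z ac' oO Oy Oc' (dt y Oy)) (pullback_delta _ _ _ _)).
  have [_ E] := eq_diff oO Eg Oy0 Dg1.
  apply: etrans (congr1 (fun h : V -> R => h b) (etrans E Dg2)) _.
  by rewrite fct_sumE.
have loc' z b : 'd ((fun y => pullback (cinv c') w y z) : V -> R^o) (cmap c' x) b =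
    \sum_m z 0 m * 'd (a m) (t y0) b.
  have Dg : is_diff (t y0) (\sum_m (z 0 m *: a m) : V -> R^o) (\sum_m (z 0 m *: ('d (a m) (t y0) : V -> R^o))).
    by apply: is_diff_bigsum => m; apply: is_diffZ; exact: differentiableP.
  have -> : (fun y => pullback (cinv c') w y z) = \sum_m (z 0 m *: a m) :> (V -> R^o).
    by apply/funext => y; rewrite fct_sumE; exact: pullback_delta.
  rewrite -ty0; have [_ E] := Dg.
  apply: etrans (congr1 (fun h : V -> R => h b) E) _.
  by rewrite fct_sumE.
apply: etrans (congr2 (fun p q => p - q) (loc v u) (loc u v)) _.
apply: etrans (esym (congr2 (fun p q => p - q) (loc' (T v) (T u)) (loc' (T u) (T v)))).
rewrite /D -!sumrB; apply: eq_bigr => m _.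
have S := congr1 (coordl m) (schwarz_rV u v oO Oy0 (Ct 2)).
have key (x1 d1 x2 d2 b e1 e2 : R) : e1 = e2 ->
    x1 * d1 + b * e1 - (x2 * d2 + b * e2) = x1 * d1 - x2 * d2 by move=> ->; ring.
exact: key (esym S).
Qed.

Lemma Cr_chart (Y : normedModType R) c W (Q : set V) (G : V -> Y) c' :
  atlas c -> atlas c' -> open W -> (forall x, W x -> cdom c x /\ Q (cmap c x)) ->
  Cr_on 1 Q G -> Cr_on 1 (cmap c' @` (W `&` cdom c')) ((G \o cmap c) \o cinv c').
Proof.
move=> ac ac' oW WQ CG; apply: (Cr1_comp (h := cmap c \o cinv c') (Q := Q)) CG.
- exact: chart_img_open.
- by move=> _ [x [Wx c'x] <-]; rewrite /= chartK//; have [] := WQ x Wx.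
- apply: Cr_on_sub (transition_smooth ac' ac 1).
  by move=> _ [x [Wx c'x] <-]; exists x => //; split=> //; have [] := WQ x Wx.
Qed.

Lemma form_Cr1_comb k W (h : 'I_k -> N -> R) (w : 'I_k -> oneform N) : open W ->
  (forall l c, atlas c -> Cr_on 1 (cmap c @` (W `&` cdom c)) ((h l \o cinv c) : V -> R^o)) ->
  (forall l, form_Cr 1 W (w l)) ->
  form_Cr 1 W (fun x => \sum_l h l x *: w l x).
Proof.
move=> oW Ch Cw c ac v.
have -> : (fun y => pullback (cinv c) (fun x => \sum_l h l x *: w l x) y v) =
    \sum_l (fun y => (h l \o cinv c) y * pullback (cinv c) (w l) y v) :> (V -> R^o).
  apply/funext => y; rewrite fct_sumE /pullback /pairing mulmx_sumr summxE.
  by apply: eq_bigr => l _; rewrite -scalemxAr mxE.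
have oO := @chart_img_open c _ oW.
apply: Cr1_sum => // l; apply: Cr1M => //; first exact: Ch.
exact: Cw.
Qed.

Lemma diff_from_chart c m (G : V -> 'rV[R]_m) x v : atlas c -> cdom c x ->
  differentiable G (cmap c x) ->
  diff_from (G \o cmap c) x v = 'd G (cmap c x) (tangent_to c x v).
Proof.
move=> ac cx dG; pose t := cmap c \o cinv (chart_at x).
have E : t (cmap (chart_at x) x) = cmap c x by rewrite /t /= chartK//; exact: chart_at_dom.
have dt : differentiable t (cmap (chart_at x) x).
  by apply: transition_diff => //; [exact: chart_at_atlas|exact: chart_at_dom].
have dG' : differentiable G (t (cmap (chart_at x) x)) by rewrite E.
apply: etrans (congr1 (fun h : V -> _ => h v) (diff_comp dt dG')) _.
exact: (congr1 (fun q => 'd G q (tangent_to c x v)) E).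
Qed.

End ChartCalculus.

Lemma free_comb (F : fieldType) n k (a : 'I_k -> 'cV[F]_n) (H : 'M[F]_k) :
  H \in unitmx -> free [tuple a i | i < k] ->
  free [tuple \sum_l H i l *: a l | i < k].
Proof.
move=> uH /freeP fa; apply/freeP => c.
have E (b : 'I_k -> 'cV[F]_n) (i : 'I_k) : [tuple b i | i < k]`_i = b i by rewrite -tnth_nth tnth_mktuple.
under eq_bigr do rewrite E scaler_sumr.
rewrite exchange_big/= => H0.
have : \row_i c i *m H = 0.
  apply/rowP => l; rewrite [RHS]mxE; have := fa (fun l => (\row_i c i *m H) 0 l).
  apply; rewrite -[RHS]H0; apply: eq_bigr => l' _; rewrite E mxE scaler_suml.
  by apply: eq_bigr => i _; rewrite mxE scalerA.
move=> /(congr1 (mulmx^~ (invmx H))); rewrite mulmxK// mul0mx => cE i.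
by have := congr1 (fun r : 'rV_k => r 0 i) cE; rewrite !mxE.
Qed.

(** * Polytopes around a point *)

Section Mesh.
Variables (R : realType) (n : nat) (N : smoothManifold R n).

(* If F is differentiable at p with injective differential L and the image of F contained
   a neighbourhood of F p, then a vector u orthogonal to the range of L would be attained:
   F q = F p + t u with q - p = O(t), so that t <u, u> = o(t). *)
Lemma embedding_no_interior m (f : 'rV[R]_m -> N) (O : set N) : (m < n)%N ->
  smooth_embedding f -> open O -> O !=set0 -> ~ (O `<=` f @` setT).
Proof.
move=> mn [[cf sf] [_ injf embf] injd] oO [x Ox] sub.
have [p _ fp] := sub x Ox.
pose c := chart_at x; have cx : cdom c x := chart_at_dom x.
pose F := cmap c \o f; pose L := 'd F p.
have dF : differentiable F p.
  have [H _] := sf c (chart_at_atlas x) 1; apply: H.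
  by rewrite /preimage/= fp.
have injL : injective L by have := injd p; rewrite /diff_into fp.
pose A : 'M[R]_(m, n) := lin1_mx L.
have LA v : L v = v *m A by rewrite mul_rV_lin1.
have freeA : row_free A.
  rewrite -kermx_eq0; apply: contraT => /rowV0Pn[v /sub_kermxP vA].
  by move=> v0; case/eqP: v0; apply: injL; rewrite LA vA linear0.
(* Injectivity of [L] in quantitative form, [|v| <= K |L v|], obtained from a one-sided inverse of
   its matrix. *)
pose K := m%:R * `|pinvmx A| + n%:R * `|pinvmx A| + 1.
have K0 : 0 < K by rewrite ltr_wpDl// addr_ge0// mulr_ge0.
have LK v : `|v| <= K * `|L v|.
  have {1}-> : v = L v *m pinvmx A by rewrite LA mulmxKp.
  apply: le_trans (mx_norm_mul _ _) _; rewrite mulrAC ler_wpM2r//.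
  by rewrite /K -addrA addrCA lerDl addr_ge0// mulr_ge0.
have [u u0 uL] : exists2 u : 'rV[R]_n, u != 0 & forall v, dot u (L v) = 0.
  have : kermx A^T != 0.
    rewrite kermx_eq0 /row_free mxrank_tr.
    by apply: contraL mn => /eqP <-; rewrite -leqNgt rank_leq_row.
  move=> /rowV0Pn[u /sub_kermxP uA u0]; exists u => // v.
  have -> : dot u (L v) = (u *m A^T *m v^T) 0 0.
    rewrite -mulmxA -trmx_mul -LA mxE; apply: eq_bigr => i _; by rewrite mxE.
  by rewrite uA mul0mx mxE.
have uu : 0 < dot u u.
  rewrite lt_def dot_ge0 andbT; apply: contra_neq u0; exact: dot_eq0.
have nu : 0 < `|u| by rewrite normr_gt0.
pose b := 2 * K * (n%:R * `|u| * `|u| + 1).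
have b0 : 0 < b by rewrite !mulr_gt0// ltr_wpDl// !mulr_ge0.
(* The first term absorbs [e |h|] and gives [|h| <= 2 K t |u|]; with that, the second makes the
   error [n |u| e |h|] smaller than [t * dot u u]. *)
pose e := Order.min (2 * K)^-1 (dot u u / (2 * b)).
have e0 : 0 < e by rewrite lt_min invr_gt0 !divr_gt0 ?mulr_gt0.
have [d d0 Hd] := differentiable_forP dF e0.
have oB : open [set q : 'rV[R]_m | `|p - q| < d].
  have -> : [set q : 'rV[R]_m | `|p - q| < d] = ball p d.
    by rewrite -ball_normE.
  exact: ball_open.
have [Q oQ fQ] := embf _ oB.
have Qx : Q x.
  have : (f @` (setT `&` [set q | `|p - q| < d])) x.
    by exists p => //; split=> //=; rewrite subrr normr0.
  by rewrite fQ => -[].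
have oI := @chart_img_open _ _ _ c _ (openI oO oQ).
have [t0 t00 Ht0] := (open_forP _).1 oI (cmap c x) (ex_intro2 _ _ x (conj (conj Ox Qx) cx) erefl).
pose t := t0 / (`|u| + 1).
have t_gt0 : 0 < t by rewrite divr_gt0// ltr_wpDl.
have [|z [[Oz Qz] cz] zE] := Ht0 (cmap c x + t *: u).
  rewrite opprD addrA subrr sub0r normrN normrZ gtr0_norm// /t mulrAC ltr_pdivrMr ?ltr_wpDl//.
  by rewrite ltr_pM2l// ltrDl.
have : (f @` (setT `&` [set q | `|p - q| < d])) z by rewrite fQ; split=> //; exact: sub.
move=> [q [_ pq] qz].
pose h := q - p.
have hd : `|h| < d by rewrite distrC.
have Fq : F (p + h) = F p + t *: u.
  by rewrite /F/= addrC subrK qz zE fp.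
have := Hd h hd; rewrite Fq [F p + _]addrC addrK -/L => H.
have eK : K * e <= 1 / 2.
  have : e <= (2 * K)^-1 by rewrite ge_min lexx.
  move=> /(ler_wpM2l (ltW K0)); rewrite invfM mulrCA divff ?gt_eqF// mulr1 => /le_trans; apply.
  by rewrite div1r.
have hb : `|h| <= 2 * K * t * `|u|.
  have : `|L h| <= t * `|u| + e * `|h|.
    rewrite -(subKr (t *: u) (L h)) (le_trans (ler_normB _ _))// normrZ gtr0_norm// lerD2l//.
  move=> /(ler_wpM2l (ltW K0)); have := LK h; have : 0 <= `|h| by [].
  move: (`|h|) (`|L h|) eK => a1 a2 eK *; nra.
have : t * dot u u <= n%:R * `|u| * (e * `|h|).
  rewrite -dotZr -[t *: u](subrK (L h)) dotDr uL addr0.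
  apply: le_trans (ler_norm _) _; apply: le_trans (dot_le _ _) _.
  by rewrite ler_wpM2l// mulr_ge0.
apply/negP; rewrite -ltNge.
have e_b : e * (2 * b) <= dot u u by rewrite -ler_pdivlMr ?mulr_gt0// ge_min lexx orbT.
apply: (@le_lt_trans _ _ (n%:R * `|u| * (e * (2 * K * t * `|u|)))).
  by rewrite ler_wpM2l ?mulr_ge0// ler_wpM2l// ltW.
apply: (@le_lt_trans _ _ (t * (e * b))).
  have -> : t * (e * b) = n%:R * `|u| * (e * (2 * K * t * `|u|)) + t * e * (2 * K) by rewrite /b; ring.
  by rewrite lerDl !mulr_ge0// ltW.
by rewrite ltr_pM2l//; apply: lt_le_trans e_b; have := mulr_gt0 e0 b0; lra.
Qed.

Lemma polytope_compact m (P : set 'rV[R]_m) : convex_polytope P -> compact P.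
Proof.
move=> [_ bP [q [a [b PE]]]]; apply: bounded_closed_compact => //.
have -> : P = \bigcap_(i in setT) [set p | pairing (a i) p <= b i].
  by rewrite PE; apply/seteqP; split => p /= H i; move: (H i) => // /(_ I).
apply: closed_bigI => i _.
apply: (@closed_comp _ _ (fun p : 'rV[R]_m => pairing (a i) p) [set x | x <= b i]).
  move=> p _; have -> : (fun p : 'rV[R]_m => pairing (a i) p) = fun p => \sum_j p 0 j * a i j 0.
    by apply/funext => r; rewrite /pairing mxE.
  apply: continuous_bigsum => j r; apply: continuousM; first exact: coord_continuous.
  exact: cst_continuous.
exact: closed_le.
Qed.

Lemma polytope_convex m (P : set 'rV[R]_m) p q (t : R) : convex_polytope P -> P p -> P q ->
  0 <= t <= 1 -> P (p + t *: (q - p)).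
Proof.
move=> [_ _ [s [a [b ->]]]] /= Pp Pq /andP[t0 t1] i.
have E (x y : 'rV[R]_m) (k : R) : pairing (a i) (x + k *: y) = pairing (a i) x + k * pairing (a i) y.
  by rewrite /pairing mulmxDl -scalemxAl !mxE.
rewrite E -[q - p]addrC -scaleN1r addrC E mulN1r.
have := Pp i; have := Pq i; nra.
Qed.

Variables (M : set N) (T : mesh M).

Lemma poly_closed D : polys T D -> closed D.
Proof.
move=> PD; rewrite (mesh_image PD); apply: compact_closed; first exact: carrier_hausdorff.
apply: continuous_compact; last exact: polytope_compact (cmodel_polytope _).
have [[cf _] _ _] := cparam_embedding (mcell T D).
exact: continuous_subspaceT.
Qed.

(** Finitely many closed sets with empty interior are removed one at a time, each leaving a nonempty
    open set. *)
Lemma open_minus_thin (O : set N) (s : seq (set N)) : open O -> O !=set0 ->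
  (forall D, D \in s -> polys T D /\ (cdim (mcell T D) < n)%N) ->
  exists2 x, O x & forall D, D \in s -> ~ D x.
Proof.
elim: s O => [|D s IH] O oO O0 Hs; first by case: O0 => x Ox; exists x.
have [PD dD] : polys T D /\ (cdim (mcell T D) < n)%N by apply: Hs; rewrite inE eqxx.
have [|||x [Ox nDx] Hx] := IH (O `\` D).
- by rewrite setDE; apply: openI => //; apply: closed_openC; exact: poly_closed.
- apply: contrapT => /set0P/negP/negPn/eqP; rewrite setD_eq0 => OD.
  apply: (embedding_no_interior dD (cparam_embedding (mcell T D)) oO O0).
  apply: subset_trans OD _; rewrite {1}(mesh_image PD).
  by move=> _ [p _ <-]; exists p.
- by move=> D' D's; apply: Hs; rewrite inE D's orbT.
by exists x => // D'; rewrite inE => /orP[/eqP ->|/Hx].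
Qed.

(** Local finiteness and closedness allow [W] to avoid every polytope that misses [x0]. Were a point
    of [W] outside all top-dimensional polytopes at [x0], some neighbourhood of it would be covered
    by finitely many polytopes of lower dimension, against [open_minus_thin]. *)
Lemma top_at_nbhs (x0 : N) : M° x0 -> finite_set (top_at T x0) /\
  exists W, [/\ open W, W x0, W `<=` M,
    forall D x, polys T D -> W x -> D x -> D x0 &
    forall x, W x -> exists2 P, top_at T x0 P & P x].
Proof.
move=> Mx0; have Mx0' : M x0 := interior_subset Mx0.
have [W1 [oW1 W1x0 fin]] := mesh_locally_finite T Mx0'.
have ftop : finite_set (top_at T x0).
  apply: sub_finite_set fin => P [[PP _] Px0]; split=> //; by exists x0.
split=> //; have [s sE] := (finite_seqP _).1 fin.
pose away := [seq D <- s | `[< ~ D x0 >]].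
have oaway (l : seq (set N)) : (forall D, D \in l -> polys T D) ->
    open [set x | forall D, D \in l -> ~ D x].
  elim: l => [|D l IH] Hl.
    by have -> : [set x | forall D, D \in [::] -> ~ D x] = setT :> set N;
      [apply/seteqP; split|exact: openT].
  have -> : [set x | forall D', D' \in D :: l -> ~ D' x] = ~` D `&` [set x | forall D', D' \in l -> ~ D' x].
    apply/seteqP; split=> x /=.
      move=> H; split; first by apply: H; rewrite inE eqxx.
      by move=> D' D'l; apply: H; rewrite inE D'l orbT.
    by move=> [nD H] D'; rewrite inE => /orP[/eqP ->|/H].
  apply: openI.
    by apply: closed_openC; apply: poly_closed; apply: Hl; rewrite inE eqxx.
  by apply: IH => D' D'l; apply: Hl; rewrite inE D'l orbT.
have sP D : D \in s -> polys T D.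
  by move=> Ds; have : [set` s] D by []; rewrite -sE => -[].
pose W := (W1 `&` M°) `&` [set x | forall D, D \in away -> ~ D x].
have oW : open W.
  apply: openI; first by apply: openI => //; exact: open_interior.
  by apply: oaway => D; rewrite mem_filter => /andP[_ /sP].
have Wthrough D x : polys T D -> W x -> D x -> D x0.
  move=> PD [[W1x _] aw] Dx; apply: contrapT => nD; apply: (aw D) => //.
  rewrite mem_filter; apply/andP; split; first exact/asboolP.
  by have : [set` s] D by rewrite -sE; split=> //; exists x.
exists W; split=> //.
- split; first by split.
  by move=> D; rewrite mem_filter => /andP[/asboolP].
- by move=> x [[_ /interior_subset]].
move=> x Wx; apply: contrapT => noP.
pose tops := [seq D <- s | `[< top_at T x0 D >]].
pose low := [seq D <- s | (cdim (mcell T D) < n)%N].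
have oW3 : open (W `&` [set y | forall D, D \in tops -> ~ D y]).
  by apply: openI => //; apply: oaway => D; rewrite mem_filter => /andP[_ /sP].
have [||y [Wy nty] nly] := open_minus_thin (s := low) oW3.
- exists x; split=> // D; rewrite mem_filter => /andP[/asboolP tD _] Dx.
  by apply: noP; exists D.
- by move=> D; rewrite mem_filter => /andP[? /sP].
have [D PD Dy] : (\bigcup_(D in polys T) D) y.
  by rewrite mesh_cover; case: Wy => [[_ /interior_subset]].
have Ds : D \in s.
  by have : [set` s] D by rewrite -sE; split=> //; exists y; split=> //; case: Wy => -[].
have Dx0 := Wthrough D y PD Wy Dy.
have := mesh_dim PD; rewrite leq_eqVlt => /orP[/eqP dn|dn].
  by apply: (nty D) => //; rewrite mem_filter Ds andbT; apply/asboolP; split.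
by apply: (nly D) => //; rewrite mem_filter dn.
Qed.

End Mesh.

(** * Frames of flat connection forms *)

Lemma diff_shift (R : realType) (V W : normedModType R) (f : V -> W) (a z : V) :
  differentiable f (a + z) -> is_diff z (fun z => f (a + z)) ('d f (a + z)).
Proof.
move=> df; have Ds : is_diff z (cst a + id : V -> V) id.
  by rewrite -[X in is_diff _ _ X]add0r; exact: is_diffD.
exact: (@is_diff_comp _ _ _ _ (cst a + id) _ f _ z Ds (differentiableP df)).
Qed.

Lemma open_shift (R : realType) (V : normedModType R) (a : V) (O : set V) :
  open O -> open [set z | O (a + z)].
Proof.
move=> oO; apply/open_forP => z Oz; have [d d0 Hd] := (open_forP O).1 oO _ Oz.
exists d => // y zy; apply: Hd; by rewrite opprD addrACA subrr add0r.
Qed.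

Lemma Cr1_shift (R : realType) (V W : normedModType R) (f : V -> W) (a : V) (O : set V) :
  open O -> Cr_on 1 O f -> Cr_on 1 [set z | O (a + z)] (fun z => f (a + z)).
Proof.
move=> oO [f1 f2]; split=> [z Oz|v]; first by have [] := diff_shift (f1 _ Oz).
apply: (@Cr_on_ext _ _ _ 0 _ (fun z => 'd f (a + z) v)).
- exact: open_shift.
- by move=> z Oz; have [_ ->] := diff_shift (f1 _ Oz).
move=> z Oz; apply: (continuous_comp (f := +%R a) (g := fun y => 'd f y v)); last exact: f2.
by apply: continuousD; [exact: cst_continuous|exact: cvg_id].
Qed.

Section FlatForms.
Variables (R : realType) (n : nat) (N : smoothManifold R n) (c : chart R n N).
Local Notation V := 'rV[R]_n.
Hypothesis c_atlas : atlas c.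
Variables (U : set N) (x0 : N) (p : nat).
Hypothesis U_open : open U.
Hypothesis U_x0 : U x0.
Hypothesis c_x0 : cdom c x0.
Local Notation y0 := (cmap c x0).

Definition conn_matrix (Om : 'I_p -> 'I_p -> oneform N) (y v : V) : 'M[R]_p :=
  \matrix_(i, j) pullback (cinv c) (Om i j) y v.

Lemma pullback_cinv w x v : cdom c x ->
  pullback (cinv c) w (cmap c x) v =
  pairing (w x) ('d (cmap (chart_at x) \o cinv c) (cmap c x) v).
Proof. by move=> cx; rewrite /pullback /diff_into chartK. Qed.

Variable Om : 'I_p -> 'I_p -> oneform N.
Hypothesis Om_C1 : forall i j, form_Cr 1 U (Om i j).
Hypothesis Om_flat : forall i j x, U x -> forall v1 v2,
  ext_d (Om i j) x v1 v2 + \sum_l wedge (Om i l) (Om l j) x v1 v2 = 0.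

Let B (l : 'I_n) (z : V) := conn_matrix Om (y0 + z) (delta_mx 0 l).

Let connB z v : conn B z v = conn_matrix Om (y0 + z) v.
Proof.
apply/matrixP => i j; rewrite /conn summxE [RHS]mxE pullback_delta.
by apply: eq_bigr => l _; rewrite !mxE.
Qed.

Let O := cmap c @` (U `&` cdom c).
Let O_open : open O.
Proof. exact: chart_img_open. Qed.

Let BE l i j : (fun z => B l z i j) =
  (fun z => pullback (cinv c) (Om i j) (y0 + z) (delta_mx 0 l)).
Proof. by apply/funext => z; rewrite mxE. Qed.

Let dconnB z u v i j : O (y0 + z) -> dconn B z u v i j =
  'd ((fun y => pullback (cinv c) (Om i j) y v) : V -> R^o) (y0 + z) u.
Proof.
move=> Oz; pose a l (y : V) : R^o := pullback (cinv c) (Om i j) y (delta_mx 0 l).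
have Da l : differentiable (a l) (y0 + z).
  by have [H _] := Om_C1 i j c_atlas (delta_mx 0 l); exact: H.
have E l m : 'd ((fun z => B l z i j) : V -> R^o) z (delta_mx 0 m) =
    'd (a l) (y0 + z) (delta_mx 0 m).
  rewrite BE; have [_ E] := diff_shift (Da l).
  exact: (congr1 (fun h : V -> R => h _) E).
have Ea : (fun y => pullback (cinv c) (Om i j) y v) = \sum_l (v 0 l *: a l) :> (V -> R^o).
  by apply/funext => y; rewrite fct_sumE; exact: pullback_delta.
have [_ D] : is_diff (y0 + z) (\sum_l (v 0 l *: a l) : V -> R^o)
    (\sum_l (v 0 l *: ('d (a l) (y0 + z) : V -> R^o))).
  by apply: is_diff_bigsum => l; apply: is_diffZ; exact: differentiableP.
rewrite Ea; apply: etrans (esym (congr1 (fun h : V -> R => h u) D)).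
rewrite fct_sumE; apply: etrans (dconnE _ _ _ _ _ _) _.
apply: eq_bigr => l _; apply: etrans (esym (congr1 (fun q : R => v 0 l * q) (linear_delta ('d (a l) (y0 + z)) u))).
rewrite mulr_sumr; apply: eq_bigr => m _.
apply: etrans (esym (mulrA _ _ _)) _.
exact: (congr1 (fun q : R => v 0 l * (u 0 m * q)) (E l m)).
Qed.

(** [flat_frame] recentred at [y0]: [ext_d_chart] carries the curvature, given in preferred charts,
    over to the fixed chart [c], where it becomes the matrix condition on [dconn] and [conn]. *)
Lemma flat_frame_form : exists (r : R) (g : V -> 'M[R]_p), [/\ 0 < r,
   forall y, `|y0 - y| < r -> (cmap c @` (U `&` cdom c)) y, g y0 = 1%:M &
   forall y, `|y0 - y| < r -> is_diff y g (fun v => g y *m conn_matrix Om y v)].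
Proof.
have [||||r [g [r0 rO g0 gd]]] := @flat_frame R n p B [set z | O (y0 + z)].
- exact: open_shift.
- by rewrite /= addr0; exists x0.
- move=> l i j; rewrite BE.
  apply: (Cr1_shift (f := fun y => pullback (cinv c) (Om i j) y (delta_mx 0 l))) => //.
  exact: Om_C1.
- move=> z u v Oz; rewrite !connB; apply/matrixP => i j; rewrite mxE [RHS]mxE.
  have [x [Ux cx] xE] := Oz.
  have F := Om_flat i j Ux ('d (cmap (chart_at x) \o cinv c) (cmap c x) u)
     ('d (cmap (chart_at x) \o cinv c) (cmap c x) v).
  rewrite -(ext_d_chart u v c_atlas U_open Ux cx (Om_C1 i j)) in F.
  have S : \sum_l wedge (Om i l) (Om l j) x ('d (cmap (chart_at x) \o cinv c) (cmap c x) u)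
     ('d (cmap (chart_at x) \o cinv c) (cmap c x) v) =
     (conn_matrix Om (y0 + z) u *m conn_matrix Om (y0 + z) v) i j
     - (conn_matrix Om (y0 + z) v *m conn_matrix Om (y0 + z) u) i j.
    rewrite ![in RHS]mxE -sumrB; apply: eq_bigr => l _.
    by rewrite /wedge !mxE -xE !pullback_cinv.
  rewrite S xE in F; rewrite -[RHS]F.
  have -> : forall X Y Z : 'M[R]_p, (X - Y + Z) i j = X i j - Y i j + Z i j.
    by move=> X Y Z; rewrite !mxE.
  have -> : forall X : 'M[R]_p, (- X) i j = - X i j by move=> X; rewrite mxE.
  rewrite -addrA; congr (_ + _).
  exact: (congr2 (fun a b => a - b) (dconnB u v i j Oz) (dconnB v u i j Oz)).
have key y : `|y0 - y| < r -> `|y - y0| < r by rewrite distrC.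
exists r, (fun y => g (- y0 + y)); split=> //.
- by move=> y /key/rO /=; rewrite addrC subrK => -[x Hx xE]; exists x.
- by rewrite addNr.
move=> y yr; have yr' : `|- y0 + y| < r by rewrite addrC distrC.
have [D E] := gd _ yr'; have := diff_shift D; rewrite E.
suff -> : (fun v => g (- y0 + y) *m conn B (- y0 + y) v) =
    (fun v => g (- y0 + y) *m conn_matrix Om y v) by [].
by apply/funext => v; rewrite connB addrA subrr add0r.
Qed.

End FlatForms.

Lemma is_derive_diff_line (R : realType) (V W : normedModType R) (f : V -> W) (y u : V)
    (t : R) df : is_diff (y + t *: u) f df ->
  is_derive t 1 (fun s => f (y + s *: u)) (df u).
Proof.
move=> [D E]; apply: is_derive_line; apply: DeriveDef; first exact: diff_derivable.
by rewrite deriveE// E.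
Qed.

Section FrameAgree.
Variables (R : realType) (n : nat) (N : smoothManifold R n) (c : chart R n N).
Local Notation V := 'rV[R]_n.
Hypothesis c_atlas : atlas c.
Variables (U : set N) (x0 : N) (p : nat).
Hypothesis U_open : open U.
Hypothesis U_x0 : U x0.
Hypothesis c_x0 : cdom c x0.
Local Notation y0 := (cmap c x0).
Variables Om Om' : 'I_p -> 'I_p -> oneform N.
Hypothesis Om_C1 : forall i j, form_Cr 1 U (Om i j).
Variables (d : nat) (f : 'rV[R]_d -> N) (P : set 'rV[R]_d) (p0 : 'rV[R]_d).
Hypothesis f_emb : smooth_embedding f.
Hypothesis P_poly : convex_polytope P.
Hypothesis P_p0 : P p0.
Hypothesis f_p0 : f p0 = x0.

Let F := cmap c \o f.
Let Q := f @^-1` (U `&` cdom c).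
Let Q_open : open Q.
Proof.
have [[cf _] _ _] := f_emb.
by apply: open_comp => [q _|]; [exact: cf|apply: openI => //; exact: cdom_open].
Qed.

Let F_C1 : Cr_on 1 Q F.
Proof.
have [[_ sf] _ _] := f_emb; apply: Cr_on_sub (sf c c_atlas 1).
by move=> q [].
Qed.

Let F_diff q : Q q -> differentiable F q.
Proof. by have [H _] := F_C1; exact: H. Qed.

Let pullF w q v : Q q -> pullback f w q v = pullback (cinv c) w (F q) ('d F q v).
Proof.
move=> Qq; apply: (pullback_chart w v c_atlas Q_open) => //; last exact: F_diff.
by move=> q' [].
Qed.

(** A bound for [Om] suffices, since on the polytope the pullbacks of [Om] and [Om'] coincide and
    both frames solve the equation with [Om]. *)
Let pullback_bound : exists K e : R, [/\ 0 <= K, 0 < e &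
  forall q, `|p0 - q| < e -> Q q /\ forall v i j, `|pullback f (Om i j) q v| <= K * `|v|].
Proof.
have Qp0 : Q p0 by rewrite /Q /preimage/= f_p0.
have [e1 e10 He1] := (open_forP Q).1 Q_open p0 Qp0.
pose T := ('I_p * 'I_p * 'I_d)%type.
pose phi (t : T) (q : 'rV[R]_d) : R^o := pullback f (Om t.1.1 t.1.2) q (delta_mx 0 t.2).
have cphi t : {for p0, continuous (phi t)}.
  pose a m (y : V) : R^o := pullback (cinv c) (Om t.1.1 t.1.2) y (delta_mx 0 m).
  have ca m : Cr_on 0 Q (a m \o F).
    move=> q Qq; have cF : {for q, continuous F}.
      by apply: differentiable_continuous; exact: F_diff.
    apply: (continuous_comp cF); apply: differentiable_continuous.
    have [H _] := Om_C1 t.1.1 t.1.2 c_atlas (delta_mx 0 m); apply: H.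
    by exists (f q).
  apply: (@Cr_on_ext _ _ _ 0 Q (\sum_m (fun q => coordl m ('d F q (delta_mx 0 t.2)) * (a m \o F) q) : _ -> R^o)) => //.
    move=> q Qq; rewrite fct_sumE; apply: esym.
    exact: etrans (pullF _ _ Qq) (pullback_delta _ _ _ _).
  move=> q Qq; apply: (big_ind (fun g : _ -> R^o => {for q, continuous g})).
  - exact: cst_continuous.
  - by move=> g h cg ch; exact: continuousD.
  move=> m _; apply: continuousM; last exact: ca.
  have [_ /(_ (delta_mx 0 t.2)) H] := F_C1.
  by apply: continuous_comp; [exact: H|exact: coordl_continuous].
have [K0 K00 HK0] : exists2 K : R, 0 <= K & forall t, `|phi t p0| + 1 <= K.
  apply: (fin_max (P := fun t K => `|phi t p0| + 1 <= K)).
    by move=> t a b ab /le_trans; apply.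
  by move=> t; exists (`|phi t p0| + 1).
have [e2 e20 He2] : exists2 e : R, 0 < e & forall t q, `|p0 - q| < e -> `|phi t p0 - phi t q| < 1.
  apply: (fin_min (P := fun t e => forall q, `|p0 - q| < e -> `|phi t p0 - phi t q| < 1)).
    by move=> t a b ba H q qb; apply: H; exact: lt_le_trans ba.
  by move=> t; exact: (continuous_forP _ _).1 (cphi t) _ ltr01.
exists (d%:R * K0), (Order.min e1 e2); split.
- by rewrite mulr_ge0.
- by rewrite lt_min e10.
move=> q; rewrite lt_min => /andP[q1 q2]; split; first exact: He1.
move=> v i j; rewrite pullback_delta; apply: le_trans (ler_norm_sum _ _ _) _.
apply: (@le_trans _ _ (\sum_(l < d) `|v| * K0)).
  apply: ler_sum => l _; rewrite normrM ler_pM ?mx_entry_le//.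
  have := HK0 (i, j, l); apply: le_trans; have := He2 (i, j, l) q q2.
  rewrite -/(phi (i, j, l) q) => /ltW H.
  by rewrite -[X in `|X|](subKr (phi (i, j, l) p0)) (le_trans (ler_normB _ _))// lerD2l.
by rewrite sumr_const card_ord -[leLHS]mulr_natl [leLHS]mulrCA [leLHS]mulrC.
Qed.

(** A nearby point of the face is joined to [x0] by the image of a segment, which stays in the face
    because the model [P] is convex. Along it both frames satisfy the same linear equation with
    equal initial values, so Gronwall's inequality with [e = 0] identifies them. That [f] is a
    topological embedding turns closeness in [N] into closeness in the model. *)
Lemma frame_agree (r : R) (g g' : V -> 'M[R]_p) : 0 < r -> g y0 = g' y0 ->
  (forall y, `|y0 - y| < r -> is_diff y g (fun v => g y *m conn_matrix c Om y v)) ->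
  (forall y, `|y0 - y| < r -> is_diff y g' (fun v => g' y *m conn_matrix c Om' y v)) ->
  (forall q, P q -> U (f q) -> forall v i j,
    pullback f (Om i j) q v = pullback f (Om' i j) q v) ->
  exists W, [/\ open W, W x0 & forall x, W x -> (f @` P) x -> g (cmap c x) = g' (cmap c x)].
Proof.
move=> r0 g0 gd gd' agree.
have [K [e [K0 e0 HK]]] := pullback_bound.
have Fp0 : F p0 = y0 by rewrite /F/= f_p0.
have cF : {for p0, continuous F}.
  apply: differentiable_continuous; apply: F_diff.
  by rewrite /Q /preimage/= f_p0.
have [e' e'0 He'] := (continuous_forP _ _).1 cF r r0.
(* The last term bounds [p K |v|] by 1/2, the factor that [gronwall_small] tolerates. *)
pose b := Order.min (Order.min e e') (2 * (p%:R * K + 1))^-1.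
have den : 0 < 2 * (p%:R * K + 1) by rewrite mulr_gt0// ltr_wpDl// mulr_ge0.
have b0 : 0 < b by rewrite !lt_min e0 e'0 invr_gt0.
have [_ [_ injf embf] _] := f_emb.
have oB : open [set q : 'rV[R]_d | `|p0 - q| < b].
  have -> : [set q : 'rV[R]_d | `|p0 - q| < b] = ball p0 b by rewrite -ball_normE.
  exact: ball_open.
have [W oW fW] := embf _ oB; exists W; split=> //.
  have : (f @` (setT `&` [set q | `|p0 - q| < b])) x0.
    by exists p0 => //; split=> //=; rewrite subrr normr0.
  by rewrite fW => -[].
move=> x Wx [q Pq qx].
have qb : `|p0 - q| < b.
  have : (f @` (setT `&` [set q | `|p0 - q| < b])) x by rewrite fW; split=> //; exists q.
  move=> [q' [_ q'b] q'x].
  by have <- : q' = q by apply: injf; rewrite ?inE// q'x qx.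
pose v := q - p0.
have vb : `|v| < b by rewrite distrC.
have path (t : R) : 0 <= t <= 1 -> `|p0 - (p0 + t *: v)| < b.
  move=> /andP[t0 t1]; rewrite opprD addrA subrr sub0r normrN normrZ ger0_norm//.
  by apply: le_lt_trans vb; rewrite ler_piMl.
have be z : z < b -> [/\ z < e, z < e' & z < (2 * (p%:R * K + 1))^-1].
  by rewrite !lt_min => /andP[/andP[-> ->] ->].
pose M (h : 'I_p -> 'I_p -> oneform N) (t : R) : 'M[R]_p :=
  \matrix_(i, j) pullback f (h i j) (p0 + t *: v) v.
have MM t : 0 <= t <= 1 -> M Om t = M Om' t.
  move=> t01; apply/matrixP => i j; rewrite [LHS]mxE [RHS]mxE; apply: agree.
    exact: polytope_convex.
  by have [/HK[[]]] := be _ (path t t01).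
have D (h : 'I_p -> 'I_p -> oneform N) (k : V -> 'M[R]_p) (t : R) : 0 <= t <= 1 ->
   (forall y, `|y0 - y| < r -> is_diff y k (fun v => k y *m conn_matrix c h y v)) ->
   is_derive t 1 (fun s : R => k (F (p0 + s *: v))) (k (F (p0 + t *: v)) *m M h t).
  move=> t01 kd; have [/HK[Qt _] /He' rt _] := be _ (path t t01).
  rewrite Fp0 in rt.
  have C := @is_diff_comp _ _ _ _ F _ k _ (p0 + t *: v) (differentiableP (F_diff Qt)) (kd _ rt).
  have := is_derive_diff_line C.
  suff -> : M h t = conn_matrix c h (F (p0 + t *: v)) ('d F (p0 + t *: v) v) by [].
  by apply/matrixP => i j; rewrite [LHS]mxE [RHS]mxE; exact: pullF.
have := @gronwall_small R p p (fun t => g (F (p0 + t *: v)) - g' (F (p0 + t *: v)))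
  (fun t => (g (F (p0 + t *: v)) - g' (F (p0 + t *: v))) *m M Om t) 0.
rewrite scale0r addr0 Fp0 g0 subrr => /(_ erefl) G.
have := G _ _ 1; rewrite ler01 lexx mulr0 scale1r => {}G.
have qE : p0 + v = q by rewrite addrC subrK.
have FqE : F q = cmap c x by rewrite /F/= qx.
rewrite qE FqE in G; apply/eqP; rewrite -subr_eq0 -normr_le0; apply: G => //.
- move=> t t01; rewrite mulmxBl; apply: is_deriveB; first exact: D.
  by rewrite MM//; exact: D.
- move=> t t01; rewrite addr0; have [/HK[_ Kt] _ vt] := be _ (path t t01).
  apply: le_trans (mx_norm_mul _ _) _; rewrite mulrAC mulrC ler_wpM2l//.
  have : `|M Om t| <= K * `|v|.
    by apply: mx_norm_le => [|i j]; [rewrite mulr_ge0|rewrite mxE Kt].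
  move=> /(ler_wpM2l (ler0n R p))/le_trans; apply.
  have [_ _ /ltW vs] := be _ vb.
  rewrite mulrA; apply: (@le_trans _ _ (p%:R * K * (2 * (p%:R * K + 1))^-1)).
    by rewrite ler_wpM2l// mulr_ge0.
  rewrite ler_pdivrMr//; have := mulr_ge0 (ler0n R p) K0; lra.
Qed.

End FrameAgree.

(** * Cutoff functions *)

Section Bump.
Variable R : realType.

(** The function [x |x|] is C^1 with derivative [2 |x|]: a building block for an algebraic cutoff,
    of the regularity asked of the annihilator. *)
Lemma mul_norm_taylor (x h : R) :
  `|(x + h) * `|x + h| - x * `|x| - 2 * `|x| * h| <= h * h.
Proof.
rewrite ler_norml.
have [x0|x0] := leP 0 x; have [xh0|xh0] := leP 0 (x + h).
- by rewrite !ger0_norm//; apply/andP; split; nra.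
- by rewrite (ger0_norm x0) (ltr0_norm xh0); apply/andP; split; nra.
- by rewrite (ltr0_norm x0) (ger0_norm xh0); apply/andP; split; nra.
- by rewrite !ltr0_norm//; apply/andP; split; nra.
Qed.

Lemma is_diff_mul_norm (x : R^o) :
  is_diff x ((fun z => z * `|z|) : R^o -> R^o) ( *:%R (2 * `|x|)).
Proof.
apply: is_diff_forP; first exact: scaler_continuous.
move=> e e0; exists e => // h he.
apply: (@le_trans _ _ (`|h| * `|h|)); last by rewrite ler_wpM2r// ltW.
have <- : h * h = `|h| * `|h| by rewrite -normrM ger0_norm// -expr2 sqr_ge0.
exact: mul_norm_taylor.
Qed.

Variable V : normedModType R.

Lemma Cr1_mul_norm (O : set V) (a : V -> R^o) : open O ->
  Cr_on 1 O a -> Cr_on 1 O ((fun y => a y * `|a y|) : V -> R^o).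
Proof.
move=> oO [a1 a2].
have D y : O y -> is_diff y ((fun z => z * `|z|) \o a : V -> R^o)
    ( *:%R (2 * `|a y|) \o 'd a y).
  move=> Oy; have E := is_diff_mul_norm (a y).
  exact: (@is_diff_comp _ _ _ _ a _ _ _ y (differentiableP (a1 y Oy)) E).
split=> [y Oy|v]; first by have [] := D y Oy.
apply: (@Cr_on_ext _ _ _ 0 _ (fun y => 2 * `|a y| * 'd a y v : R^o)) => //.
  move=> y Oy; have [_ E] := D y Oy.
  exact: esym (congr1 (fun h : V -> R^o => h v) E).
move=> y Oy; apply: continuousM; last exact: a2.
apply: continuousM; first exact: cst_continuous.
have ca : {for y, continuous a} by apply: differentiable_continuous; exact: a1.
by apply: (continuous_comp ca); exact: norm_continuous.
Qed.

(* A C^1 quadratic spline, equal to 1 on q <= 1 and to 0 on 2 <= q; the square of the positive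
   part of s is (s |s| + s s) / 2. *)
Definition pos_sqr (s : R) : R := (s * `|s| + s * s) / 2.
Definition spline (q : R) : R :=
  1 + ((-2) * pos_sqr (q - 1) + (4 * pos_sqr (q - 3 / 2) + (-2) * pos_sqr (q - 2))).

Lemma pos_sqrE (s : R) : pos_sqr s = if 0 <= s then s * s else 0.
Proof.
rewrite /pos_sqr; case: leP => s0; first by rewrite ger0_norm//; field.
by rewrite ltr0_norm//; field.
Qed.

Lemma spline_1 q : q <= 1 -> spline q = 1.
Proof.
by move=> q1; rewrite /spline !pos_sqrE; do 3 case: leP => ?; nra.
Qed.

Lemma spline_0 q : 2 <= q -> spline q = 0.
Proof.
by move=> q1; rewrite /spline !pos_sqrE; do 3 case: leP => ?; nra.
Qed.

Lemma spline_01 q : 0 <= spline q <= 1.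
Proof.
rewrite /spline !pos_sqrE; case: (leP 0 (q - 1)) => ?; case: (leP 0 (q - 3 / 2)) => ?;
  case: (leP 0 (q - 2)) => ?; apply/andP; split; nra.
Qed.

Let Cr1D_pt (O : set V) (f g : V -> R^o) : open O -> Cr_on 1 O f -> Cr_on 1 O g ->
  Cr_on 1 O ((fun y => f y + g y) : V -> R^o).
Proof. exact: Cr1D. Qed.

Let Cr1Z_pt (O : set V) (k : R) (f : V -> R^o) : open O -> Cr_on 1 O f ->
  Cr_on 1 O ((fun y => k * f y) : V -> R^o).
Proof. by move=> oO; exact: (Cr1M oO (@Cr_on_cst R V R^o O k 1)). Qed.

Lemma Cr1_spline (O : set V) (a : V -> R^o) : open O ->
  Cr_on 1 O a -> Cr_on 1 O ((fun y => spline (a y)) : V -> R^o).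
Proof.
move=> oO Ca.
have P (s : R) : Cr_on 1 O ((fun y => pos_sqr (a y - s)) : V -> R^o).
  pose b : V -> R^o := fun y => a y - s.
  have Cb : Cr_on 1 O b := Cr1D_pt oO Ca (@Cr_on_cst R V R^o O (- s) 1).
  exact: (Cr1M oO (Cr1D_pt oO (Cr1_mul_norm oO Cb) (Cr1M oO Cb Cb))
    (@Cr_on_cst R V R^o O (2^-1 : R) 1)).
exact: (Cr1D_pt oO (@Cr_on_cst R V R^o O (1 : R) 1) (Cr1D_pt oO (Cr1Z_pt (-2) oO (P 1))
  (Cr1D_pt oO (Cr1Z_pt 4 oO (P (3 / 2))) (Cr1Z_pt (-2) oO (P 2))))).
Qed.

End Bump.

Lemma Cr1_coordl (R : realType) n (j : 'I_n) : Cr_on 1 setT (@coordl R n j).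
Proof.
have dL y : differentiable (@coordl R n j) y.
  exact/linear_differentiable/coordl_continuous.
split=> // v; apply: (@Cr_on_ext _ _ _ 0 _ (cst (coordl j v))).
- exact: openT.
- move=> y _; apply: esym; apply: (congr1 (fun h : _ -> R^o => h v) (diff_lin y _)).
  exact: coordl_continuous.
exact: (Cr_on_cst _ _ 0).
Qed.

(** A product over coordinates matches the sup norm. The factor [2 / rho ^+ 2] puts the point where
    [spline] reaches 0 at distance [rho]; at distance [rho / 2] its argument is 1/2, still in the
    range where it equals 1. *)
Lemma bump_function (R : realType) n (y0 : 'rV[R]_n) (rho : R) : 0 < rho ->
  exists psi : 'rV[R]_n -> R^o, [/\ Cr_on 1 setT psi,
    forall y, 0 <= psi y <= 1,
    exists2 rho1 : R, 0 < rho1 & forall y, `|y0 - y| < rho1 -> psi y = 1 &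
    forall y, rho <= `|y0 - y| -> psi y = 0].
Proof.
move=> rho0; pose q j (y : 'rV[R]_n) : R^o := 2 / rho ^+ 2 * ((y 0 j - y0 0 j) * (y 0 j - y0 0 j)).
have Cq j : Cr_on 1 setT (q j).
  have C1 : Cr_on 1 setT (coordl j + cst (- y0 0 j : R^o)).
    by apply: Cr1D; [exact: openT|exact: Cr1_coordl|exact: Cr_on_cst].
  apply: (Cr1M (f := cst (2 / rho ^+ 2 : R^o))); first exact: openT.
    exact: Cr_on_cst.
  by apply: (Cr1M (f := coordl j + cst (- y0 0 j : R^o)) (g := coordl j + cst (- y0 0 j : R^o))) => //; exact: openT.
exists (fun y => \prod_j spline (q j y)); split.
- have -> : (fun y => \prod_j spline (q j y)) =
     \big[(fun f g y => f y * g y)/cst 1]_j (fun y => spline (q j y)) :> ('rV[R]_n -> R^o).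
    apply/funext => y; elim/big_rec2 : _ => [|j a b _ <-] //.
  apply: (big_ind (fun f : 'rV[R]_n -> R^o => Cr_on 1 setT f)).
  + exact: Cr_on_cst.
  + by move=> f g Cf Cg; apply: Cr1M => //; exact: openT.
  + by move=> j _; apply: Cr1_spline => //; exact: openT.
- move=> y; apply: (big_ind (fun z : R => 0 <= z <= 1)); first by rewrite ler01 lexx.
  + by move=> z1 z2 /andP[? ?] /andP[? ?]; rewrite mulr_ge0// mulr_ile1.
  + by move=> j _; exact: spline_01.
- exists (rho / 2); first by rewrite divr_gt0.
  move=> y yr; apply: big1 => j _; apply: spline_1.
  rewrite /q mulrAC ler_pdivrMr ?exprn_gt0// mul1r.
  have : `|y 0 j - y0 0 j| <= rho / 2.
    by rewrite distrC -mx_subE (le_trans (mx_entry_le _ _ _))// ltW.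
  by rewrite ler_norml expr2; nra.
- move=> y yr.
  have [j Hj] : exists j, rho <= `|y0 0 j - y 0 j|.
    apply: contrapT => /forallNP H.
    have [n0|/card_gt0P[j0 _]] := posnP #|'I_n|.
      have E : y0 = y by apply/rowP => j; have := fintype0 j n0.
      by move: yr; rewrite E subrr normr0 leNgt rho0.
    have [|[i j] /= E] := @mx_norm_neq0 _ _ _ (y0 - y).
      by rewrite -/(`|y0 - y|) gt_eqF// (lt_le_trans rho0).
    apply: (H j); move: yr; rewrite [X in _ <= X -> _]E (ord1 i).
    by rewrite mx_subE.
  rewrite (bigD1 j)//= spline_0 ?mul0r// /q mulrAC ler_pdivlMr ?exprn_gt0// ler_pM2l// expr2.
  have : rho * rho <= `|y0 0 j - y 0 j| * `|y0 0 j - y 0 j| by apply: ler_pM => //; exact: ltW.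
  by rewrite -normrM ger0_norm -?expr2 ?sqr_ge0//; nra.
Qed.

(** * Trivialization *)

(** The columns of [Z] from [k] on are the coordinates of the projection onto a complement of [V]
    along [V], so their common kernel lies in [V]. *)
Lemma complement_coordinates (F : fieldType) (n k : nat) (V : {vspace 'rV[F]_n}) :
  \dim V = k -> (k <= n)%N /\ exists Z : 'M[F]_n, forall v : 'rV[F]_n,
    (forall j : 'I_n, (k <= j)%N -> (v *m Z) 0 j = 0) -> v \in V.
Proof.
move=> dV; have dn : \dim {:'rV[F]_n} = n by rewrite dimvf dim_matrix; exact: mul1n.
have kn : (k <= n)%N by rewrite -dV -[X in (_ <= X)%N]dn dimvS// subvf.
split=> //; pose W := (V^C)%VS; pose X := vbasis W.
have WV : (W :&: V = 0)%VS by rewrite capvC capv_compl.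
have dW : \dim W = (n - k)%N by rewrite dimv_compl dn dV.
pose z (j : 'I_n) (v : 'rV[F]_n) : F :=
  if insub (j - k)%N is Some i then coord X i (daddv_pi W V v) else 0.
pose Z : 'M[F]_n := \matrix_(l, j) z j (delta_mx 0 l).
have ZE v j : (v *m Z) 0 j = z j v.
  rewrite mxE [v in RHS]row_sum_delta /z; case E : (insub (j - k)%N) => [i|].
    by rewrite !linear_sum; apply: eq_bigr => l _; rewrite !linearZ mxE /z E.
  by rewrite big1// => l _; rewrite mxE /z E mulr0.
exists Z => v Hv.
have pv0 : daddv_pi W V v = 0.
  rewrite (coord_vbasis (memv_pi W V v)) big1// => i _.
  have ki : (k + i < n)%N by have := ltn_ord i; rewrite {2}dW ltn_subRL.
  have := Hv (Ordinal ki) (leq_addr _ _); rewrite ZE /z/= addKn.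
  case: insubP => [i' _ ii'|]; last by rewrite ltn_ord.
  have -> : i' = i by exact: val_inj.
  by move=> ->; rewrite scale0r.
have WVf : (W + V)%VS = fullv by rewrite addvC addv_complf.
have vWV : v \in (W + V)%VS by rewrite WVf memvf.
by rewrite -(daddv_pi_add WV vWV) pv0 add0r memv_pi.
Qed.

Lemma lker_inj (F : fieldType) (aT rT : vectType F) (f : 'Hom(aT, rT)) (V : {vspace aT}) v :
  \dim (f @: V) = \dim V -> v \in V -> f v = 0 -> v = 0.
Proof.
move=> dfV vV fv; have := limg_ker_dim f V; rewrite dfV -[RHS]add0n => /addIn/eqP.
rewrite dimv_eq0 => /eqP E; apply/eqP; rewrite -memv0 -E memv_cap vV.
by rewrite memv_ker fv eqxx.
Qed.

Section BlockForm.
Variables (R : realType) (n : nat) (N : smoothManifold R n) (k : nat).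

(* The connection matrix with blocks A and a in its first k rows, and a last row equal to
   zero: the equations d a = - A /\ a and d A + A /\ A = 0 amount to its flatness. *)
Definition block_form (A : 'I_k -> 'I_k -> oneform N) (a : 'I_k -> oneform N)
    (i j : 'I_(k + 1)) : oneform N :=
  match fintype.split i, fintype.split j with
  | inl i', inl j' => A i' j'
  | inl i', inr _ => a i'
  | inr _, _ => fun=> 0
  end.

Variables (A : 'I_k -> 'I_k -> oneform N) (a : 'I_k -> oneform N).

Lemma block_formll i j : block_form A a (lshift 1 i) (lshift 1 j) = A i j.
Proof. by rewrite /block_form !(unsplitK (inl _)). Qed.

Lemma block_formlr i j : block_form A a (lshift 1 i) (rshift k j) = a i.
Proof. by rewrite /block_form (unsplitK (inl _)) (unsplitK (inr _)). Qed.

Lemma block_formr i j : block_form A a (rshift k i) j = fun=> 0.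
Proof. by rewrite /block_form (unsplitK (inr _)). Qed.

Lemma pullback0 m (F : 'rV[R]_m -> N) : pullback F (fun=> 0) = fun _ _ => 0.
Proof. by do 2 (apply/funext => ?); rewrite /pullback /pairing mulmx0 mxE. Qed.

Lemma block_form_C1 (U : set N) : (forall i j, form_Cr 1 U (A i j)) ->
  (forall i, form_Cr 1 U (a i)) -> forall i j, form_Cr 1 U (block_form A a i j).
Proof.
move=> CA Ca i j; rewrite /block_form; case: (fintype.split i) => i'.
  by case: (fintype.split j) => j'; [exact: CA|exact: Ca].
move=> c _ v; rewrite pullback0; exact: (@Cr_on_cst R _ R^o _ 0 1).
Qed.

Lemma ext_d0 (x : N) (u v : 'rV[R]_n) : ext_d (fun=> 0) x u v = 0.
Proof.
rewrite /ext_d pullback0.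
have E w : 'd ((fun=> 0) : 'rV[R]_n -> R^o) (cmap (chart_at x) x) w = 0.
  exact: (congr1 (fun h : 'rV[R]_n -> R^o => h w) (@diff_cst R _ R^o 0 _)).
exact: etrans (congr2 (fun p q : R => p - q) (E u) (E v)) (subrr 0).
Qed.

Lemma block_form_flat (U : set N) :
  (forall i x, U x -> forall u v,
     ext_d (a i) x u v = - \sum_(j < k) wedge (A i j) (a j) x u v) ->
  (forall i j x, U x -> forall u v,
     ext_d (A i j) x u v + \sum_(l < k) wedge (A i l) (A l j) x u v = 0) ->
  forall i j x, U x -> forall u v, ext_d (block_form A a i j) x u v +
    \sum_l wedge (block_form A a i l) (block_form A a l j) x u v = 0.
Proof.
move=> structure flatness i j x Ux u v.
have w0l w : wedge (fun=> 0) w x u v = 0 by rewrite /wedge /pairing !mulmx0 !mxE !mul0r subrr.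
have w0r w : wedge w (fun=> 0) x u v = 0 by rewrite /wedge /pairing !mulmx0 !mxE !mulr0 subrr.
rewrite big_split_ord/= big_ord1 block_formr w0r addr0.
rewrite -(splitK i); case: (fintype.split i) => i' /=; last first.
  by rewrite block_formr ext_d0 big1 ?addr0// => l _; rewrite block_formr w0l.
rewrite -(splitK j); case: (fintype.split j) => j' /=.
  apply: etrans (flatness i' j' x Ux u v); rewrite block_formll; congr (_ + _).
  by apply: eq_bigr => l _; rewrite !block_formll.
rewrite block_formlr structure// addrC; apply/eqP; rewrite subr_eq0; apply/eqP.
by apply: eq_bigr => l _; rewrite block_formll block_formlr.
Qed.

End BlockForm.

Section MatrixDiff.
Variable R : realType.

Definition entryl p q (i : 'I_p) (j : 'I_q) (X : 'M[R]_(p, q)) : R^o := X i j.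

Lemma entryl_linear p q i j : linear (@entryl p q i j).
Proof. by move=> a u v; rewrite /entryl !mxE. Qed.

HB.instance Definition _ p q (i : 'I_p) (j : 'I_q) :=
  GRing.isLinear.Build R 'M[R]_(p, q) R^o _ (@entryl p q i j) (@entryl_linear p q i j).

Lemma is_diff_entry p q (V : normedModType R) (F dF : V -> 'M[R]_(p, q)) x i j :
  is_diff x F dF -> is_diff x (@entryl p q i j \o F) (@entryl p q i j \o dF).
Proof.
move=> [D <-]; have cL : continuous (@entryl p q i j) by exact: coord_continuous.
have dL y : differentiable (@entryl p q i j) y by exact: linear_differentiable.
have E : ('d (@entryl p q i j) (F x) : 'M[R]_(p, q) -> R^o) = @entryl p q i j by exact: diff_lin.
by apply: DiffDef; [exact: differentiable_comp|rewrite diff_comp// E].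
Qed.

End MatrixDiff.

Lemma tangent_to_self (R : realType) n (N : smoothManifold R n) (x : N) v :
  tangent_to (chart_at x) x v = v.
Proof.
set c := chart_at x; have cx : cdom c x := chart_at_dom x.
have E y : (cmap c @` (setT `&` cdom c)) y -> id y = (cmap c \o cinv c) y.
  by move=> [z [_ cz] <-]; rewrite /= chartK.
have [_ D] := eq_diff (@chart_img_open _ _ _ c _ openT) E
  (ex_intro2 _ _ x (conj I cx) erefl) (ex_diff (is_diff_def := is_diff_id (cmap c x))).
have [_ D'] := is_diff_id (cmap c x).
exact: (congr1 (fun h : _ -> _ => h v) (etrans D D')).
Qed.

Lemma norm_ball_open (R : realType) (V : normedModType R) (x : V) (r : R) :
  open [set y : V | `|x - y| < r].
Proof.
have -> : [set y : V | `|x - y| < r] = ball_ Num.norm x r by [].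
rewrite ball_normE; exact: ball_open.
Qed.

Section Trivialize.
Variables (R : realType) (n k : nat) (N : smoothManifold R n) (M : set N) (T : mesh M).
Variable x0 : N.
Local Notation V := 'rV[R]_n.
Let c := chart_at x0.
Let y0 := cmap c x0.
Variables (m : nat) (Pi : 'I_m -> set N).
Variables (A : 'I_m -> 'I_k -> 'I_k -> oneform N) (al : 'I_m -> 'I_k -> oneform N).
Variables (g : 'I_m -> V -> 'M[R]_(k + 1)) (rho : R) (Z : 'M[R]_n).
Let Om i := block_form (A i) (al i).
Let ball := [set y : V | `|y0 - y| < rho].
Hypothesis rho_gt0 : 0 < rho.
Hypothesis Pi_top : forall P, top_at T x0 P <-> exists i, P = Pi i.
Hypothesis ball_pt : forall y, `|y0 - y| < rho ->
  exists x, [/\ cdom c x, cmap c x = y, M x & exists i, Pi i x].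
Hypothesis ball_poly : forall x D, cdom c x -> `|y0 - cmap c x| < rho -> polys T D -> D x ->
  D x0.
Hypothesis agree : forall i j x, cdom c x -> `|y0 - cmap c x| < rho -> Pi i x -> Pi j x ->
  g i (cmap c x) = g j (cmap c x).
Hypothesis Om_C1 : forall i a b v,
  Cr_on 1 [set y : V | `|y0 - y| < rho] ((fun y => pullback (cinv c) (block_form (A i) (al i) a b) y v) : V -> R^o).
Hypothesis g_diff : forall i y, `|y0 - y| < rho ->
  is_diff y (g i) (fun v => g i y *m conn_matrix c (block_form (A i) (al i)) y v).
Hypothesis g_y0 : forall i, g i y0 = 1%:M.
Hypothesis kn : (k <= n)%N.
Hypothesis full : forall (s : 'rV[R]_m) (w : V), simplex s ->
  (forall j : 'I_n, (k <= j)%N -> (w *m Z) 0 j = 0) ->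
  (forall a, \sum_i s 0 i * pairing (al i a x0) w = 0) -> w = 0.

Let c_atlas : atlas c.
Proof. exact: chart_at_atlas. Qed.
Let c_x0 : cdom c x0.
Proof. exact: chart_at_dom. Qed.

Let ball_open : open ball.
Proof. exact: norm_ball_open. Qed.

Let conn_matrixE i y v : conn_matrix c (Om i) y v =
  \sum_l v 0 l *: conn_matrix c (Om i) y (delta_mx 0 l).
Proof.
apply/matrixP => a b; rewrite mxE summxE pullback_delta.
by apply: eq_bigr => l _; rewrite !mxE.
Qed.

Let lst : 'I_(k + 1) := rshift k ord0.

Definition potential_chart i (y : V) : V :=
  \row_j (if insub (val j) is Some a then g i y (lshift 1 (a : 'I_k)) (rshift k ord0)
          else (y *m Z) 0 j).

(** Written through the equation of the frame, so that its continuity follows from that of [g] and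
    of the forms. *)
Definition potential_jac i (y : V) : 'M[R]_n :=
  \matrix_(l, j) (if insub (val j) is Some a then
    (g i y *m conn_matrix c (block_form (A i) (al i)) y (delta_mx 0 l))
       (lshift 1 (a : 'I_k)) (rshift k ord0)
  else Z l j).

Local Notation phi := potential_chart.
Local Notation Jm := potential_jac.

Let Jm_low i y (v : V) (j : 'I_n) (a : 'I_k) : val a = val j ->
  (v *m Jm i y) 0 j = (g i y *m conn_matrix c (Om i) y v) (lshift 1 a) lst.
Proof.
move=> aj; have E : insub (val j) = Some a :> option 'I_k.
  by rewrite -aj valK.
rewrite [LHS]mxE conn_matrixE mulmx_sumr summxE; apply: eq_bigr => l _.
by rewrite [X in _ * X]mxE E -scalemxAr [RHS]mxE.
Qed.

Let Jm_high i y (v : V) (j : 'I_n) : (k <= j)%N -> (v *m Jm i y) 0 j = (v *m Z) 0 j.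
Proof.
move=> kj; rewrite [LHS]mxE [RHS]mxE; apply: eq_bigr => l _.
by rewrite mxE insubN// -leqNgt.
Qed.

Let phi_low i y (j : 'I_n) (a : 'I_k) : val a = val j ->
  phi i y 0 j = g i y (lshift 1 a) lst.
Proof. by move=> aj; rewrite mxE -aj valK. Qed.

Let phi_high i y (j : 'I_n) : (k <= j)%N -> phi i y 0 j = (y *m Z) 0 j.
Proof. by move=> kj; rewrite mxE insubN// -leqNgt. Qed.

Let low_or_high (j : 'I_n) : (exists a : 'I_k, val a = val j) \/ (k <= j)%N.
Proof. by have [kj|jk] := leqP k j; [right|left; exists (Ordinal jk)]. Qed.

Let phi_diff i y : `|y0 - y| < rho -> is_diff y (phi i) (mulmxr (Jm i y)).
Proof.
move=> yb; apply: is_diff_rV => j; have [[a aj]|kj] := low_or_high j.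
  have D := is_diff_entry (lshift 1 a) lst (g_diff i yb).
  have -> : coordl j \o phi i = entryl (lshift 1 a) lst \o g i.
    by apply/funext => z; exact: phi_low.
  have -> : coordl j \o mulmxr (Jm i y) = entryl (lshift 1 a) lst \o
     (fun v => g i y *m conn_matrix c (block_form (A i) (al i)) y v).
    by apply/funext => v; exact: Jm_low.
  exact: D.
pose L := (@coordl R n j \o mulmxr Z : {linear V -> R^o}).
have -> : coordl j \o phi i = L by apply/funext => z; exact: phi_high.
have -> : coordl j \o mulmxr (Jm i y) = L by apply/funext => v; exact: Jm_high.
have cL : continuous L by exact: linear_rV_continuous.
by apply: DiffDef; [exact: linear_differentiable|exact: diff_lin].
Qed.

Let Jm_cont i y : `|y0 - y| < rho -> {for y, continuous (Jm i)}.
Proof.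
move=> yb; apply: continuous_mx_for => l j; have [[a aj]|kj] := low_or_high j; last first.
  have -> : (fun y => Jm i y l j) = cst (Z l j).
    by apply/funext => z; rewrite mxE insubN// -leqNgt.
  exact: cst_continuous.
have -> : (fun y => Jm i y l j) = \sum_b ((fun y => g i y (lshift 1 a) b *
    pullback (cinv c) (Om i b lst) y (delta_mx 0 l)) : V -> R^o).
  apply/funext => z; rewrite fct_sumE mxE -aj valK mxE.
  by apply: eq_bigr => b _; rewrite [X in _ * X]mxE.
apply: (big_ind (fun f : V -> R^o => {for y, continuous f})).
- exact: cst_continuous.
- by move=> f h cf ch; exact: continuousD.
move=> b _; apply: continuousM.
  have [D _] := g_diff i yb.
  exact: continuous_comp (differentiable_continuous D) (@coord_continuous _ _ _ _ _ _).
apply: differentiable_continuous.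
by have [H _] := Om_C1 i b lst (delta_mx 0 l); exact: H.
Qed.

Let phi_C1 i : Cr_on 1 ball (phi i).
Proof.
split=> [y yb|v]; first by have [] := phi_diff i yb.
apply: (@Cr_on_ext _ _ _ 0 _ (fun y => v *m Jm i y)); first exact: ball_open.
  move=> y yb; have [_ E] := phi_diff i yb.
  exact: esym (congr1 (fun h : V -> V => h v) E).
move=> y yb; have cm : continuous (mulmx v : 'M[R]_n -> V).
  move=> X; apply: continuous_rV_for => j.
  have -> : (fun Y : 'M[R]_n => (v *m Y) 0 j) = \sum_l (fun Y : 'M[R]_n => v 0 l * Y l j).
    by apply/funext => Y; rewrite fct_sumE mxE.
  apply: (big_ind (fun f : 'M[R]_n -> R => {for X, continuous f})).
  - exact: cst_continuous.
  - by move=> f h cf ch; exact: continuousD.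
  move=> l _; apply: continuousM; [exact: cst_continuous|exact: coord_continuous].
by apply: continuous_comp; [exact: Jm_cont|exact: cm].
Qed.

Let y0_ball : `|y0 - y0| < rho.
Proof. by rewrite subrr normr0. Qed.

Let pairing_conn i a x v : cdom c x ->
  conn_matrix c (Om i) (cmap c x) (tangent_to c x v) (lshift 1 a) lst = pairing (al i a x) v.
Proof. by move=> cx; rewrite mxE /Om /lst block_formlr; exact: pairing_chart. Qed.

(** The coordinates from [k] on do not depend on the polytope, and the weights add up to 1, so a
    kernel vector of the convex combination is killed by those columns of [Z]. Since [g] is the
    identity at [y0], the other coordinates are the convex combination of the forms themselves. *)
Let Jm_hull (s : 'rV[R]_m) (v : V) : simplex s -> v != 0 ->
  \sum_i s 0 i *: (v *m Jm i y0) != 0.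
Proof.
move=> Ss; apply: contra_neq => E; apply: (full Ss).
- move=> j kj; have := congr1 (fun r : V => r 0 j) E; rewrite summxE [RHS]mxE => <-.
  rewrite -[LHS]mul1r -Ss.2 mulr_suml; apply: eq_bigr => i _.
  by rewrite -(Jm_high i y0 v kj) [RHS]mxE.
- move=> a; pose j := Ordinal (leq_trans (ltn_ord a) kn).
  have := congr1 (fun r : V => r 0 j) E; rewrite summxE [RHS]mxE => H.
  apply: (etrans _ H); apply: eq_bigr => i _; rewrite [RHS]mxE (Jm_low _ _ _ (a := a) (j := j))//.
  rewrite g_y0 mul1mx; congr (_ * _).
  by rewrite -(pairing_conn i a v c_x0) tangent_to_self.
Qed.

(** Some polytope through the point is chosen; on the ball [agree] makes the choice immaterial. The
    value 0 is a default at points outside all the [Pi i]. *)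
Definition glued_chart (y : V) : V :=
  if pselect (exists i, Pi i (cinv c y)) is left H then phi (projT1 (cid H)) y else 0.

Local Notation Phi := glued_chart.

Let PhiE i x : cdom c x -> `|y0 - cmap c x| < rho -> Pi i x ->
  Phi (cmap c x) = phi i (cmap c x).
Proof.
move=> cx xb Px; rewrite /glued_chart; case: pselect => [H|[]]; last by exists i; rewrite chartK.
case: (cid H) => i' /=; rewrite chartK// => Pi'x.
by apply/rowP => j; rewrite !mxE (agree cx xb Pi'x Px).
Qed.

Let Pi_poly i : polys T (Pi i).
Proof. by have [[]] := (Pi_top (Pi i)).2 (ex_intro _ i erefl). Qed.

(** The pieces are closed and finite in number: close to [y] only those through its point [x] occur,
    and each corresponding potential takes the value [Phi y] at [y]. *)
Let Phi_cont y : `|y0 - y| < rho -> {for y, continuous Phi}.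
Proof.
move=> yb; have [x [cx xy _ [i0 Pi0]]] := ball_pt yb.
apply/continuous_forP => e e0.
have [d1 d10 Hd1] := (open_forP _).1 ball_open y yb.
have [d2 d20 Hd2] : exists2 d : R, 0 < d & forall i x', cdom c x' -> `|y - cmap c x'| < d ->
    Pi i x' -> Pi i x /\ `|phi i y - phi i (cmap c x')| < e.
  apply: (fin_min (P := fun i d => forall x', cdom c x' -> `|y - cmap c x'| < d ->
    Pi i x' -> Pi i x /\ `|phi i y - phi i (cmap c x')| < e)).
    by move=> i d d' d'd H x' cx' xd; apply: H => //; exact: lt_le_trans d'd.
  move=> i; have [Pix|nPix] := pselect (Pi i x).
    have [D _] := phi_diff i yb.
    have [d d0 Hd] := (continuous_forP _ _).1 (differentiable_continuous D) e e0.
    by exists d => // x' _ /Hd.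
  have oC : open (~` Pi i) by apply: closed_openC; exact: poly_closed (Pi_poly i).
  have [d d0 Hd] := (open_forP _).1 (@chart_img_open _ _ _ c _ oC) y (ex_intro2 _ _ x (conj nPix cx) xy).
  exists d => // x' cx' /Hd[z [nPz cz] zx'] Px'; exfalso; apply: nPz.
  by rewrite -(chartK cz) zx' chartK.
exists (Order.min d1 d2); first by rewrite lt_min d10.
move=> y'; rewrite lt_min => /andP[/Hd1 yb' y'd].
have [x' [cx' xy' _ [i Pix']]] := ball_pt yb'.
have := Hd2 i x' cx'; rewrite xy' => /(_ y'd Pix')[Pix H].
have E1 : Phi y = phi i y by rewrite -xy; apply: PhiE => //; rewrite xy.
have E2 : Phi y' = phi i y' by rewrite -xy'; apply: PhiE => //; rewrite xy'.
by rewrite E1 E2.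
Qed.

Let Phi_sel y : `|y0 - y| < rho -> exists i, Phi y = phi i y.
Proof.
move=> yb; have [x [cx xy _ [i Pix]]] := ball_pt yb; exists i.
by rewrite -xy; apply: PhiE => //; rewrite xy.
Qed.

Lemma trivialization : exists (U : set N) (F : N -> V),
  [/\ open U, U x0, forall x, U x -> [/\ cdom c x, `|y0 - cmap c x| < rho & M x],
      pw_C1_diffeo T U F &
      forall i x, (U `&` Pi i) x -> exists2 L, restr_diff (U `&` Pi i) F x L &
        forall a : 'I_k, exists2 j : 'I_n, a = j :> nat & forall v, L v 0 j =
          \sum_l g i (cmap c x) (lshift 1 a) (lshift 1 l) * pairing (al i l x) v].
Proof.
have [r r0 [rb inj opn Jinj]] :=
  @pw_inverse_function R n m ball Phi phi Jm y0 ball_open y0_ball Phi_cont Phi_sel phi_diff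
  (fun i => @Jm_cont i y0 y0_ball) Jm_hull.
pose Q := [set y : V | `|y0 - y| < r].
have oQ : open Q by exact: norm_ball_open.
pose U := cdom c `&` cmap c @^-1` Q.
have oU : open U by exact: chart_preimg_open.
have UP x : U x -> [/\ cdom c x, `|y0 - cmap c x| < rho & M x].
  move=> [cx xr]; have xb := rb _ xr; split=> //.
  by have [z [cz zx Mz _]] := ball_pt xb; rewrite -(chartK cx) -zx chartK.
pose F := Phi \o cmap c.
have FE i x : U x -> Pi i x -> F x = phi i (cmap c x).
  by move=> /UP[cx xb _]; exact: PhiE.
have oF (W : set N) : open W -> W `<=` U -> open (F @` W).
  move=> oW WU; have -> : F @` W = Phi @` (cmap c @` (W `&` cdom c)).
    apply/seteqP; split=> [_ [x Wx <-]|_ [_ [x [Wx _] <-] <-]]; last by exists x.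
    by exists (cmap c x) => //; exists x => //; split=> //; have [] := WU x Wx.
  apply: opn; first exact: chart_img_open.
  by move=> _ [x [Wx _] <-]; have [] := WU x Wx.
have injF : {in U &, injective F}.
  move=> x z; rewrite !inE => -[cx xr] [cz zr] /inj E.
  by rewrite -(chartK cx) -(chartK cz) E.
have cF x : U x -> {for x, continuous F}.
  move=> Ux; have [cx xb _] := UP x Ux.
  by apply: continuous_comp; [exact: cmap_cont|exact: Phi_cont].
have withinF S : S `<=` U -> {within S, continuous F}.
  by move=> SU; apply: continuous_in_subspaceT => x /set_mem/SU; exact: cF.
have diffF i x : U x -> Pi i x ->
    restr_diff (U `&` Pi i) F x (diff_from (phi i \o cmap c) x).
  move=> Ux Pix; exists U, (phi i \o cmap c); split=> //.
    move=> c' ac'; apply: (Cr_chart (Q := ball)) => //.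
    by move=> z /UP[cz zb _].
  by move=> z [_ [Uz Piz]]; rewrite (FE i z).
have diffE i x v : U x -> diff_from (phi i \o cmap c) x v = tangent_to c x v *m Jm i (cmap c x).
  move=> /UP[cx xb _]; have [D E] := phi_diff i xb.
  by rewrite (diff_from_chart v c_atlas cx D) E.
exists U, F; split=> //.
- by split=> //; rewrite /Q /preimage/= subrr normr0.
- split=> //; first exact: withinF.
  move=> P [PP dP]; split.
    split; first by apply: withinF => x [].
      by move=> x z; rewrite !inE => -[Ux _] [Uz _]; apply: injF; rewrite inE.
    move=> W oW; exists (F @` (U `&` W)); first by apply: oF; [exact: openI|move=> x []].
    apply/seteqP; split=> [_ [x [[Ux Px] Wx] <-]|_ [[x [Ux Px] <-] [z [Uz Wz] zx]]].
      by split; exists x.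
    have E : z = x by apply: injF; rewrite ?inE.
    by exists x => //; rewrite -E in Ux Px *; split.
  move=> x [Ux Px]; have [cx xb _] := UP x Ux.
  (* The embedding property concerns all top-dimensional polytopes; one that meets [U] contains [x0]
     and is therefore some [Pi i]. *)
  have Px0 := ball_poly cx xb PP Px.
  have [i Pi_] := (Pi_top P).1 (conj (conj PP dP) Px0).
  rewrite Pi_ in Px *; exists (diff_from (phi i \o cmap c) x); first exact: diffF.
  move=> u v; rewrite !diffE// => E; apply: (tangent_to_inj c_atlas cx).
  apply/eqP; rewrite -subr_eq0; apply/eqP; apply: (Jinj i (cmap c x)).
    by have [_] := Ux.
  by rewrite mulmxBl E subrr.
- move=> i x [Ux Pix]; exists (diff_from (phi i \o cmap c) x); first exact: diffF.
  move=> a; exists (Ordinal (leq_trans (ltn_ord a) kn)) => // v.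
  have [cx xb _] := UP x Ux.
  (* The last row of the block form is zero, so its summand drops out and [G alpha] remains. *)
  rewrite diffE// (Jm_low _ _ _ (a := a))// mxE big_split_ord/= big_ord1.
  rewrite [X in _ + _ * X]mxE /Om block_formr pullback0 mulr0 addr0.
  by apply: eq_bigr => l _; congr (_ * _); exact: pairing_conn.
Qed.

End Trivialize.

(** * The cut-off annihilator *)

Lemma unitmx_near_id (R : realType) k (X : 'M[R]_k) : k%:R * `|X| <= 1 / 2 ->
  1%:M + X \in unitmx.
Proof.
move=> Xs; rewrite -row_free_unit -kermx_eq0; apply: contraT => /rowV0Pn[v /sub_kermxP vX v0].
move: vX; rewrite mulmxDr mulmx1 => /eqP; rewrite addr_eq0 => /eqP vE.
have : `|v| <= `|v| / 2.
  rewrite {1}vE normrN (le_trans (mx_norm_mul _ _))//.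
  by rewrite mulrAC mulrC ler_wpM2l//; rewrite mul1r in Xs.
have : 0 < `|v| by rewrite normr_gt0.
lra.
Qed.

(** The equation expresses the derivative of [g] through [g] and the forms, so mere
    differentiability of [g] already makes that derivative continuous. *)
Lemma frame_entry_C1 (R : realType) n (N : smoothManifold R n) (c : chart R n N) p
    (Om : 'I_p -> 'I_p -> oneform N) (g : 'rV[R]_n -> 'M[R]_p) (O : set 'rV[R]_n) :
  open O ->
  (forall a b v, Cr_on 1 O ((fun y => pullback (cinv c) (Om a b) y v) : 'rV[R]_n -> R^o)) ->
  (forall y, O y -> is_diff y g (fun v => g y *m conn_matrix c Om y v)) ->
  forall a b, Cr_on 1 O ((fun y => g y a b) : 'rV[R]_n -> R^o).
Proof.
move=> oO CO gd a b; split=> [y Oy|v].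
  by have [] := is_diff_entry a b (gd y Oy).
apply: (@Cr_on_ext _ _ _ 0 _
  (\sum_l ((fun y => g y a l * pullback (cinv c) (Om l b) y v) : 'rV[R]_n -> R^o))).
- exact: oO.
- move=> y Oy; have [_ E] := is_diff_entry a b (gd y Oy).
  apply: etrans _ (esym (congr1 (fun h : 'rV[R]_n -> R => h v) E)).
  rewrite fct_sumE [RHS]mxE; apply: eq_bigr => l _.
  by rewrite [X in _ = _ * X]mxE.
move=> y Oy; apply: (big_ind (fun f : 'rV[R]_n -> R^o => {for y, continuous f})).
- exact: cst_continuous.
- by move=> f h cf ch; exact: continuousD.
move=> l _; apply: continuousM.
  have [D _] := gd y Oy.
  exact: continuous_comp (differentiable_continuous D) (@coord_continuous _ _ _ _ _ _).
by apply: differentiable_continuous; have [H _] := CO l b v; exact: H.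
Qed.

(** The interpolation [1 + psi (G - 1)] stays invertible because multiplying [G - 1] by [psi] in the
    unit interval preserves the smallness that [unitmx_near_id] requires. *)
Lemma cutoff_frame (R : realType) n (N : smoothManifold R n) (c : chart R n N) (x0 : N) k
    (G : 'rV[R]_n -> 'M[R]_k) (r : R) :
  atlas c -> cdom c x0 -> 0 < r ->
  (forall y, `|cmap c x0 - y| < r -> (cmap c @` cdom c) y) ->
  (forall a b, Cr_on 1 [set y | `|cmap c x0 - y| < r] ((fun y => G y a b) : _ -> R^o)) ->
  (forall y, `|cmap c x0 - y| < r -> k%:R * `|G y - 1%:M| <= 1 / 2) ->
  exists (r' : R) (h : N -> 'M[R]_k), [/\ 0 < r', forall x, h x \in unitmx,
    forall x, cdom c x -> `|cmap c x0 - cmap c x| < r' -> h x = G (cmap c x) &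
    forall x, exists W, [/\ open W, W x & forall c' a b, atlas c' ->
      Cr_on 1 (cmap c' @` (W `&` cdom c')) (((fun z => h z a b) \o cinv c') : 'rV[R]_n -> R^o)]].
Proof.
move=> ac cx0 r0 ball_in CG Gs; set y0 := cmap c x0 in ball_in CG Gs *.
have r2 : 0 < r / 2 by rewrite divr_gt0.
have [psi [Cpsi psi01 [r' r'0 psi1] psi0]] := bump_function y0 r2.
pose H y : 'M[R]_k := 1%:M + psi y *: (G y - 1%:M).
pose h x : 'M[R]_k := if pselect (cdom c x) is left _ then H (cmap c x) else 1%:M.
have hE x : cdom c x -> h x = H (cmap c x) by rewrite /h; case: pselect.
have h1 x : (cdom c x -> r / 2 <= `|y0 - cmap c x|) -> h x = 1%:M.
  rewrite /h; case: pselect => // cx /(_ cx)/psi0; rewrite /H => ->.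
  by rewrite scale0r addr0.
have oB : open [set y | `|y0 - y| < r] := norm_ball_open y0 r.
have CH a b : Cr_on 1 [set y | `|y0 - y| < r] ((fun y => H y a b) : _ -> R^o).
  have C1 : Cr_on 1 [set y | `|y0 - y| < r] psi := Cr_on_sub (@subsetT _ _) Cpsi.
  have C2 : Cr_on 1 [set y | `|y0 - y| < r]
      ((fun y => G y a b + - (1%:M : 'M[R]_k) a b) : _ -> R^o).
    exact: (Cr1D oB (CG a b) (@Cr_on_cst R _ R^o _ (- (1%:M : 'M[R]_k) a b) 1)).
  have C3 := Cr1D oB (@Cr_on_cst R _ R^o _ ((1%:M : 'M[R]_k) a b) 1) (Cr1M oB C1 C2).
  apply: (Cr_on_ext oB _ C3) => y _.
  by apply: esym; rewrite /H mxE [X in _ + X]mxE mx_subE.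
exists r', h; split=> //.
- move=> x; have [[cx xr]|nx] := pselect (cdom c x /\ `|y0 - cmap c x| < r); last first.
    rewrite h1 ?unitmx1// => cx; have [//|xr] := leP (r / 2) `|y0 - cmap c x|.
    by exfalso; apply: nx; split=> //; lra.
  rewrite hE//; apply: unitmx_near_id; apply: le_trans (Gs _ xr); rewrite ler_wpM2l//.
  rewrite normrZ; have /andP[p0 p1] := psi01 (cmap c x).
  by rewrite ger0_norm// ler_piMl.
- by move=> x cx xr; rewrite hE// /H psi1// scale1r addrC subrK.
move=> x; have [[cx xr]|nx] := pselect (cdom c x /\ `|y0 - cmap c x| < r).
  exists (cdom c `&` cmap c @^-1` [set y | `|y0 - y| < r]); split=> //.
    exact: chart_preimg_open.
  move=> c' a b ac'.
  have oW := @chart_preimg_open _ _ _ c _ oB.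
  apply: (@Cr_on_ext _ _ _ 1 _ ((((fun y => H y a b) : _ -> R^o) \o cmap c) \o cinv c')).
  - exact: chart_img_open.
  - by move=> _ [z [[cz zr] c'z] <-] /=; rewrite chartK// hE.
  - by apply: (Cr_chart (Q := [set y | `|y0 - y| < r])).
(* The cutoff vanishes from radius [r / 2] on, so [h] differs from 1 only in the image of a closed
   ball inside the chart; this image is compact, hence closed because [N] is Hausdorff. *)
pose K := cinv c @` [set y | `|y0 - y| <= r / 2].
have Kin y : `|y0 - y| <= r / 2 -> (cmap c @` cdom c) y.
  by move=> yr; apply: ball_in; lra.
have cK : closed K.
  apply: compact_closed; first exact: carrier_hausdorff.
  apply: continuous_compact; last exact: closed_ball_rV_compact.
  apply: continuous_in_subspaceT => y /set_mem /Kin[z cz <-]; exact: cinv_cont.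
have nK z : (~` K) z -> h z = 1%:M.
  move=> nKz; apply: h1 => cz; rewrite leNgt; apply/negP => zr; apply: nKz.
  by exists (cmap c z); [exact: ltW|rewrite chartK].
exists (~` K); split.
- exact: closed_openC.
- move=> [y yr yx]; apply: nx; have [z cz zy] := Kin y yr.
  have xz : x = z by rewrite -yx -zy chartK.
  by rewrite xz zy; split=> //; move: yr => /=; lra.
move=> c' a b ac'.
apply: (@Cr_on_ext _ _ _ 1 _ (cst ((1%:M : 'M[R]_k) a b : R^o))).
- by apply: chart_img_open; exact: closed_openC.
- by move=> _ [z [nKz c'z] <-] /=; rewrite chartK// nK.
- exact: Cr_on_cst.
Qed.

Lemma form_Cr_sub (R : realType) n (N : smoothManifold R n) r (W W' : set N) (w : oneform N) :
  W `<=` W' -> form_Cr r W' w -> form_Cr r W w.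
Proof.
move=> WW' H c ac v; apply: Cr_on_sub (H c ac v).
by move=> _ [x [Wx cx] <-]; exists x => //; split=> //; exact: WW'.
Qed.

Lemma restr_C1_pfaffian_comb (R : realType) n (N : smoothManifold R n) k (P : set N)
    (a : 'I_k -> oneform N) (h : N -> 'M[R]_k) :
  restr_C1_pfaffian P a -> (forall x, h x \in unitmx) ->
  (forall x, exists W, [/\ open W, W x & forall c' i j, atlas c' ->
      Cr_on 1 (cmap c' @` (W `&` cdom c')) (((fun z => h z i j) \o cinv c') : 'rV[R]_n -> R^o)]) ->
  restr_C1_pfaffian P (fun i x => \sum_l h x i l *: a l x).
Proof.
move=> [ai ac] uh Ch; split=> [x Px|i x Px].
  exact: free_comb (uh x) (ai x Px).
have [Wh [oWh Whx CWh]] := Ch x.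
have /choice[f Hf] : forall l, exists Ww : set N * oneform N,
    [/\ open Ww.1, Ww.1 x, form_Cr 1 Ww.1 Ww.2 & forall z, (Ww.1 `&` P) z -> Ww.2 z = a l z].
  by move=> l; have [W [w [H1 H2 H3 H4]]] := ac l x Px; exists (W, w).
pose W1 := [set z | forall l, (f l).1 z]°.
have W1sub l : W1 `<=` (f l).1 by move=> z /interior_subset; apply.
have W1x : W1 x.
  apply: filter_forall => l; apply: open_nbhs_nbhs; by have [] := Hf l.
have oW : open (Wh `&` W1) by apply: openI => //; exact: open_interior.
exists (Wh `&` W1), (fun z => \sum_l h z i l *: (f l).2 z); split=> //.
- apply: form_Cr1_comb => // l.
    move=> c ac'; apply: Cr_on_sub (CWh c i l ac').
    by move=> _ [z [[Whz _] cz] <-]; exists z.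
  have [_ _ H _] := Hf l; apply: form_Cr_sub H.
  by move=> z [_]; exact: W1sub.
- move=> z [[_ W1z] Pz]; apply: eq_bigr => l _; congr (_ *: _).
  by have [_ _ _] := Hf l; apply; split=> //; exact: W1sub.
Qed.

Lemma annihilator_comb (R : realType) n (N : smoothManifold R n) k (a : 'I_k -> oneform N)
    (H : 'M[R]_k) (x : N) v : H \in unitmx ->
  (forall i, pairing (\sum_l H i l *: a l x) v = 0) <-> (forall i, pairing (a i x) v = 0).
Proof.
move=> uH.
have E i : pairing (\sum_l H i l *: a l x) v = \sum_l H i l * pairing (a l x) v.
  rewrite /pairing mulmx_sumr summxE; apply: eq_bigr => l _.
  by rewrite -scalemxAr mxE.
split=> K i; last by rewrite E big1// => l _; rewrite K mulr0.
have H0 : H *m (\col_l pairing (a l x) v) = 0.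
  apply/colP => j; rewrite [RHS]mxE -(K j) E mxE.
  by apply: eq_bigr => l _; rewrite mxE.
have := congr1 (mulmx (invmx H)) H0; rewrite mulKmx// mulmx0 => /colP/(_ i).
by rewrite !mxE.
Qed.

(** * From sets of polytopes to finite families, and the assembly *)

Lemma finite_set_enum (T : eqType) (A : set T) : finite_set A ->
  exists m (f : 'I_m -> T), injective f /\ A = range f.
Proof.
move=> /finite_seqP[s ->]; exists (size (undup s)), (tnth (in_tuple (undup s))); split.
  by apply/tuple_uniqP; exact: undup_uniq.
apply/seteqP; split=> [t /=|_ [i _ <-] /=].
  rewrite -mem_undup => /(tnthP (in_tuple (undup s)))[i ->].
  by exists i.
by rewrite -mem_undup; exact: (mem_tnth i (in_tuple (undup s))).
Qed.

(** A bridge between two indexings: ordinals for the finitely many polytopes at [x0], arbitrary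
    subsets of [N] in the definitions. *)
Lemma extend_family (I T X : Type) (f : I -> T) (g : I -> X) (x : X) : injective f ->
  exists G : T -> X, (forall i, G (f i) = g i) /\ forall t, ~ range f t -> G t = x.
Proof.
move=> fI.
exists (fun t => if pselect (exists i, f i = t) is left H then g (projT1 (cid H)) else x).
split=> [i|t nt]; case: pselect => //.
- by move=> H; case: cid => j /= /fI ->.
- by move=> H; exfalso; apply: H; exists i.
- by move=> [i ft]; exfalso; apply: nt; exists i.
Qed.

(** Condition 3 in the form that the Jacobians use: a linear map preserving the dimension of [V] has
    no kernel in [V]. The weights are moved from polytopes to ordinals. *)
Lemma hull_kernel (R : realType) n k (N : smoothManifold R n) (S : set (set N)) m
    (Pi : 'I_m -> set N) (a : set N -> 'I_k -> 'cV[R]_n) (V : {vspace 'rV[R]_n}) :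
  injective Pi -> S = range Pi -> \dim V = k ->
  (forall c : set N -> R, (forall P, S P -> 0 <= c P) -> \sum_(P \in S) c P = 1 ->
    \dim (linfun (fun v : 'rV[R]_n =>
      \sum_(P \in S) c P *: (\row_i pairing (a P i) v : 'rV[R]_k)) @: V)%VS = k) ->
  forall (s : 'rV[R]_m) (w : 'rV[R]_n), simplex s -> w \in V ->
    (forall i, \sum_j s 0 j * pairing (a (Pi j) i) w = 0) -> w = 0.
Proof.
move=> PiI SE dV H s w [s0 s1] wV sw.
have [c [cPi _]] := extend_family (fun i => s 0 i) 0 PiI.
have sumE (X : zmodType) (F : set N -> X) : \sum_(P \in S) F P = \sum_i F (Pi i).
  rewrite SE fsbig_image; last by move=> i j _ _ /PiI.
  rewrite (fsbigE (index_enum 'I_m)) ?index_enum_uniq//; last by move=> i; rewrite mem_index_enum.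
  by apply: eq_bigl => i; rewrite in_setT.
have c0 P : S P -> 0 <= c P by rewrite SE => -[i _ <-]; rewrite cPi.
have c1 : \sum_(P \in S) c P = 1.
  by rewrite sumE -s1; apply: eq_bigr => i _; rewrite cPi.
have := H c c0 c1.
set L := fun v : 'rV[R]_n => _ => dimL.
have LE v : L v = v *m (\sum_j s 0 j *: \matrix_(l, i) a (Pi j) i l 0).
  rewrite /L sumE mulmx_sumr; apply: eq_bigr => j _.
  rewrite cPi -scalemxAr; congr (_ *: _); apply/rowP => i; rewrite [LHS]mxE /pairing !mxE.
  by apply: eq_bigr => l _; rewrite mxE.
have Leq : L = mulmxr (\sum_j s 0 j *: \matrix_(l, i) a (Pi j) i l 0).
  by apply/funext => v; exact: LE.
apply: (lker_inj (etrans dimL (esym dV)) wV).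
rewrite Leq lfunE /= -LE /L sumE; apply/rowP => i.
rewrite summxE [RHS]mxE -[RHS](sw i); apply: eq_bigr => j _.
by rewrite cPi !mxE.
Qed.

Theorem theorem5 (R : realType) (n k : nat) (N : smoothManifold R n)
  (M : set N) (T : mesh M) (alpha : set N -> 'I_k -> oneform N)
  (alpha_pfaffian : pw_C1_pfaffian T alpha)
  (x0 : N) (x0_in_M : M° x0)
  (* condition 1 *)
  (U : set N) (U_open : open U) (U_x0 : U x0) (U_M : U `<=` M)
  (alphaU : set N -> 'I_k -> oneform N)
  (A : set N -> 'I_k -> 'I_k -> oneform N)
  (alphaU_extends : forall P, top_at T x0 P ->
     forall i x, (U `&` P) x -> alphaU P i x = alpha P i x)
  (alphaU_C1 : forall P, top_at T x0 P -> C1_pfaffian_on U (alphaU P))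
  (A_smooth : forall P, top_at T x0 P -> forall i j, form_smooth U (A P i j))
  (structure_eq : forall P, top_at T x0 P -> forall i x, U x -> forall v1 v2,
     ext_d (alphaU P i) x v1 v2 =
     - \sum_(j < k) wedge (A P i j) (alphaU P j) x v1 v2)
  (flatness : forall P, top_at T x0 P -> forall i j x, U x -> forall v1 v2,
     ext_d (A P i j) x v1 v2
     + \sum_(l < k) wedge (A P i l) (A P l j) x v1 v2 = 0)
  (* condition 2 *)
  (compatible : forall D P P', polys T D -> D x0 ->
     top_polys T P -> top_polys T P' -> mesh_face T P D -> mesh_face T P' D ->
     (forall i, pullback_eq T U D (alphaU P i) (alphaU P' i)) /\
     (forall i j, pullback_eq T U D (A P i j) (A P' i j)))
  (* condition 3 *)
  (full_rank : exists2 V : {vspace 'rV[R]_n}, \dim V = k &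
     forall c : set N -> R,
       (forall P, top_at T x0 P -> 0 <= c P) ->
       \sum_(P \in top_at T x0) c P = 1 ->
       \dim (linfun (fun v : 'rV[R]_n =>
               \sum_(P \in top_at T x0) c P *: form_map (alpha P) x0 v)
             @: V)%VS = k) :
  completely_integrable T k (ker_form alpha) x0.
Proof.
have [ftop [W0 [oW0 W0x0 W0M W0poly W0top]]] := top_at_nbhs T x0_in_M.
have [m [Pi [PiI topE]]] := finite_set_enum ftop.
have top i : top_at T x0 (Pi i) by rewrite topE; exists i.
set c := chart_at x0; set y0 := cmap c x0.
have ac : atlas c := chart_at_atlas x0.
have cx0 : cdom c x0 := chart_at_dom x0.
pose Om i := block_form (A (Pi i)) (alphaU (Pi i)).
have Om_C1 i a b : form_Cr 1 U (Om i a b).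
  apply: block_form_C1; first by move=> p q; exact: A_smooth.
  by have [_] := alphaU_C1 _ (top i).
have Om_flat i := block_form_flat (structure_eq _ (top i)) (flatness _ (top i)).
have /choice[rg frame] : forall i, exists rg : R * ('rV[R]_n -> 'M[R]_(k + 1)),
    [/\ 0 < rg.1, forall y, `|y0 - y| < rg.1 -> (cmap c @` (U `&` cdom c)) y,
      rg.2 y0 = 1%:M & forall y, `|y0 - y| < rg.1 ->
      is_diff y rg.2 (fun v => rg.2 y *m conn_matrix c (Om i) y v)].
  move=> i; have [r [g Q]] := flat_frame_form ac U_open U_x0 cx0 (Om_C1 i) (Om_flat i).
  by exists (r, g).
have agree i j : exists W, [/\ open W, W x0 &
    forall x, W x -> (Pi i `&` Pi j) x -> (rg i).2 (cmap c x) = (rg j).2 (cmap c x)].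
  have [[Pi_poly _] Pix0] := top i; have [[Pj_poly _] Pjx0] := top j.
  (* The intersection contains [x0], so it is a common face and itself a polytope of the mesh, to
     which condition 2 applies. *)
  have [fi fj] := mesh_inter Pi_poly Pj_poly (ex_intro _ x0 (conj Pix0 Pjx0)).
  have D_poly := mesh_faces Pi_poly fi.
  have DE := mesh_image D_poly; set D := Pi i `&` Pi j in fi fj D_poly DE *.
  have [p0 Pp0 fp0] : (cparam (mcell T D) @` cmodel (mcell T D)) x0 by rewrite -DE.
  have [HA Hal] := compatible _ _ _ D_poly (conj Pix0 Pjx0) (top i).1 (top j).1 fi fj.
  have [ri0 _ gi0 gid] := frame i; have [rj0 _ gj0 gjd] := frame j.
  have r0 : 0 < Num.min (rg i).1 (rg j).1 by rewrite lt_min ri0.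
  rewrite DE; apply: (frame_agree ac U_open U_x0 cx0 (Om_C1 i) (cparam_embedding (mcell T D))
    (cmodel_polytope (mcell T D)) Pp0 fp0 r0 (etrans gi0 (esym gj0))).
  - by move=> y; rewrite lt_min => /andP[yi _]; exact: gid.
  - by move=> y; rewrite lt_min => /andP[_ yj]; exact: gjd.
  move=> q Pq Uq v a b; rewrite /Om.
  case: (split_ordP a) => a' ->; last by rewrite !block_formr.
  case: (split_ordP b) => b' ->; first by rewrite !block_formll; exact: Hal.
  by rewrite !block_formlr; exact: HA.
have ball_in (O : set N) : open O -> O x0 -> exists2 d : R, 0 < d &
    forall y, `|y0 - y| < d -> (cmap c @` (O `&` cdom c)) y.
  move=> oO Ox0; apply: (open_forP _).1; first exact: chart_img_open.
  by exists x0.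
have near_id i : exists2 d : R, 0 < d & forall y, `|y0 - y| < d ->
    k%:R * `|ulsubmx ((rg i).2 y) - 1%:M| <= 1 / 2.
  have [r0 _ g0 gd] := frame i.
  have e0 : 0 < 1 / 2 / (k%:R + 1) :> R by rewrite divr_gt0// ltr_wpDl.
  have [gdf _] : is_diff y0 (rg i).2 _ := gd y0 (eq_ind_r (fun z => z < _) r0
    (etrans (congr1 Num.norm (subrr y0)) (normr0 _))).
  have [d d0 Hd] := (continuous_forP _ _).1 (differentiable_continuous gdf) _ e0.
  exists d => // y /Hd; rewrite g0 distrC => /ltW gy.
  have : `|ulsubmx ((rg i).2 y) - 1%:M| <= 1 / 2 / (k%:R + 1).
    apply: mx_norm_le => [|a b]; first exact: ltW.
    apply: le_trans gy; apply: le_trans (mx_entry_le _ (lshift 1 a) (lshift 1 b)).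
    by rewrite !mx_subE !mxE (inj_eq (@lshift_inj _ _)).
  move=> /(ler_wpM2l (ler0n _ k))/le_trans; apply.
  by rewrite mulrCA ler_piMr// ler_pdivrMr ?ltr_wpDl// mul1r lerDl.
have [d0 d0_gt0 d0P] := ball_in W0 oW0 W0x0.
have [d1 d1_gt0 d1P] : exists2 d : R, 0 < d & forall i, d <= (rg i).1.
  apply: fin_min => [i d d' dd'|i]; first exact: le_trans.
  by have [r0 _ _ _] := frame i; exists (rg i).1.
have [d2 d2_gt0 d2P] : exists2 d : R, 0 < d & forall i y, `|y0 - y| < d ->
    k%:R * `|ulsubmx ((rg i).2 y) - 1%:M| <= 1 / 2.
  apply: fin_min => [i d d' dd' H y yd'|i]; last exact: near_id.
  exact: H (lt_le_trans yd' dd').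
have [d3 d3_gt0 d3P] : exists2 d : R, 0 < d & forall (ij : 'I_m * 'I_m) x, cdom c x ->
    `|y0 - cmap c x| < d -> (Pi ij.1 `&` Pi ij.2) x ->
    (rg ij.1).2 (cmap c x) = (rg ij.2).2 (cmap c x).
  apply: fin_min => [ij d d' dd' H x cx xd'|ij]; first exact: H (lt_le_trans xd' dd').
  have [W [oW Wx0 HW]] := agree ij.1 ij.2; have [d d_gt0 dP] := ball_in W oW Wx0.
  exists d => // x cx /dP[z [Wz cz] zx]; apply: HW.
  by rewrite -(chartK cx) -zx chartK.
(* Two radii are needed: on [rho1] all frames exist and are near the identity, which permits the
   cutoff; the smaller [rho] also lies where the cutoffs equal [G], and that region depends on
   [rho1]. *)
pose rho1 := Num.min d1 d2.
have rho1_gt0 : 0 < rho1 by rewrite lt_min d1_gt0.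
have ball1U (i : 'I_m) y : `|y0 - y| < rho1 -> (cmap c @` (U `&` cdom c)) y.
  rewrite lt_min => /andP[yd1 _]; have [_ H _ _] := frame i.
  exact: H (lt_le_trans yd1 (d1P i)).
have g_diff i y : `|y0 - y| < rho1 ->
    is_diff y (rg i).2 (fun v => (rg i).2 y *m conn_matrix c (Om i) y v).
  rewrite lt_min => /andP[yd1 _]; have [_ _ _ H] := frame i.
  exact: H (lt_le_trans yd1 (d1P i)).
have Om_ball i a b v : Cr_on 1 [set y | `|y0 - y| < rho1]
    ((fun y => pullback (cinv c) (Om i a b) y v) : 'rV[R]_n -> R^o).
  by apply: Cr_on_sub (Om_C1 i a b c ac v) => y; exact: ball1U.
have /choice[rh cutoff] : forall i, exists rh : R * (N -> 'M[R]_k),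
    [/\ 0 < rh.1, forall x, rh.2 x \in unitmx,
    forall x, cdom c x -> `|y0 - cmap c x| < rh.1 -> rh.2 x = ulsubmx ((rg i).2 (cmap c x)) &
    forall x, exists W, [/\ open W, W x & forall c' a b, atlas c' ->
      Cr_on 1 (cmap c' @` (W `&` cdom c')) (((fun z => rh.2 z a b) \o cinv c') : 'rV[R]_n -> R^o)]].
  move=> i.
  have [|||r' [h Q]] := @cutoff_frame R n N c x0 k (fun y => ulsubmx ((rg i).2 y)) rho1 ac cx0 rho1_gt0.
  - by move=> y /(ball1U i)[x [_ cx] <-]; exists x.
  - move=> a b; apply: (@Cr_on_ext _ _ _ 1 _ ((fun y => (rg i).2 y (lshift 1 a) (lshift 1 b)) : _ -> R^o)).
    + exact: norm_ball_open.
    + by move=> y _; rewrite [RHS]mxE [RHS]mxE.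
    + exact: (frame_entry_C1 (norm_ball_open y0 rho1) (Om_ball i) (g_diff i)).
  - move=> y; rewrite lt_min => /andP[_ yd2]; exact: d2P.
  by exists (r', h).
have [d4 d4_gt0 d4P] : exists2 d : R, 0 < d & forall i, d <= (rh i).1.
  apply: fin_min => [i d d' dd'|i]; first exact: le_trans.
  by have [r0 _ _ _] := cutoff i; exists (rh i).1.
pose rho := Num.min rho1 (Num.min d0 (Num.min d3 d4)).
have rho_gt0 : 0 < rho by rewrite !lt_min d1_gt0 d2_gt0 d0_gt0 d3_gt0.
have rhoP y : `|y0 - y| < rho -> [/\ `|y0 - y| < rho1, `|y0 - y| < d0, `|y0 - y| < d3 & `|y0 - y| < d4].
  by rewrite !lt_min => /andP[-> /and3P[-> -> ->]].
have ballW x : cdom c x -> `|y0 - cmap c x| < rho -> W0 x.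
  by move=> cx /rhoP[_ /d0P[z [Wz cz] zx] _ _]; rewrite -(chartK cx) -zx chartK.
have [V dV fullV] := full_rank.
have [kn [Z Zin]] := complement_coordinates dV.
(* On polytopes that do not contain [x0] the factor is the identity, so the annihilator is [alpha]
   itself there. *)
have [Hm [HmPi HmN]] := extend_family (fun i => (rh i).2) (fun=> 1%:M) PiI.
have Hm_unit P x : Hm P x \in unitmx.
  have [[i _ <-]|/HmN ->] := pselect (range Pi P); last exact: unitmx1.
  by rewrite HmPi; have [_ H _ _] := cutoff i.
have Hm_C1 P x : exists W, [/\ open W, W x & forall c' a b, atlas c' ->
      Cr_on 1 (cmap c' @` (W `&` cdom c')) (((fun z => Hm P z a b) \o cinv c') : 'rV[R]_n -> R^o)].
  have [[i _ <-]|/HmN ->] := pselect (range Pi P).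
    by rewrite HmPi; have [_ _ _ H] := cutoff i.
  exists setT; split=> // [|c' a b _]; first exact: openT.
  exact: (@Cr_on_cst R _ R^o _ ((1%:M : 'M[R]_k) a b) 1).
exists (fun P a x => \sum_l Hm P x a l *: alpha P l x); split.
- by move=> P tP; apply: restr_C1_pfaffian_comb => //; exact: alpha_pfaffian.
- move=> P tP x Px; apply/seteqP; split=> v /=.
    exact: (@annihilator_comb R n N k (alpha P) (Hm P x) x v (Hm_unit P x)).1.
  exact: (@annihilator_comb R n N k (alpha P) (Hm P x) x v (Hm_unit P x)).2.
have Pi_top P : top_at T x0 P <-> exists i, P = Pi i.
  by rewrite topE; split=> [[i _ <-]|[i ->]]; exists i.
have ball_pt y : `|y0 - y| < rho -> exists x, [/\ cdom c x, cmap c x = y, M x & exists i, Pi i x].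
  move=> /rhoP[_ /d0P[x [Wx cx] xy] _ _]; exists x; split=> //; first exact: W0M.
  by have [P] := W0top x Wx; rewrite topE => -[i _ <-] Px; exists i.
have ball_poly x D : cdom c x -> `|y0 - cmap c x| < rho -> polys T D -> D x -> D x0.
  by move=> cx xr tD; apply: W0poly => //; exact: ballW.
have agree_ball i j x : cdom c x -> `|y0 - cmap c x| < rho -> Pi i x -> Pi j x ->
    (rg i).2 (cmap c x) = (rg j).2 (cmap c x).
  by move=> cx /rhoP[_ _ xd3 _] Pix Pjx; exact: (d3P (i, j)).
have rho_rho1 y : `|y0 - y| < rho -> `|y0 - y| < rho1 by move=> /rhoP[].
(* Condition 3 is stated for [alpha] and the Jacobians involve its extension [alphaU]; the two agree
   at [x0], which lies in every [Pi i]. *)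
have full (s : 'rV[R]_m) (w : 'rV[R]_n) : simplex s ->
    (forall j : 'I_n, (k <= j)%N -> (w *m Z) 0 j = 0) ->
    (forall a, \sum_i s 0 i * pairing (alphaU (Pi i) a x0) w = 0) -> w = 0.
  move=> Hs wZ Hw; apply: (hull_kernel PiI topE dV fullV Hs (Zin _ wZ)) => a.
  rewrite -[RHS](Hw a); apply: eq_bigr => i _.
  by rewrite alphaU_extends//; split=> //; have [] := top i.
have Om_rho i a b v := Cr_on_sub rho_rho1 (Om_ball i a b v).
have g_rho i y (yr : `|y0 - y| < rho) := g_diff i y (rho_rho1 y yr).
have g_y0 i : (rg i).2 y0 = 1%:M by have [] := frame i.
have [U' [F [oU' U'x0 U'in FT FL]]] := trivialization rho_gt0 Pi_top ball_pt ball_poly agree_ball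
  Om_rho g_rho g_y0 kn full.
exists U', F; split=> // [x /U'in[]//|P].
rewrite topE => -[i _ <-] x U'Px; have [cx xr _] := U'in x U'Px.1.
have [L FxL LE] := FL i x U'Px; exists L => // a; have [j aj Lj] := LE a.
exists j => // v; rewrite Lj HmPi /pairing mulmx_sumr summxE; apply: eq_bigr => l _.
have [r1 _ _ xd4] := rhoP _ xr.
have [_ _ hE _] := cutoff i; rewrite hE//; last exact: lt_le_trans xd4 (d4P i).
have Ux : U x.
  by have [z [Uz cz] zx] := ball1U i _ r1; rewrite -(chartK cx) -zx chartK.
rewrite alphaU_extends; [|exact: top|by split=> //; case: U'Px].
by rewrite -scalemxAr mxE !mxE.
Qed.
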